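(* Let $n>2$, $f\in\tilde C^\infty_e(S^n)$, and $\lambda_n=\frac{(-1)^{[n/2-1]}\Gamma((n-1)/2)\Gamma(n/2)}{8\pi^{n-1/2}(n-2)!}$. Then for every $x=(x',x_{n+1})\in S^n$ with $|x'|<1$: (i) if $n$ is odd, \[ f(x)=\lambda_n|x_{n+1}|(-\Delta)\int_{S^{n-1}}\frac{d^{n-3}}{dt^{n-3}}\big[(Vf)(\theta,t)(1-t^2)^{-1/2}\big]\Big|_{t=\theta\cdot x'}\,d\sigma(\theta); \] (ii) if $n$ is even, \[ f(x)=\frac{\lambda_n}{\pi}|x_{n+1}|\,\Delta\int_{S^{n-1}}d\sigma(\theta)\int_{-1}^1\frac{d^{n-2}}{dt^{n-2}}\big[(Vf)(\theta,t)(1-t^2)^{-1/2}\big]\log|t-\theta\cdot x'|\,dt, \] where $\Delta$ is the Laplacian in $x'\in\mathbb{R}^n$.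
   Context: Points of $\mathbb{R}^{n+1}$ are written $x=(x',x_{n+1})$; $S^n$ unit sphere with surface measure $d\sigma$; $S^{n-1}$ the unit sphere of $\mathbb{R}^n$; $[\cdot]$ integer part. $\tilde C^\infty_e(S^n)$: $C^\infty$ functions on $S^n$ even in $x_{n+1}$ and vanishing identically in a neighborhood of the equator $\{x_{n+1}=0\}$. Vertical slice transform: $(Vf)(\theta,t)=\int_{\{x\in S^n:x'\cdot\theta=t\}}f(x)\,d_\tau\sigma(x)$ for $\theta\in S^{n-1}$, $t\in(-1,1)$, with the induced surface measure on the section. *)

(* Defs.v *)
From HB Require Import structures.
From mathcomp Require Import all_boot all_order all_algebra.
From mathcomp Require Import all_classical all_reals all_analysis.
Set Implicit Arguments. Unset Strict Implicit. Unset Printing Implicit Defensive.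
Import Order.TTheory GRing.Theory Num.Theory.
Import numFieldNormedType.Exports.
Local Open Scope classical_set_scope.
Local Open Scope ring_scope.

Section Defs.
Variable R : realType.

(* Euclidean inner product and norm on R^k (row vectors).  NB: the library's
   `|_| on matrices is the max-norm, so we define the Euclidean one. *)
Definition dotv k (u v : 'rV[R]_k) : R := (u *m v^T) 0 0.
Definition enorm k (u : 'rV[R]_k) : R := Num.sqrt (dotv u u).

Fixpoint intRk (k : nat) : ('rV[R]_k -> R) -> R :=
  match k return ('rV[R]_k -> R) -> R with
  | 0 => fun F => F 0
  | k'.+1 => fun F =>
      \int[@lebesgue_measure R]_(s in setT)
        intRk (fun v : 'rV[R]_k' => F (row_mx (const_mx s : 'rV[R]_1) v))
  end.

(* Integral over the unit sphere S^{k-1} of R^k w.r.t. the standard surface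
   measure, via polar coordinates:
   int_{S^{k-1}} F dsigma = k * int_{0<|y|<1} F(y/|y|) dy. *)
Definition sphInt k (F : 'rV[R]_k -> R) : R :=
  k%:R * intRk (fun y => if (0 < enorm y) && (enorm y < 1)
                         then F ((enorm y)^-1 *: y) else 0).

Definition xprime n (x : 'rV[R]_(n + 1)) : 'rV[R]_n := lsubmx x.
Definition xlast n (x : 'rV[R]_(n + 1)) : R := rsubmx x 0 0.

Definition on_sphere n (x : 'rV[R]_(n + 1)) : Prop := enorm x = 1.

Definition elast n : 'rV[R]_(n + 1) := row_mx 0 (const_mx 1).

(* An orthogonal matrix Q (acting on row vectors, x |-> x *m Q) mapping
   e_{n+1} to Theta = (theta, 0); its first n rows then form an orthonormal
   basis of Theta^perp. *)
Definition frameQ n (Theta : 'rV[R]_(n + 1)) : 'M[R]_(n + 1) :=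
  xget 1%:M [set Q : 'M[R]_(n + 1) | Q *m Q^T = 1%:M /\ elast n *m Q = Theta].

(* Vertical slice transform: integral of f over the (n-1)-sphere
   {x in S^n : x' . theta = t} = {t Theta + r u : u in S^n, u perp Theta},
   r = sqrt(1 - t^2), with respect to its induced (n-1)-dimensional
   surface measure (= r^(n-1) times the standard measure of S^{n-1}). *)
Definition vslice n (f : 'rV[R]_(n + 1) -> R) (theta : 'rV[R]_n) (t : R) : R :=
  let Theta := row_mx theta (0 : 'rV[R]_1) in
  let Q := frameQ Theta in
  let r := Num.sqrt (1 - t ^+ 2) in
  r ^+ n.-1 *
  sphInt (fun w : 'rV[R]_n =>
            f (t *: Theta + r *: (row_mx w (0 : 'rV[R]_1) *m Q))).

(* smoothness: all iterated directional derivatives exist and are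
   (Frechet) differentiable at every point of U; on an open U this is C^oo *)
Definition smooth_on k (U : set 'rV[R]_k) (g : 'rV[R]_k -> R) : Prop :=
  forall (vs : seq 'rV[R]_k) (x : 'rV[R]_k), U x ->
    differentiable (foldr (fun v h => 'D_v h) g vs) x.

Definition smooth_sphere n (f : 'rV[R]_(n + 1) -> R) : Prop :=
  exists (U : set 'rV[R]_(n + 1)) (g : 'rV[R]_(n + 1) -> R),
    open U /\ on_sphere (n:=n) `<=` U /\ smooth_on U g /\
    (forall x, on_sphere x -> f x = g x).

Definition Ctilde_e n (f : 'rV[R]_(n + 1) -> R) : Prop :=
  smooth_sphere f /\
  (forall x, on_sphere x ->
     f (row_mx (xprime x) (const_mx (- xlast x))) = f x) /\
  (exists eps : R, 0 < eps /\
     forall x, on_sphere x -> `|xlast x| < eps -> f x = 0).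

Definition ebasis n (i : 'I_n) : 'rV[R]_n := delta_mx 0 i.
Definition laplacian n (F : 'rV[R]_n -> R) (y : 'rV[R]_n) : R :=
  \sum_(i < n) 'D_(ebasis i) ('D_(ebasis i) F) y.

Definition Gamma (s : R) : R :=
  \int[@lebesgue_measure R]_(t in `]0, +oo[%classic) (t `^ (s - 1) * expR (- t)).

(* lambda_n; [n/2 - 1] = (n %/ 2 - 1) for n >= 2 *)
Definition lambda_n (n : nat) : R :=
  (-1) ^+ (n./2 - 1) * Gamma ((n%:R - 1) / 2) * Gamma (n%:R / 2)
  / (8 * pi `^ (n%:R - 2^-1) * (n - 2)`!%:R).

Definition Vweight n (f : 'rV[R]_(n + 1) -> R) (theta : 'rV[R]_n) (t : R) : R :=
  vslice f theta t * (Num.sqrt (1 - t ^+ 2))^-1.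

End Defs.

(* Main.v *)
(**
On the sphere f(x) = |x_(n+1)| phi(x') with phi smooth and supported in a ball
of radius < 1.  The slice x'.theta = t is a sphere of radius sqrt (1 - t^2),
and projecting its two halves to the hyperplane disc turns
(Vf)(theta, t) (1 - t^2)^(-1/2) into 2 R phi(theta, t), where R is the Radon
transform.  Its t-derivative of order 2j is R (Delta^j phi), since tangential
derivatives integrate to 0 over the hyperplane.

For n = 2j + 3, write g(s) as half the integral of |t - s| g''(t) over t, with
g = R (Delta^j phi); for n = 2j + 2 the pairing with ln |t - s| is already in
the statement.  In both cases the integral over t and the hyperplane
directions is an integral over R^n, and averaging over theta turns |theta.z|
into c |z| and ln |theta.z| into |S^(n-1)| ln |z| + c', so that the
backprojection at y is the integral over z of Delta^(j+1) phi (y + z) c |z|,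
respectively Delta^j phi (y + z) (|S^(n-1)| ln |z| + c').  Applying Delta once
more and moving all the Laplacians on the kernel one by one, through powers
|z|^(-q), up to Delta |z|^(2-n) = - (n - 2) |S^(n-1)| delta, leaves a multiple
of phi(y).  The constants are compared by expressing Gamma values, |S^(n-1)|
and c through the moments of exp (- r^2).
*)
Require Import Defs.
From HB Require Import structures.
From mathcomp Require Import all_boot all_order all_algebra.
From mathcomp Require Import all_classical all_reals all_analysis.
From mathcomp Require Import measurable_realfun ring lra zify.
Set Implicit Arguments. Unset Strict Implicit. Unset Printing Implicit Defensive.
Import Order.TTheory GRing.Theory Num.Theory.
Import numFieldNormedType.Exports.
Local Open Scope classical_set_scope.
Local Open Scope ring_scope.

(** The statement fixes concrete integrals: iterated one-dimensional ones, a spherical integral that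
    normalises points of the ball, and a slice integral through an arbitrarily chosen frame. They
    are identified with integrals for a product measure on R^k and for a cone measure on the sphere.
    Independence of the frame is then rotation invariance, derived from uniqueness of the
    translation invariant measure, so that no Jacobian enters; the projection of the hemisphere
    needs only one-dimensional substitutions under Tonelli.

    The kernels are singular at 0, so each Laplacian is moved onto a smooth approximation with |z|^2
    + e^2 in place of |z|^2, and e tends to 0 along 1/(j+1). Every such approximation has a gradient
    a z (|z|^2 + e^2)^(-p/2), so one computation serves all steps: for p < n it yields the next
    kernel, for p = n an approximate identity. The constant c' is never evaluated: it is paired with
    a Laplacian of a compactly supported function, whose integral is 0. *)

Definition rv_display : measure_display. Proof. exact: default_measure_display. Qed.

(** * Measurable structure on row vectors *)

Section rv_measurable.
Context {R : realType} {k : nat}.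
Local Notation T := 'rV[R]_k.

(** Generating by coordinates rather than by open sets makes measurability of a map into R^k a
    coordinatewise condition; the price is that continuous functions need the separate argument of
    [continuous_measurable_rv]. *)
Definition rv_cylinders : set (set T) :=
  [set A | exists (i : 'I_k) (B : set R), measurable B /\
           A = (fun v : T => v 0 i) @^-1` B].

Let rv0 : <<s rv_cylinders >> set0. Proof. exact: sigma_algebra0. Qed.
Let rvC A : <<s rv_cylinders >> A -> <<s rv_cylinders >> (~` A).
Proof. exact: sigma_algebraC. Qed.
Let rvU (F : _^nat) : (forall i, <<s rv_cylinders >> (F i)) ->
  <<s rv_cylinders >> (\bigcup_i (F i)).
Proof. exact: sigma_algebra_bigcup. Qed.

HB.instance Definition _ := @isMeasurable.Build rv_display 'rV[R]_k
  <<s rv_cylinders >> rv0 rvC rvU.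

Lemma measurable_coord (i : 'I_k) :
  measurable_fun [set: T] (fun v : T => v 0 i).
Proof.
move=> _ B mB; rewrite setTI; apply: sub_sigma_algebra.
by exists i, B.
Qed.

Lemma measurable_rv d (X : measurableType d) (f : X -> T) :
  (forall i, measurable_fun [set: X] (fun x => f x 0 i)) ->
  measurable_fun [set: X] f.
Proof.
move=> mf; apply: (@measurability _ _ _ _ _ _ rv_cylinders) => //.
move=> _ [_ [i [B [mB ->]] <-]].
by apply: mf.
Qed.

End rv_measurable.

Section measurable_maps.
Context {R : realType}.

(** This is the very vector that the recursion of [intRk] feeds to its integrand, packaged as a map
    from a product so that Fubini applies to it. *)
Definition rcons0 k (p : R * 'rV[R]_k) : 'rV[R]_k.+1 :=
  row_mx (const_mx p.1 : 'rV[R]_1) p.2.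

Definition rhead k (v : 'rV[R]_k.+1) : R := v 0 0.
Definition rtail k (v : 'rV[R]_k.+1) : 'rV[R]_k := \row_i v 0 (lift ord0 i).

Lemma rcons0_0 k p : @rcons0 k p 0 0 = p.1.
Proof.
have := row_mxEl (const_mx p.1 : 'rV[R]_1) p.2 0 0; rewrite [in RHS]mxE => <-.
by congr (_ 0 _); exact: val_inj.
Qed.

Lemma rcons0_lift k p i : @rcons0 k p 0 (lift ord0 i) = p.2 0 i.
Proof.
have := row_mxEr (const_mx p.1 : 'rV[R]_1) p.2 0 i => <-.
by congr (_ 0 _); exact: val_inj.
Qed.

Lemma rhead_rcons0 k p : rhead (@rcons0 k p) = p.1.
Proof. exact: rcons0_0. Qed.

Lemma rtail_rcons0 k p : rtail (@rcons0 k p) = p.2.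
Proof. by apply/rowP => i; rewrite mxE rcons0_lift. Qed.

Lemma rcons0K k (v : 'rV[R]_k.+1) : rcons0 (rhead v, rtail v) = v.
Proof.
apply/rowP => i; case: (unliftP 0 i) => [j ->|->].
  by rewrite rcons0_lift mxE.
by rewrite rcons0_0.
Qed.

Lemma measurable_rcons0 k : measurable_fun [set: R * 'rV[R]_k] (@rcons0 k).
Proof.
apply: measurable_rv => i; case: (unliftP 0 i) => [j ->|->].
  under eq_fun do rewrite rcons0_lift.
  exact: (measurableT_comp (measurable_coord _)).
by under eq_fun do rewrite rcons0_0; exact: measurable_fst.
Qed.

Lemma measurable_rhead k : measurable_fun [set: 'rV[R]_k.+1] (@rhead k).
Proof. exact: measurable_coord. Qed.

Lemma measurable_rtail k : measurable_fun [set: 'rV[R]_k.+1] (@rtail k).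
Proof.
apply: measurable_rv => i; under eq_fun do rewrite mxE.
exact: measurable_coord.
Qed.

Lemma measurable_dotv k d (X : measurableType d) (f g : X -> 'rV[R]_k) :
  measurable_fun [set: X] f -> measurable_fun [set: X] g ->
  measurable_fun [set: X] (fun x => dotv (f x) (g x)).
Proof.
move=> mf mg; rewrite /dotv; under eq_fun do rewrite mxE.
apply: measurable_sum => i; under eq_fun do rewrite mxE.
by apply: measurable_funM; apply: (measurableT_comp (measurable_coord _)).
Qed.

Lemma measurable_enorm k d (X : measurableType d) (f : X -> 'rV[R]_k) :
  measurable_fun [set: X] f ->
  measurable_fun [set: X] (fun x => enorm (f x)).
Proof.
move=> mf; rewrite /enorm; apply: (measurableT_comp (continuous_measurable_fun (@sqrt_continuous R))).
exact: measurable_dotv.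
Qed.

Lemma measurable_rvD k d (X : measurableType d) (f g : X -> 'rV[R]_k) :
  measurable_fun [set: X] f -> measurable_fun [set: X] g ->
  measurable_fun [set: X] (fun x => f x + g x).
Proof.
move=> mf mg; apply: measurable_rv => i; under eq_fun do rewrite mxE.
by apply: measurable_funD; apply: (measurableT_comp (measurable_coord _)).
Qed.

Lemma measurable_rvZ k d (X : measurableType d) (a : X -> R) (f : X -> 'rV[R]_k) :
  measurable_fun [set: X] a -> measurable_fun [set: X] f ->
  measurable_fun [set: X] (fun x => a x *: f x).
Proof.
move=> ma mf; apply: measurable_rv => i; under eq_fun do rewrite mxE.
by apply: measurable_funM => //; apply: (measurableT_comp (measurable_coord _)).
Qed.

Lemma measurable_mulmx k l d (X : measurableType d) (f : X -> 'rV[R]_k) (A : 'M[R]_(k, l)) :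
  measurable_fun [set: X] f ->
  measurable_fun [set: X] (fun x => f x *m A).
Proof.
move=> mf; apply: measurable_rv => i; under eq_fun do rewrite mxE.
apply: measurable_sum => j; apply: measurable_funM => //.
by apply: (measurableT_comp (measurable_coord _)).
Qed.

Lemma rv_norm_le k (v : 'rV[R]_k) e :
  0 <= e -> (forall i, `|v 0 i| <= e) -> `|v| <= e.
Proof.
move=> e0 ve; rewrite [`|v|]mx_normrE; apply: bigmax_le => // -[i j] _ /=.
by rewrite ord1.
Qed.

Lemma coord_le_norm k (v : 'rV[R]_k) i : `|v 0 i| <= `|v|.
Proof.
by rewrite [`|v|]mx_normrE; exact: (le_bigmax _ (fun ij => `|v ij.1 ij.2|) (0, i)).
Qed.

Definition grid k (m : nat) (v : 'rV[R]_k) : 'rV[R]_k :=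
  \row_i ((Num.floor (v 0 i * m.+1%:R))%:~R / m.+1%:R).

Lemma grid_cvg k (v : 'rV[R]_k) : grid m v @[m --> \oo] --> v.
Proof.
apply/cvgrPdist_le => e e0.
have : (m.+1%:R : R)^-1 @[m --> \oo] --> (0 : R).
  exact: cvg_harmonic.
move=> /cvgrPdist_le /(_ _ e0); apply: filterS => m.
rewrite sub0r normrN => me.
have m0 : (0 : R) < m.+1%:R by [].
rewrite ger0_norm ?invr_ge0// in me.
apply: rv_norm_le; first exact: ltW.
move=> i; rewrite !mxE; apply: le_trans me.
have /andP[l u] := floor_itv (v 0 i * m.+1%:R).
rewrite -[X in X - _](mulfK (lt0r_neq0 m0)) -mulrBl normrM [X in _ * X]ger0_norm ?invr_ge0//.
rewrite ler_piMl ?invr_ge0//.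
by rewrite intrD in u; rewrite ger0_norm; lra.
Qed.

(* F is the pointwise limit of its compositions with rounding to a grid, which have countable range. *)
Lemma continuous_measurable_rv k (F : 'rV[R]_k -> R) :
  continuous F -> measurable_fun [set: 'rV[R]_k] F.
Proof.
move=> cF.
apply: (@measurable_fun_cvg _ _ R [set: 'rV[R]_k] (fun m v => F (grid m v)) F).
  move=> m _ B mB; rewrite setTI.
  pose z (c : 'rV[int]_k) : 'rV[R]_k := \row_i ((c 0 i)%:~R / m.+1%:R).
  have -> : (fun v => F (grid m v)) @^-1` B =
    \bigcup_(c in [set c | B (F (z c))])
       [set v | forall i, Num.floor (v 0 i * m.+1%:R) = c 0 i].
    apply/seteqP; split => [v /= Bv|v [c /= Bc vc]].
      exists (\row_i Num.floor (v 0 i * m.+1%:R)) => /=; last by move=> i; rewrite mxE.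
      by congr (B (F _)): Bv; apply/rowP => i; rewrite !mxE.
    by congr (B (F _)): Bc; apply/rowP => i; rewrite !mxE vc.
  have mz c : measurable [set v : 'rV[R]_k | forall i, Num.floor (v 0 i * m.+1%:R) = c i].
    have -> : [set v : 'rV[R]_k | forall i, Num.floor (v 0 i * m.+1%:R) = c i] =
       \bigcap_(i in [set: 'I_k]) ((fun v : 'rV[R]_k => v 0 i) @^-1`
          [set x | Num.floor (x * m.+1%:R) = c i]).
      by apply/seteqP; split => v /= H i; [move=> _|]; apply: H.
    apply: fin_bigcap_measurable => // i _.
    rewrite -[X in measurable X]setTI; apply: measurable_coord => //.
    have -> : [set x : R | Num.floor (x * m.+1%:R) = c i] =
        `[(c i)%:~R / m.+1%:R, (c i + 1)%:~R / m.+1%:R[%classic.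
      apply/seteqP; split => x /=; rewrite in_itv /= ler_pdivrMr// ltr_pdivlMr//.
        by move=> <-; exact: floor_itv.
      by move=> /floor_def.
    exact: measurable_itv.
  rewrite bigcup_mkcond; apply: countable_bigcupT_measurable => [|c]; first exact: countableP.
  case: ifPn => [_|_]; [exact: mz|exact: measurable0].
move=> v _; apply: (cvg_comp (fun m => grid m v)); last exact: cF.
exact: grid_cvg.
Qed.

End measurable_maps.

(** * Lebesgue measure on R^k *)

Section leb_step.
Local Open Scope ereal_scope.
Context {R : realType} (k : nat).
Variable mu : {sigma_finite_measure set 'rV[R]_k -> \bar R}.

Let mR : measurable_fun [set: measurableTypeR R * 'rV[R]_k] (@rcons0 R k).
Proof. exact: measurable_rcons0. Qed.

Let push : {measure set 'rV[R]_k.+1 -> \bar R} :=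
  measure_function_pushforward__canonical__measure_function_Measure
   ((@lebesgue_measure R) \x mu) mR.

Definition leb_step (A : set 'rV[R]_k.+1) : \bar R :=
  ((@lebesgue_measure R) \x mu) (@rcons0 R k @^-1` A).

HB.instance Definition _ := isMeasure.Build _ _ _ leb_step
  (measure0 push) (measure_ge0 push) (@measure_semi_sigma_additive _ _ _ push).

Let sf : sigma_finite setT leb_step.
Proof.
have [F FT mF] : sigma_finite setT ((@lebesgue_measure R) \x mu).
  have /sigma_finiteP[F [FT ndF mF]] := sigma_finiteT (@lebesgue_measure R).
  have /sigma_finiteP[G [GT ndG mG]] := sigma_finiteT mu.
  (* Both exhaustions are nondecreasing, so the diagonal products already cover the product
     space. *)
  exists (fun i => F i `*` G i).
    apply/seteqP; split => // -[x y] _.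
      have [i _ Fi] : (\bigcup_i F i) x by rewrite -FT.
      have [j _ Gj] : (\bigcup_i G i) y by rewrite -GT.
      exists (maxn i j) => //; split.
        by move: Fi; apply/subsetPset/ndF/leq_maxl.
      by move: Gj; apply/subsetPset/ndG/leq_maxr.
  move=> i; have [m1 f1] := mF i; have [m2 f2] := mG i; split; first exact: measurableX.
  by rewrite product_measure1E// lte_mul_pinfty// ge0_fin_numE.
exists (fun i => [set v | F i (rhead v, rtail v)]).
  apply/seteqP; split => // v _.
  have : (\bigcup_i F i) (rhead v, rtail v) by rewrite -FT.
  by move=> [i _ Fi]; exists i.
move=> i; split.
  rewrite -[X in measurable X]setTI.
  apply: (measurable_fun_pair (@measurable_rhead R k) (@measurable_rtail R k)) => //.
  by have [] := mF i.
have [_] := mF i; congr (_ < _); rewrite /leb_step; congr (_ _).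
apply/seteqP; split => -[x v] /=; rewrite rhead_rcons0 rtail_rcons0//.
Qed.

HB.instance Definition _ := Measure_isSigmaFinite.Build _ _ _ leb_step sf.

Lemma ge0_integral_leb_step (f : 'rV[R]_k.+1 -> \bar R) :
  measurable_fun setT f -> (forall v, 0 <= f v) ->
  \int[leb_step]_v f v = \int[@lebesgue_measure R]_s \int[mu]_v f (rcons0 (s, v)).
Proof.
move=> mf f0.
have -> : \int[leb_step]_v f v = \int[push]_v f v by [].
rewrite /push ge0_integral_pushforward//= preimage_setT.
rewrite fubini_tonelli1//=.
by apply: measurableT_comp => //; exact: measurable_rcons0.
Qed.

Lemma integral_leb_step (f : 'rV[R]_k.+1 -> \bar R) :
  leb_step.-integrable setT f ->
  \int[leb_step]_v f v = \int[@lebesgue_measure R]_s \int[mu]_v f (rcons0 (s, v)).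
Proof.
move=> intf; have mf := measurable_int _ intf.
have mfr : measurable_fun [set: measurableTypeR R * 'rV[R]_k] (f \o @rcons0 R k).
  by apply: measurableT_comp => //; exact: measurable_rcons0.
have intfr : ((@lebesgue_measure R) \x mu).-integrable setT (f \o @rcons0 R k).
  apply/integrableP; split => //.
  move/integrableP: intf => [_].
  rewrite ge0_integral_leb_step//; last exact: measurableT_comp.
  by rewrite fubini_tonelli1//=; exact: measurableT_comp.
have -> : \int[leb_step]_v f v = \int[push]_v f v by [].
rewrite /push integral_pushforward//= preimage_setT.
by rewrite -fubini1.
Qed.

End leb_step.

Section leb.
Local Open Scope ereal_scope.
Context {R : realType}.

(** The recursion copies that of [intRk]: on R^0 integration is evaluation at the only point, and
    each successor adds one first coordinate. Sigma-finiteness is carried along because the product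
    measure and Tonelli require it at the next stage. *)
Fixpoint leb (k : nat) : {sigma_finite_measure set 'rV[R]_k -> \bar R} :=
  match k with
  | 0 => dirac (0%R : 'rV[R]_0)
  | k'.+1 => leb_step (leb k')
  end.

Lemma ge0_integral_lebS k (f : 'rV[R]_k.+1 -> \bar R) :
  measurable_fun setT f -> (forall v, 0 <= f v) ->
  \int[leb k.+1]_v f v = \int[@lebesgue_measure R]_s \int[leb k]_v f (rcons0 (s, v)).
Proof. exact: ge0_integral_leb_step. Qed.

Lemma integral_lebS k (f : 'rV[R]_k.+1 -> \bar R) :
  (leb k.+1).-integrable setT f ->
  \int[leb k.+1]_v f v = \int[@lebesgue_measure R]_s \int[leb k]_v f (rcons0 (s, v)).
Proof. exact: integral_leb_step. Qed.

Lemma integral_leb0 (f : 'rV[R]_0 -> \bar R) :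
  measurable_fun setT f -> \int[leb 0]_v f v = f 0%R.
Proof. by move=> mf; rewrite integral_dirac// diracT mul1e. Qed.

Definition cube k (r : R) : set 'rV[R]_k := [set v | forall i, (`|v 0%R i| <= r)%R].

Lemma measurable_cube k r : measurable (@cube k r).
Proof.
have -> : @cube k r = \bigcap_(i in [set: 'I_k]) ((fun v : 'rV[R]_k => v 0%R i) @^-1` `[(- r)%R, r]).
  apply/seteqP; split => v /= H i.
    by move=> _; have := H i; rewrite /= in_itv /= ler_norml.
  by have := H i I; rewrite /= in_itv /= ler_norml.
apply: fin_bigcap_measurable => // i _.
by rewrite -[X in measurable X]setTI; exact: measurable_coord.
Qed.

(** Cubes are products, hence computable; enclosing balls in them and them in balls shows that balls
    have positive finite measure, which is all that is needed of balls. *)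
Lemma leb_cube k r : (0 <= r)%R -> leb k (@cube k r) = ((2 * r) ^+ k)%:E.
Proof.
move=> r0; elim: k => [|k IH].
  rewrite /= diracE expr0 mem_set//; by case.
rewrite /= /leb_step.
have -> : @rcons0 R k @^-1` (@cube k.+1 r) = `[(- r)%R, r] `*` @cube k r.
  apply/seteqP; split => -[s v] /=.
    move=> H; split; first by have := H 0%R; rewrite rcons0_0 /= in_itv /= ler_norml.
    by move=> i; have := H (lift ord0 i); rewrite rcons0_lift.
  rewrite in_itv /= -ler_norml => -[H1 H2] i; case: (unliftP 0%R i) => [j ->|->].
    by rewrite rcons0_lift.
  by rewrite rcons0_0.
rewrite product_measure1E//; last exact: measurable_cube.
rewrite IH; have /= -> := @lebesgue_measure_itv R `[(- r)%R, r]; rewrite lte_fin -EFinD.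
have -> : (r - - r = 2 * r)%R by ring.
case: ifPn => [_|]; first by rewrite -EFinM -exprS.
rewrite -leNgt => h; have -> : r = 0%R by lra.
by rewrite mulr0 exprS mul0r mul0e.
Qed.

Lemma gt0_muleBr (c : R) (x y : \bar R) : (0 < c)%R ->
  c%:E * (x - y) = c%:E * x - c%:E * y.
Proof.
move=> c0; have c0' : 0 < c%:E by rewrite lte_fin.
case: x => [x| |]; case: y => [y| |];
  rewrite /= ?(gt0_muley c0') ?(gt0_muleNy c0') //= ?(gt0_muley c0') ?(gt0_muleNy c0') //.
by rewrite -EFinD -!EFinM -EFinD mulrBr.
Qed.

(** A change of variables proved for nonnegative functions passes to signed ones through positive
    and negative parts. Multiplication by a positive real distributes over the difference even at
    infinite values, so integrability is not assumed. *)
Lemma integral_change_var d d' (T : measurableType d) (T' : measurableType d')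
    (mu : {measure set T -> \bar R}) (nu : {measure set T' -> \bar R})
    (phi : T -> T') (c : R) : (0 < c)%R ->
  (forall f : T' -> \bar R, measurable_fun setT f -> (forall x, 0 <= f x) ->
    \int[mu]_x f (phi x) = c%:E * \int[nu]_x f x) ->
  forall f : T' -> \bar R, measurable_fun setT f ->
    \int[mu]_x f (phi x) = c%:E * \int[nu]_x f x.
Proof.
move=> c0 H f mf.
rewrite [LHS]integralE [in RHS]integralE gt0_muleBr//; congr (_ - _).
  rewrite -(H f^\+)//; last exact: measurable_funepos.
  by apply: eq_integral => x _; rewrite -[RHS]/((f^\+ \o phi) x) -funepos_comp.
rewrite -(H f^\-)//; last exact: measurable_funeneg.
by apply: eq_integral => x _; rewrite -[RHS]/((f^\- \o phi) x) -funeneg_comp.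
Qed.

Lemma ge0_integral_affine1 (c a : R) (f : R -> \bar R) : (0 < c)%R ->
  measurable_fun setT f -> (forall x, 0 <= f x) ->
  \int[@lebesgue_measure R]_s f (c * s + a)%R =
  (c^-1)%:E * \int[@lebesgue_measure R]_s f s.
Proof.
move=> c0 mf f0.
pose phi (s : measurableTypeR R) : measurableTypeR R := (c * s + a)%R.
have mphi : measurable_fun [set: measurableTypeR R] phi.
  by apply: measurable_funD => //; exact: measurable_funM.
pose push : {measure set (measurableTypeR R) -> \bar R} :=
  measure_function_pushforward__canonical__measure_function_Measure
   (@lebesgue_measure R) mphi.
have c1 : (0 <= c)%R by exact: ltW.
pose cn : {nonneg R} := NngNum c1.
(* Lebesgue measure is determined by its values on half-open intervals, and there c times the image
   under s -> c s + a has the right value. *)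
have E A : measurable A -> lebesgue_measure A = mscale cn push A.
  apply: lebesgue_measure_unique => X [[x y] _ <-].
  transitivity (c%:E * lebesgue_measure (phi @^-1` `]x, y]%classic)); last by [].
  have -> : phi @^-1` `]x, y] = `]((x - a) / c)%R, ((y - a) / c)%R]%classic.
    apply/seteqP; split => z /=; rewrite !in_itv /= /phi ltr_pdivrMr// ler_pdivlMr//;
      rewrite (mulrC c); lra.
  rewrite !lebesgue_measure_itv /= !lte_fin ltr_pM2r ?invr_gt0// ltrD2r.
  case: ifPn => _; last by rewrite mule0.
  by rewrite -!EFinD -EFinM; congr EFin; field; rewrite gt_eqF.
have -> : \int[@lebesgue_measure R]_s f s = \int[mscale cn push]_s f s.
  by apply: eq_measure_integral => A mA _; exact: E.
rewrite ge0_integral_mscale// muleA -EFinM /= mulVf ?gt_eqF// mul1e.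
by rewrite /push ge0_integral_pushforward//= preimage_setT.
Qed.

Lemma ge0_integral_affine k (c : R) (a : 'rV[R]_k) (f : 'rV[R]_k -> \bar R) : (0 < c)%R ->
  measurable_fun setT f -> (forall x, 0 <= f x) ->
  \int[leb k]_v f (c *: v + a)%R = ((c ^+ k)^-1)%:E * \int[leb k]_v f v.
Proof.
move=> c0; elim: k a f => [|k IH] a f mf f0.
  rewrite !integral_leb0// ?expr0 ?invr1 ?mul1e; first by congr f; apply/rowP; case.
  by apply: measurableT_comp => //; apply: measurable_rvD => //; exact: measurable_rvZ.
rewrite ge0_integral_lebS//; last first.
  by apply: measurableT_comp => //; apply: measurable_rvD => //; exact: measurable_rvZ.
rewrite ge0_integral_lebS//.
have step s v : (c *: rcons0 (s, v) + a = rcons0 (c * s + rhead a, c *: v + rtail a))%R.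
  apply/rowP => i; case: (unliftP 0%R i) => [j ->|->].
    by rewrite mxE mxE !rcons0_lift !mxE.
  by rewrite mxE mxE !rcons0_0.
have mfr s : measurable_fun [set: 'rV[R]_k] (fun v => f (rcons0 (s, v))).
  apply: measurableT_comp => //.
  by apply: measurableT_comp; [exact: measurable_rcons0|exact: measurable_pair1].
pose G s := \int[leb k]_v f (rcons0 (s, v)).
have mG : measurable_fun [set: measurableTypeR R] G.
  apply: (@measurable_fun_fubini_tonelli_F _ _ (measurableTypeR R) 'rV[R]_k R (leb k)
    (f \o @rcons0 R k)).
    by apply: measurableT_comp => //; exact: measurable_rcons0.
  by move=> x; exact: f0.
have G0 s : 0 <= G s by apply: integral_ge0.
transitivity (\int[@lebesgue_measure R]_s (((c ^+ k)^-1)%:E * G (c * s + rhead a)%R)).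
  apply: eq_integral => s _; under eq_integral do rewrite step.
  by rewrite (IH _ (fun v => f (rcons0 (c * s + rhead a, v)%R))).
rewrite (@ge0_integralZl _ (measurableTypeR R) R lebesgue_measure setT measurableT
  (fun s : R => G (c * s + rhead a)%R)); last 3 first.
- apply: (@measurableT_comp _ _ _ _ _ _ _ _ (fun s : R => (c * s + rhead a)%R)) => //.
  by apply: measurable_funD => //; exact: measurable_funM.
- by move=> s _; exact: G0.
- by rewrite lee_fin invr_ge0 exprn_ge0// ltW.
by rewrite ge0_integral_affine1// muleA -EFinM exprSr invfM.
Qed.

Lemma integral_affine k (c : R) (a : 'rV[R]_k) (f : 'rV[R]_k -> \bar R) : (0 < c)%R ->
  measurable_fun setT f ->
  \int[leb k]_v f (c *: v + a)%R = ((c ^+ k)^-1)%:E * \int[leb k]_v f v.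
Proof.
move=> c0; apply: integral_change_var; first by rewrite invr_gt0 exprn_gt0.
by move=> g mg g0; exact: ge0_integral_affine.
Qed.

Lemma integral_translation k (a : 'rV[R]_k) (f : 'rV[R]_k -> \bar R) :
  measurable_fun setT f -> \int[leb k]_v f (v + a)%R = \int[leb k]_v f v.
Proof.
move=> mf; have := integral_affine a (@ltr01 R) mf.
rewrite expr1n invr1 mul1e => <-.
by apply: eq_integral => v _; rewrite scale1r.
Qed.

Lemma integral_scaling k (c : R) (f : 'rV[R]_k -> \bar R) : (0 < c)%R ->
  measurable_fun setT f ->
  \int[leb k]_v f (c *: v)%R = ((c ^+ k)^-1)%:E * \int[leb k]_v f v.
Proof.
move=> c0 mf; rewrite -(integral_affine 0%R c0 mf).
by apply: eq_integral => v _; rewrite addr0.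
Qed.

Definition eball k (r : R) : set 'rV[R]_k := [set v | (enorm v < r)%R].

Lemma measurable_eball k r : measurable (@eball k r).
Proof.
have -> : @eball k r = (@enorm R k) @^-1` `]-oo, r[%classic.
  by apply/seteqP; split => v /=; rewrite in_itv.
rewrite -[X in measurable X]setTI.
exact: (@measurable_enorm R k _ _ idfun (@measurable_id _ _ _)).
Qed.

End leb.

(** * Euclidean geometry *)

Section euclid.
Context {R : realType} {k : nat}.
Implicit Types u v w : 'rV[R]_k.

Lemma dotvE u v : dotv u v = \sum_i u 0 i * v 0 i.
Proof. by rewrite /dotv mxE; apply: eq_bigr => i _; rewrite mxE. Qed.

Lemma dotvC u v : dotv u v = dotv v u.
Proof. by rewrite !dotvE; apply: eq_bigr => i _; rewrite mulrC. Qed.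

Lemma dotvDl u v w : dotv (u + v) w = dotv u w + dotv v w.
Proof. by rewrite !dotvE -big_split; apply: eq_bigr => i _; rewrite mxE mulrDl. Qed.

Lemma dotvDr u v w : dotv w (u + v) = dotv w u + dotv w v.
Proof. by rewrite !(dotvC w) dotvDl. Qed.

Lemma dotvZl a u v : dotv (a *: u) v = a * dotv u v.
Proof. by rewrite !dotvE mulr_sumr; apply: eq_bigr => i _; rewrite mxE mulrA. Qed.

Lemma dotvZr a u v : dotv u (a *: v) = a * dotv u v.
Proof. by rewrite dotvC dotvZl dotvC. Qed.

Lemma dotvNl u v : dotv (- u) v = - dotv u v.
Proof. by rewrite -scaleN1r dotvZl mulN1r. Qed.

Lemma dotvNr u v : dotv u (- v) = - dotv u v.
Proof. by rewrite dotvC dotvNl dotvC. Qed.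

Lemma dotvBr u v w : dotv w (u - v) = dotv w u - dotv w v.
Proof. by rewrite dotvDr dotvNr. Qed.

Lemma dotvBl u v w : dotv (u - v) w = dotv u w - dotv v w.
Proof. by rewrite dotvDl dotvNl. Qed.

Lemma dotv0l v : dotv 0 v = 0.
Proof. by rewrite -(scale0r v) dotvZl mul0r. Qed.

Lemma dotv0r v : dotv v 0 = 0.
Proof. by rewrite dotvC dotv0l. Qed.

Lemma dotvv_ge0 v : 0 <= dotv v v.
Proof. by rewrite dotvE; apply: sumr_ge0 => i _; rewrite -expr2 sqr_ge0. Qed.

Lemma enorm_ge0 v : 0 <= enorm v.
Proof. exact: sqrtr_ge0. Qed.

Lemma enorm2 v : enorm v ^+ 2 = dotv v v.
Proof. by rewrite sqr_sqrtr// dotvv_ge0. Qed.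

Lemma enorm0 : enorm (0 : 'rV[R]_k) = 0.
Proof. by rewrite /enorm dotv0l sqrtr0. Qed.

Lemma enorm_eq0 v : (enorm v == 0) = (v == 0).
Proof.
apply/eqP/eqP => [h|->]; last exact: enorm0.
have : dotv v v = 0 by rewrite -enorm2 h expr0n.
rewrite dotvE => /eqP; rewrite psumr_eq0; last by move=> i _; rewrite -expr2 sqr_ge0.
move=> /allP h'; apply/rowP => i; rewrite mxE; apply/eqP.
by have := h' i (mem_index_enum _); rewrite /= -expr2 sqrf_eq0.
Qed.

Lemma enorm_gt0 v : (0 < enorm v) = (v != 0).
Proof. by rewrite lt_def enorm_eq0 enorm_ge0 andbT. Qed.

Lemma enormZ a v : enorm (a *: v) = `|a| * enorm v.
Proof.
by rewrite /enorm dotvZl dotvZr mulrA -expr2 sqrtrM ?sqr_ge0// sqrtr_sqr.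
Qed.

Lemma enormN v : enorm (- v) = enorm v.
Proof. by rewrite -scaleN1r enormZ normrN1 mul1r. Qed.

Lemma enorm_normalize v : v != 0 -> enorm ((enorm v)^-1 *: v) = 1.
Proof.
move=> v0; rewrite enormZ ger0_norm ?invr_ge0 ?enorm_ge0// mulVf//.
by rewrite enorm_eq0.
Qed.

Lemma coord_le_enorm v i : `|v 0 i| <= enorm v.
Proof.
rewrite -sqrtr_sqr ler_sqrt ?dotvv_ge0// dotvE (bigD1 i)//= expr2 lerDl.
by apply: sumr_ge0 => j _; rewrite -expr2 sqr_ge0.
Qed.

Lemma norm_le_enorm v : `|v| <= enorm v.
Proof. by apply: rv_norm_le; [exact: enorm_ge0|exact: coord_le_enorm]. Qed.

Lemma enorm_le_norm v : enorm v <= k%:R * `|v|.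
Proof.
rewrite -(@ler_pXn2r _ 2)// ?nnegrE ?enorm_ge0// ?mulr_ge0//.
rewrite enorm2 dotvE.
apply: (@le_trans _ _ (\sum_(i < k) `|v| ^+ 2)).
  apply: ler_sum => i _; rewrite -expr2 -[v 0 i ^+ 2]real_normK ?num_real//.
  by rewrite ler_pXn2r// ?nnegrE// coord_le_norm.
rewrite sumr_const card_ord exprMn -[X in X <= _]mulr_natl ler_wpM2r ?sqr_ge0//.
case: (k) => [|m]; first by rewrite expr0n.
by rewrite expr2 ler_peMl// ler1n.
Qed.

Lemma cauchy_schwarz u v : `|dotv u v| <= enorm u * enorm v.
Proof.
have [->|v0] := eqVneq v 0; first by rewrite dotv0r enorm0 mulr0 normr0.
have vp : 0 < dotv v v by rewrite -enorm2 exprn_gt0// enorm_gt0.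
have := dotvv_ge0 (dotv v v *: u - dotv u v *: v).
rewrite dotvBl !dotvBr !dotvZl !dotvZr (dotvC v u) => h.
rewrite -(@ler_pXn2r _ 2)// ?nnegrE ?mulr_ge0 ?enorm_ge0//.
rewrite real_normK ?num_real// exprMn !enorm2.
rewrite -(ler_pM2l vp); nra.
Qed.

Lemma enormD u v : enorm (u + v) <= enorm u + enorm v.
Proof.
rewrite -(@ler_pXn2r _ 2)// ?nnegrE ?addr_ge0 ?enorm_ge0//.
rewrite enorm2 dotvDl !dotvDr sqrrD !enorm2 (dotvC v u).
have := cauchy_schwarz u v; rewrite ler_norml => /andP[_ h]; lra.
Qed.

End euclid.

Section orthogonal.
Context {R : realType} {k : nat}.
Variable (Q : 'M[R]_k).
Hypothesis QQ : Q *m Q^T = 1%:M.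

Lemma orthogonal_trmx : Q^T *m Q = 1%:M.
Proof. exact: mulmx1C. Qed.

Lemma dotv_orth u v : dotv (u *m Q) (v *m Q) = dotv u v :> R.
Proof. by rewrite /dotv trmx_mul mulmxA -(mulmxA u) QQ mulmx1. Qed.

Lemma enorm_orth u : enorm (u *m Q) = enorm u :> R.
Proof. by rewrite /enorm dotv_orth. Qed.

End orthogonal.

Section ge0_integralZT.
Local Open Scope ereal_scope.
Context d (T : measurableType d) (R : realType) (mu : {measure set T -> \bar R}).

Lemma ge0_integralZlT (c : \bar R) (f : T -> \bar R) : measurable_fun setT f ->
  (forall x, 0 <= f x) -> 0 <= c -> \int[mu]_x (c * f x) = c * \int[mu]_x f x.
Proof. by move=> mf f0 c0; apply: ge0_integralZl. Qed.

Lemma ge0_integralZrT (c : \bar R) (f : T -> \bar R) : measurable_fun setT f ->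
  (forall x, 0 <= f x) -> 0 <= c -> \int[mu]_x (f x * c) = (\int[mu]_x f x) * c.
Proof. by move=> mf f0 c0; apply: ge0_integralZr. Qed.

End ge0_integralZT.

(** * Rotation invariance of Lebesgue measure *)

Section rotation.
Local Open Scope ereal_scope.
Context {R : realType} {k : nat}.

Lemma leb_eball_gt0 : 0 < @leb R k (@eball R k 1%R).
Proof.
have r0 : (0 < (k.+1%:R : R)^-1)%R by rewrite invr_gt0.
apply: (@lt_le_trans _ _ (@leb R k (@cube R k (k.+1%:R)^-1%R))).
  by rewrite leb_cube ?(ltW r0)// lte_fin exprn_gt0// mulr_gt0.
apply: le_measure; rewrite ?inE; [exact: measurable_cube|exact: measurable_eball|].
move=> v /= cv; apply: le_lt_trans (enorm_le_norm _) _.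
have : (`|v| <= (k.+1%:R)^-1)%R by apply: rv_norm_le; [exact: ltW|].
move=> /(ler_wpM2l (ler0n R k))/le_lt_trans; apply.
by rewrite ltr_pdivrMr// mul1r ltr_nat.
Qed.

Lemma leb_eball_lty r : @leb R k (@eball R k r) < +oo.
Proof.
have [r0|r0] := ltP 0%R r; last first.
  have -> : @eball R k r = set0; last by rewrite measure0.
  by apply/seteqP; split => // v /= /lt_le_trans /(_ r0); rewrite ltNge enorm_ge0.
apply: (@le_lt_trans _ _ (@leb R k (@cube R k r))).
  apply: le_measure; rewrite ?inE; [exact: measurable_eball|exact: measurable_cube|].
  move=> v /= vr i; apply: le_trans (coord_le_enorm _ _) _; exact: ltW.
by rewrite leb_cube ?(ltW r0)// ltey.
Qed.

(* Uniqueness of Haar measure, tested against the rotation invariant unit ball. *)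
Lemma ge0_integral_rotation (Q : 'M[R]_k) (f : 'rV[R]_k -> \bar R) :
  Q *m Q^T = 1%:M -> measurable_fun setT f -> (forall x, 0 <= f x) ->
  \int[leb k]_v f (v *m Q) = \int[leb k]_v f v.
Proof.
move=> QQ mf f0; have QTQ := orthogonal_trmx QQ.
pose g (v : 'rV[R]_k) : \bar R := (\1_(@eball R k 1) v)%:E.
have mg : measurable_fun setT g.
  by apply/measurable_EFinP; apply: measurable_indic; exact: measurable_eball.
have g0 v : 0 <= g v by rewrite /g lee_fin.
have gE v w : enorm v = enorm w -> g v = g w.
  move=> e; rewrite /g !indicE.
  have -> // : (v \in @eball R k 1%R) = (w \in @eball R k 1%R).
  by apply/idP/idP; rewrite !inE /eball /= e.
pose b := \int[leb k]_v g v.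
have bE : b = leb k (@eball R k 1%R).
  by rewrite /b integral_indic ?setIT//; exact: measurable_eball.
have b0 : 0 < b by rewrite bE leb_eball_gt0.
have boo : b < +oo by rewrite bE leb_eball_lty.
have mfQ : measurable_fun setT (fun v : 'rV[R]_k => f (v *m Q)).
  by apply: measurableT_comp => //; exact: measurable_mulmx.
suff : (\int[leb k]_v f (v *m Q)) * b = (\int[leb k]_v f v) * b.
  have bf : b \is a fin_num by rewrite ge0_fin_numE// ltW.
  move=> /(congr1 (fun z => z * (fine b)^-1%:E)).
  have bb : b * (fine b)^-1%:E = 1.
    by rewrite -{1}(fineK bf) -EFinM mulfV// gt_eqF// fine_gt0// b0 boo.
  by rewrite -!muleA bb !mule1.
(* Integrating [FG] in y first gives the left side. With y fixed, the translation of x by y Q^T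
   turns x Q into x Q + y and y - x Q into - x Q, where g has the value g(x); so [FG] becomes [GF],
   whose integral in y first gives the right side. *)
pose FG (x y : 'rV[R]_k) := f (x *m Q) * g (y - x *m Q)%R.
pose GF (x y : 'rV[R]_k) := f (x *m Q + y)%R * g x.
transitivity (\int[leb k]_x \int[leb k]_y FG x y).
  rewrite -(ge0_integralZrT (leb k) mfQ)//; last exact: ltW.
  apply: eq_integral => x _; rewrite /FG /b -(integral_translation (- (x *m Q))%R mg).
  rewrite -(ge0_integralZlT (leb k) (f := fun y => g (y - x *m Q)%R))//.
  by apply: measurableT_comp => //; exact: measurable_rvD.
have mQ' : measurable_fun [set: 'rV[R]_k * 'rV[R]_k] (fun p => p.2 - p.1 *m Q)%R.
  apply: measurable_rvD => //=.
  under eq_fun do rewrite -scaleN1r.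
  by apply: measurable_rvZ => //; exact: measurable_mulmx.
have mFG : measurable_fun [set: 'rV[R]_k * 'rV[R]_k] (fun p => FG p.1 p.2).
  apply: emeasurable_funM; first exact: (measurableT_comp mfQ).
  exact: (measurableT_comp mg).
have mQ2 : measurable_fun [set: 'rV[R]_k * 'rV[R]_k] (fun p => p.1 *m Q + p.2)%R.
  by apply: measurable_rvD => //=; exact: measurable_mulmx.
have mGF : measurable_fun [set: 'rV[R]_k * 'rV[R]_k] (fun p => GF p.1 p.2).
  apply: emeasurable_funM; first exact: (measurableT_comp mf).
  exact: (measurableT_comp mg).
rewrite (@fubini_tonelli _ _ _ _ R (leb k) (leb k) _ mFG); last first.
  by move=> p; rewrite mule_ge0.
transitivity (\int[leb k]_y \int[leb k]_x GF x y).
  apply: eq_integral => y _.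
  have mFGy : measurable_fun [set: 'rV[R]_k] (FG ^~ y).
    apply: emeasurable_funM => //; apply: (measurableT_comp mg).
    apply: measurable_rvD => //=.
    under eq_fun do rewrite -scaleN1r.
    by apply: measurable_rvZ => //; exact: measurable_mulmx.
  rewrite -(integral_translation (y *m Q^T)%R mFGy).
  apply: eq_integral => x _; rewrite /FG /GF mulmxDl -mulmxA QTQ mulmx1.
  by congr (_ * _); apply: gE; rewrite opprD addrCA subrr addr0 enormN enorm_orth.
rewrite -(@fubini_tonelli _ _ _ _ R (leb k) (leb k) _ mGF); last first.
  by move=> p; rewrite mule_ge0.
rewrite /b -(ge0_integralZlT (leb k) mg)//; last by apply: integral_ge0.
apply: eq_integral => x _.
have mfx : measurable_fun [set: 'rV[R]_k] (fun y => f (x *m Q + y)%R).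
  by apply: (measurableT_comp mf); exact: measurable_rvD.
apply: etrans (ge0_integralZrT (leb k) mfx (fun y => f0 _) (g0 x)) _.
congr (_ * _); rewrite -(integral_translation (x *m Q) mf).
by apply: eq_integral => y _; rewrite addrC.
Qed.

Lemma integral_rotation (Q : 'M[R]_k) (f : 'rV[R]_k -> \bar R) :
  Q *m Q^T = 1%:M -> measurable_fun setT f ->
  \int[leb k]_v f (v *m Q) = \int[leb k]_v f v.
Proof.
move=> QQ mf; rewrite -[RHS]mul1e; apply: (integral_change_var ltr01) mf.
by move=> g mg g0; rewrite mul1e ge0_integral_rotation.
Qed.

End rotation.

Lemma integrable_indic_lty d (T : measurableType d) (R : realType)
    (mu : {measure set T -> \bar R}) (A : set T) :
  measurable A -> (mu A < +oo)%E -> mu.-integrable setT (fun x => (\1_A x)%:E).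
Proof.
move=> mA Aoo; apply/integrableP; split.
  exact/measurable_EFinP/measurable_indic.
under eq_integral do rewrite /= ger0_norm//.
by rewrite integral_indic// setIT.
Qed.

Lemma ge0_integral_mrestr d (T : measurableType d) (R : realType)
    (mu : {measure set T -> \bar R}) (D : set T) (mD : measurable D) (f : T -> \bar R) :
  measurable_fun setT f -> (forall x, 0 <= f x)%E ->
  (\int[mrestr mu mD]_x f x = \int[mu]_(x in D) f x)%E.
Proof.
move=> mf f0.
rewrite (@ge0_negligible_integral _ _ _ (mrestr mu mD) setT (~` D))//; last 2 first.
- exact: measurableC.
- by rewrite /= /mrestr setICl measure0.
rewrite setTD setCK; apply: eq_measure_integral => A mA AD.
by rewrite /= /mrestr setIidl.
Qed.

(** The discontinuity at 0 is avoided by writing 1/x as x times a real power of x^2; at 0 both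
    expressions vanish by the convention for the inverse of 0. *)
Lemma measurable_inv (R : realType) : measurable_fun [set: R] (fun x : R => x^-1).
Proof.
have -> : (fun x : R => x^-1) = (fun x => x * (x ^+ 2) `^ (-1)).
  apply/funext => x; have [->|x0] := eqVneq x 0; first by rewrite invr0 mul0r.
  by rewrite powR_inv1 ?sqr_ge0// expr2 invfM mulrA mulfV// mul1r.
apply: measurable_funM => //.
by apply: (measurableT_comp (measurable_powR _)); exact: exprn_measurable.
Qed.

(** * Iterated integrals as Lebesgue integrals *)

Section bridge.
Context {R : realType}.

(** A class that passes to sections in the first coordinate, so that the comparison of [intRk] with
    [leb] goes by induction. A single M bounds both the values and the support, which keeps the
    condition uniform over the sections. *)
Definition bdsupp k (F : 'rV[R]_k -> R) :=
  measurable_fun [set: 'rV[R]_k] F /\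
  exists M : R, forall v, `|F v| <= M /\ (F v != 0 -> enorm v <= M).

Lemma bdsupp_integrable k (F : 'rV[R]_k -> R) : bdsupp F ->
  (leb k).-integrable setT (EFin \o F).
Proof.
move=> [mF [M MF]].
have M0 : 0 <= M by apply: le_trans (MF 0).1.
apply: (@le_integrable _ _ _ (leb k) setT measurableT _
   (fun v => (M * \1_(@eball R k (M + 1)) v)%:E)).
- exact/measurable_EFinP.
- move=> v _; rewrite /= lee_fin indicE.
  have [Fv0|Fv0] := eqVneq (F v) 0.
    by rewrite Fv0 normr0.
  rewrite mem_set ?mulr1; last by rewrite /eball /=; apply: le_lt_trans ((MF v).2 Fv0) _; rewrite ltrDl.
  by rewrite (ger0_norm M0); exact: (MF v).1.
have -> : (fun v => (M * \1_(@eball R k (M + 1)) v)%:E) =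
    (fun v => M%:E * (\1_(@eball R k (M + 1)) v)%:E)%E by apply/funext => v; rewrite EFinM.
apply: integrableZl => //; apply: integrable_indic_lty; [exact: measurable_eball|exact: leb_eball_lty].
Qed.

Lemma enorm_rcons0 k (s : R) (v : 'rV[R]_k) :
  enorm (rcons0 (s, v)) = Num.sqrt (s ^+ 2 + enorm v ^+ 2).
Proof.
rewrite {1}/enorm; congr Num.sqrt; rewrite enorm2 !dotvE big_ord_recl rcons0_0 expr2.
by congr (_ + _); apply: eq_bigr => i _; rewrite rcons0_lift.
Qed.

Lemma dotv_rcons0 k (s t : R) (u v : 'rV[R]_k) :
  dotv (rcons0 (s, u)) (rcons0 (t, v)) = s * t + dotv u v.
Proof.
rewrite !dotvE big_ord_recl !rcons0_0; congr (_ + _).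
by apply: eq_bigr => i _; rewrite !rcons0_lift.
Qed.

Lemma enorm_tail_le k (s : R) (v : 'rV[R]_k) : enorm v <= enorm (rcons0 (s, v)).
Proof.
rewrite enorm_rcons0 -[leLHS]ger0_norm ?enorm_ge0// -sqrtr_sqr.
by rewrite ler_sqrt ?addr_ge0 ?sqr_ge0// lerDr sqr_ge0.
Qed.

Lemma bdsupp_section k (F : 'rV[R]_k.+1 -> R) s : bdsupp F ->
  bdsupp (fun v => F (rcons0 (s, v))).
Proof.
move=> [mF [M MF]]; split.
  apply: measurableT_comp => //.
  by apply: measurableT_comp; [exact: measurable_rcons0|exact: measurable_pair1].
exists M => v; split; first exact: (MF _).1.
by move=> /(MF _).2; apply: le_trans; exact: enorm_tail_le.
Qed.

Lemma Rintegral_lebS k (F : 'rV[R]_k.+1 -> R) :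
  (leb k.+1).-integrable setT (EFin \o F) ->
  (forall s, (leb k).-integrable setT (EFin \o (fun v => F (rcons0 (s, v))))) ->
  \int[leb k.+1]_v F v = \int[@lebesgue_measure R]_s \int[leb k]_v F (rcons0 (s, v)).
Proof.
move=> intF intFs; rewrite /Rintegral integral_lebS//; congr fine.
apply: eq_integral => s _; rewrite fineK//.
exact: (integrable_fin_num measurableT (intFs s)).
Qed.

Lemma intRkE k (F : 'rV[R]_k -> R) : bdsupp F -> intRk F = \int[leb k]_v F v.
Proof.
elim: k F => [|k IH] F bF /=.
  rewrite /Rintegral integral_leb0//; apply/measurable_EFinP; exact: bF.1.
rewrite [RHS]Rintegral_lebS; last 2 first.
- exact: bdsupp_integrable.
- by move=> s; apply: bdsupp_integrable; exact: bdsupp_section.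
by apply: eq_Rintegral => s _; rewrite -IH//; exact: bdsupp_section.
Qed.

End bridge.

(** * Surface measure on the sphere *)

Section sphere_measure.
Context {R : realType} (k : nat).
Local Notation T := 'rV[R]_k.

Definition pball : set T := [set y | 0 < enorm y < 1].
Definition usphere : set T := [set y | enorm y = 1].
Definition nrm (y : T) : T := (enorm y)^-1 *: y.

Lemma measurable_nrm : measurable_fun [set: T] nrm.
Proof.
apply: measurable_rvZ => //.
apply: (measurableT_comp (@measurable_inv R)).
exact: (@measurable_enorm R k _ _ idfun (@measurable_id _ _ _)).
Qed.

Lemma measurable_pball : measurable pball.
Proof.
have -> : pball = (@enorm R k) @^-1` `]0, 1[%classic.
  by apply/seteqP; split => v /=; rewrite in_itv.
rewrite -[X in measurable X]setTI.
exact: (@measurable_enorm R k _ _ idfun (@measurable_id _ _ _)).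
Qed.

Lemma measurable_usphere : measurable usphere.
Proof.
have -> : usphere = (@enorm R k) @^-1` [set 1] by [].
rewrite -[X in measurable X]setTI.
exact: (@measurable_enorm R k _ _ idfun (@measurable_id _ _ _)).
Qed.

Lemma nrm_usphere y : pball y -> usphere (nrm y).
Proof. by move=> /andP[y0 _]; apply: enorm_normalize; rewrite -enorm_gt0. Qed.

Let m1 := measure_function_mrestr__canonical__measure_function_Measure (leb k) measurable_pball.
Let push : {measure set T -> \bar R} :=
  measure_function_pushforward__canonical__measure_function_Measure m1 measurable_nrm.
Let kn : {nonneg R} := NngNum (ler0n R k).
Let m : {measure set T -> \bar R} :=
  measure_function_mscale__canonical__measure_function_Measure kn push.

(* The surface measure of A is k times the volume of the cone over A in the unit ball. *)
Definition sphm (A : set T) : \bar R :=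
  (k%:R%:E * leb k (nrm @^-1` A `&` pball))%E.

Let mE : sphm = m. Proof. by []. Qed.

HB.instance Definition _ := isMeasure.Build _ _ _ sphm
  (measure0 m) (measure_ge0 m) (@measure_semi_sigma_additive _ _ _ m).

Let sphm_fin : fin_num_fun sphm.
Proof.
move=> A mA; rewrite /sphm fin_numM// ge0_fin_numE//.
apply: (@le_lt_trans _ _ (leb k (@eball R k 1))); last exact: leb_eball_lty.
apply: le_measure; rewrite ?inE; [|exact: measurable_eball|].
  apply: measurableI; last exact: measurable_pball.
  by rewrite -[X in measurable X]setTI; exact: measurable_nrm.
by move=> y [_ /andP[]].
Qed.

HB.instance Definition _ := Measure_isFinite.Build _ _ _ sphm sphm_fin.

Lemma ge0_integral_sphm (f : T -> \bar R) : measurable_fun setT f ->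
  (forall y, 0 <= f y)%E ->
  (\int[sphm]_y f y = k%:R%:E * \int[leb k]_(y in pball) f (nrm y))%E.
Proof.
move=> mf f0.
have -> : (\int[sphm]_y f y = \int[m]_y f y)%E by [].
rewrite /m ge0_integral_mscale//=; congr (_ * _)%E.
rewrite /push ge0_integral_pushforward//=; last first.
  exact: measurable_nrm.
rewrite preimage_setT ge0_integral_mrestr//.
by apply: measurableT_comp => //; exact: measurable_nrm.
Qed.

Lemma integrable_sphm (f : T -> \bar R) : (leb k).-integrable pball (f \o nrm) ->
  measurable_fun setT f -> sphm.-integrable setT f.
Proof.
move=> /integrableP[_ intf] mf; apply/integrableP; split => //.
rewrite ge0_integral_sphm//; last exact: measurableT_comp.
by rewrite lte_mul_pinfty.
Qed.

Lemma integral_sphm (f : T -> \bar R) : (0 < k)%N -> measurable_fun setT f ->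
  (\int[sphm]_y f y = k%:R%:E * \int[leb k]_(y in pball) f (nrm y))%E.
Proof.
move=> k0 mf; rewrite [LHS]integralE [in RHS]integralE gt0_muleBr ?ltr0n//.
congr (_ - _)%E; rewrite ge0_integral_sphm//; try exact: measurable_funepos;
  try exact: measurable_funeneg; congr (_ * _)%E; apply: eq_integral => y _.
  by rewrite -[LHS]/((f^\+ \o nrm)%E y) -funepos_comp.
by rewrite -[LHS]/((f^\- \o nrm)%E y) -funeneg_comp.
Qed.

(** [sphm] is a measure on all of R^k, which spares a measurable structure on the sphere; being
    carried by the unit sphere, it only sees the values of integrands there. *)
Lemma sphm_notsphere : sphm (~` usphere) = 0%E.
Proof.
rewrite /sphm; have -> : nrm @^-1` (~` usphere) `&` pball = set0.
  by apply/seteqP; split => // y /= [h /nrm_usphere].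
by rewrite measure0 mule0.
Qed.

Lemma sphm_rotation (Q : 'M[R]_k) (f : T -> \bar R) : Q *m Q^T = 1%:M ->
  measurable_fun setT f -> (forall y, 0 <= f y)%E ->
  (\int[sphm]_y f (y *m Q) = \int[sphm]_y f y)%E.
Proof.
move=> QQ mf f0.
rewrite !ge0_integral_sphm//; last by apply: measurableT_comp => //; exact: measurable_mulmx.
congr (_ * _)%E; rewrite !(integral_mkcond pball).
rewrite -[RHS](integral_rotation QQ); last first.
  apply/(measurable_restrictT _ measurable_pball).
  by apply: measurable_funTS; apply: measurableT_comp => //; exact: measurable_nrm.
apply: eq_integral => v _; rewrite !patchE /nrm scalemxAl enorm_orth//.
have -> // : (v \in pball) = (v *m Q \in pball).
by apply/idP/idP; rewrite !inE /pball /= enorm_orth.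
Qed.

Lemma sphm_integral_on (f : T -> \bar R) : measurable_fun setT f ->
  (\int[sphm]_y f y = \int[sphm]_(y in usphere) f y)%E.
Proof.
have mN : measurable (~` usphere) by exact: measurableC measurable_usphere.
move=> mf; rewrite [LHS]integralE [RHS]integralE.
have E g : measurable_fun setT g -> (forall y, 0 <= g y)%E ->
    (\int[sphm]_y g y = \int[sphm]_(y in usphere) g y)%E.
  move=> mg g0; rewrite (ge0_negligible_integral mN)//; last exact: sphm_notsphere.
  by rewrite setTD setCK.
congr (_ - _)%E; apply: E => //; [exact: measurable_funepos|exact: measurable_funeneg].
Qed.

End sphere_measure.

Section sphInt_bridge.
Context {R : realType} (k : nat).

Lemma leb_pball_lty : (leb k (@pball R k) < +oo)%E.
Proof.
apply: (@le_lt_trans _ _ (leb k (@eball R k 1))); last exact: leb_eball_lty.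
apply: le_measure; rewrite ?inE; [exact: measurable_pball|exact: measurable_eball|].
by move=> y /andP[].
Qed.

Lemma integrable_pball_bounded (F : 'rV[R]_k -> R) (M : R) :
  measurable_fun setT F -> (forall y, usphere y -> `|F y| <= M) ->
  (leb k).-integrable (@pball R k) (EFin \o (F \o @nrm R k)).
Proof.
move=> mF MF; apply: measurable_bounded_integrable.
- exact: measurable_pball.
- exact: leb_pball_lty.
- apply: measurable_funTS; apply: measurableT_comp => //; exact: measurable_nrm.
exists M; split; first exact: num_real.
by move=> z Mz y /nrm_usphere/MF h; exact: le_trans h (ltW Mz).
Qed.

Lemma integrable_sphm_bounded (F : 'rV[R]_k -> R) (M : R) :
  measurable_fun setT F -> (forall y, usphere y -> `|F y| <= M) ->
  (@sphm R k).-integrable setT (EFin \o F).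
Proof.
move=> mF MF; apply: integrable_sphm; last exact/measurable_EFinP.
exact: integrable_pball_bounded mF MF.
Qed.

Lemma sphInt_eq_on (F G : 'rV[R]_k -> R) : (forall y, usphere y -> F y = G y) ->
  sphInt F = sphInt G.
Proof.
move=> FG; congr (_ * intRk _); apply/funext => y.
by case: ifPn => // /nrm_usphere/FG.
Qed.

Lemma sphIntE (F : 'rV[R]_k -> R) (M : R) : (0 < k)%N ->
  measurable_fun setT F -> (forall y, usphere y -> `|F y| <= M) ->
  sphInt F = \int[@sphm R k]_y F y.
Proof.
move=> k0 mF MF; have M0 : 0 <= Num.max M 1 by rewrite le_max ler01 orbT.
rewrite /sphInt intRkE; last first.
  split.
    have -> : (fun y : 'rV[R]_k => if (0 < enorm y) && (enorm y < 1)
        then F ((enorm y)^-1 *: y) else 0) = (F \o (@nrm R k)) \_ (@pball R k).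
      apply/funext => y; rewrite patchE.
      by have -> : (y \in (@pball R k)) = (0 < enorm y < 1) by apply/idP/idP; rewrite inE.
    apply/(measurable_restrictT _ (@measurable_pball R k)).
    by apply: measurable_funTS; apply: measurableT_comp => //; exact: measurable_nrm.
  (* M bounds the values and 1 bounds the radius of the support, as the extension vanishes outside
     the unit ball. *)
  exists (Num.max M 1) => v; case: ifPn => [/andP[v0 v1]|_]; last first.
    by rewrite normr0 eqxx.
  rewrite !le_max; split; last by rewrite (ltW v1) orbT.
  by rewrite MF//; apply: nrm_usphere; rewrite /pball/= v0 v1.
rewrite /Rintegral integral_sphm//; last exact/measurable_EFinP.
have intF := integrable_pball_bounded mF MF.
rewrite -[k%:R in LHS]/(fine k%:R%:E) -fineM//; last first.
  rewrite -[X in X \is a fin_num](_ : \int[leb k]_(y in @pball R k) (F (nrm y))%:E = _)%E.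
    exact: (integrable_fin_num (@measurable_pball R k) intF).
  rewrite [LHS]integral_mkcond; apply: eq_integral => y _.
  rewrite patchE.
  have -> : (y \in (@pball R k)) = (0 < enorm y < 1) by apply/idP/idP; rewrite inE.
  by case: ifPn.
congr fine; congr (_ * _)%E; rewrite [RHS]integral_mkcond; apply: eq_integral => y _.
rewrite patchE.
have -> : (y \in (@pball R k)) = (0 < enorm y < 1) by apply/idP/idP; rewrite inE.
by case: ifPn.
Qed.

End sphInt_bridge.

Section householder.
Context {R : realType} {k : nat}.

(** The Householder reflection in the hyperplane orthogonal to a - b exchanges two unit vectors a
    and b; when they coincide there is no such hyperplane and the identity serves. *)
Lemma exists_orthogonal (a b : 'rV[R]_k) : enorm a = 1 -> enorm b = 1 ->
  exists O : 'M[R]_k, O *m O^T = 1%:M /\ a *m O = b.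
Proof.
move=> a1 b1; have [<-|ab] := eqVneq a b.
  by exists 1%:M; rewrite trmx1 mulmx1 mulmx1.
have [u uE] : {u | u = a - b} by exists (a - b).
pose c := 2 / dotv u u.
have u0 : dotv u u != 0 by rewrite uE -enorm2 sqrf_eq0 enorm_eq0 subr_eq0.
have uu : u *m u^T = (dotv u u)%:M by rewrite [LHS]mx11_scalar.
exists (1%:M - c *: (u^T *m u)).
have sym : (1%:M - c *: (u^T *m u))^T = 1%:M - c *: (u^T *m u).
  by rewrite linearB/= linearZ/= trmx1 trmx_mul trmxK.
have aa : dotv a a = 1 by rewrite -enorm2 a1 expr1n.
have bb : dotv b b = 1 by rewrite -enorm2 b1 expr1n.
split.
  have WW : (u^T *m u) *m (u^T *m u) = dotv u u *: (u^T *m u).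
    by rewrite mulmxA -(mulmxA _ u) uu mul_mx_scalar -scalemxAl.
  rewrite sym mulmxBl mul1mx mulmxBr mulmx1 -scalemxAl -scalemxAr WW !scalerA.
  have -> : c * c * dotv u u = c + c by rewrite /c; field.
  by rewrite scalerDl opprB addrK subrK.
rewrite mulmxBr mulmx1 -scalemxAr mulmxA.
have -> : a *m u^T = (dotv a u)%:M by rewrite [LHS]mx11_scalar.
rewrite mul_scalar_mx scalerA (_ : c * dotv a u = 1).
  by rewrite scale1r uE opprB addrC subrK.
move: u0; rewrite /c uE !dotvBl !dotvBr aa bb (dotvC b a) => u0.
have -> : 1 - dotv a b - (dotv a b - 1) = 2 * (1 - dotv a b) by ring.
have -> : 1 - dotv a b = (2 * (1 - dotv a b)) / 2 by field.
move: u0; rewrite (_ : 1 - dotv a b - (dotv a b - 1) = 2 * (1 - dotv a b)); last by ring.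
by move=> u0; field; rewrite mulf_eq0 negb_or in u0; case/andP: u0.
Qed.

End householder.

(** * Polar coordinates *)

Section polar.
Local Open Scope ereal_scope.
Context {R : realType}.

Lemma integral_indicM d (T : measurableType d) (mu : {measure set T -> \bar R})
    (A : set T) (f : T -> R) :
  \int[mu]_x (f x * \1_A x)%:E = \int[mu]_(x in A) (f x)%:E.
Proof.
rewrite [RHS]integral_mkcond; apply: eq_integral => x _.
by rewrite patchE indicE; case: (x \in A); rewrite ?mulr1 ?mulr0.
Qed.

(* Domains of integration are encoded by factors [posr], so that Tonelli is only applied on whole spaces. *)
Definition posr (x : R) : R := \1_(`]0%R, +oo[%classic) x.

Lemma posrE x : posr x = (0 < x)%R%:R.
Proof.
by rewrite /posr indicE; congr (nat_of_bool _)%:R; apply/idP/idP; rewrite inE /= in_itv /= andbT.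
Qed.

Lemma posr_ge0 x : (0 <= posr x)%R.
Proof. by rewrite posrE. Qed.

Lemma measurable_posr : measurable_fun [set: R] posr.
Proof. exact: measurable_indic. Qed.

Lemma measurable_posr_comp d (T : measurableType d) (f : T -> R) :
  measurable_fun setT f -> measurable_fun setT (fun x => posr (f x)).
Proof. exact: measurableT_comp measurable_posr. Qed.

Lemma integral_posr_ray (f : R -> R) (a : R) :
  \int[@lebesgue_measure R]_t (f t * posr (t - a))%:E =
  \int[@lebesgue_measure R]_(t in `]a, +oo[) (f t)%:E.
Proof.
rewrite [RHS]integral_mkcond; apply: eq_integral => t _.
rewrite patchE posrE subr_gt0.
have -> : (t \in `]a, +oo[%classic) = (a < t)%R by apply/idP/idP; rewrite inE /= in_itv /= andbT.
by case: ifPn => _; rewrite ?mulr1 ?mulr0.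
Qed.

Lemma integral_posr_itv (f : R -> R) (a b : R) :
  \int[@lebesgue_measure R]_t (f t * posr (t - a) * posr (b - t))%:E =
  \int[@lebesgue_measure R]_(t in `]a, b[) (f t)%:E.
Proof.
rewrite [RHS]integral_mkcond; apply: eq_integral => t _.
rewrite patchE !posrE !subr_gt0.
have -> : (t \in `]a, b[%classic) = (a < t)%R && (t < b)%R.
  by apply/idP/idP; rewrite inE /= in_itv.
by case: (a < t)%R; case: (t < b)%R; rewrite /= ?mulr1 ?mulr0.
Qed.

Lemma within_continuous_derive (F : R -> R) (A : set R) (dF : R -> R) :
  (forall x, A x -> is_derive x (1%R : R) F (dF x)) ->
  forall x, A x -> F t @[t --> x] --> F x.
Proof.
move=> d x Ax; apply: (@differentiable_continuous _ _ _ x F).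
by apply/derivable1_diffP; have [] := d x Ax.
Qed.

Lemma integral_ray_FTC (f F : R -> R) (a l : R) :
  {within `[a, +oo[, continuous f} -> (forall x, (a <= x)%R -> (0 <= f x)%R) ->
  (forall x, (a <= x)%R -> is_derive x (1%R : R) F (f x)) -> F x @[x --> +oo%R] --> l ->
  \int[@lebesgue_measure R]_x (f x * posr (x - a))%:E = (l - F a)%:E.
Proof.
move=> cf f0 dF Fl; rewrite integral_posr_ray integral_itv_obnd_cbnd; last first.
  apply/measurable_EFinP; apply: (measurable_funS (E := `[a, +oo[%classic)) => //.
    by apply: subset_itvr; rewrite bnd_simp.
  exact: subspace_continuous_measurable_fun.
rewrite (@ge0_continuous_FTC2y _ _ F a l)//.
- by move=> x /ltW /dF[].
- by apply: cvg_at_right_filter; exact: (within_continuous_derive dF).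
- by move=> x; rewrite in_itv /= andbT => /ltW /dF[_ <-]; rewrite derive1E.
Qed.

Lemma integral_itv_FTC (f F : R -> R) (a b : R) : (a < b)%R ->
  {within `[a, b], continuous f} -> (forall x, (a <= x <= b)%R -> is_derive x (1%R : R) F (f x)) ->
  \int[@lebesgue_measure R]_x (f x * posr (x - a) * posr (b - x))%:E = (F b - F a)%:E.
Proof.
move=> ab cf dF; rewrite integral_posr_itv.
have mf : measurable_fun `]a, b[ (fun x => (f x)%:E).
  apply/measurable_EFinP; apply: (measurable_funS (E := `[a, b]%classic)) => //.
    by apply: subset_itvW; rewrite bnd_simp.
  exact: subspace_continuous_measurable_fun.
rewrite -(@integral_itv_bndoo _ a b _ true false)//.
rewrite (@continuous_FTC2 _ _ F)//.
- split.
  + by move=> x; rewrite in_itv /= => /andP[/ltW ax /ltW xb]; have [] := dF x; rewrite ?ax.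
  + by apply: cvg_at_right_filter; apply: (within_continuous_derive dF); rewrite /= lexx ltW.
  + by apply: cvg_at_left_filter; apply: (within_continuous_derive dF); rewrite /= lexx ltW.
- move=> x; rewrite in_itv /= => /andP[/ltW ax /ltW xb]; rewrite derive1E.
  by have [|_ ->] := dF x; rewrite ?ax.
Qed.

Lemma measurable_rv0 k : measurable [set (0%R : 'rV[R]_k)].
Proof.
have -> : [set (0%R : 'rV[R]_k)] = cube 0%R.
  apply/seteqP; split => [v -> i|v /= v0]; first by rewrite mxE normr0.
  by apply/rowP => i; rewrite mxE; apply/eqP; rewrite -normr_le0.
exact: measurable_cube.
Qed.

Lemma leb_set0 k : (0 < k)%N -> @leb R k [set 0%R] = 0.
Proof.
case: k => // k _; apply/eqP; rewrite eq_le measure_ge0 andbT.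
have -> : 0 = leb k.+1 (@cube R k.+1 0%R) by rewrite leb_cube// mulr0 exprS mul0r.
apply: le_measure; rewrite ?inE; [exact: measurable_rv0|exact: measurable_cube|].
by move=> v -> i; rewrite mxE normr0.
Qed.

Lemma is_derive1_exp n (x : R) : is_derive x 1%R (fun t : R => t ^+ n)%R (n%:R * x ^+ n.-1)%R.
Proof.
apply: DeriveDef; first exact: exprn_derivable.
by rewrite exp_derive /GRing.scale /= mulr1.
Qed.

Lemma is_derive1_expV n (x : R) : x != 0%R ->
  is_derive x 1%R (fun t : R => t ^- n)%R (- (n%:R * x ^- n.+1))%R.
Proof.
move=> x0; have := @is_deriveV R (fun t => t ^+ n)%R x _ 1%R _ (is_derive1_exp n x).
move=> /(_ (expf_neq0 n x0)) h; apply: (is_derive_eq h).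
rewrite /GRing.scale /= mulNr; congr (- _)%R.
case: n h => [|n] _; first by rewrite !mul0r mulr0.
by rewrite /= !exprS; field; rewrite x0 expf_neq0.
Qed.

Lemma cvg_expV_pinfty n : (0 < n)%N -> (t ^- n)%R @[t --> +oo%R] --> (0 : R)%R.
Proof.
move=> n0; have h : (t^-1)%R @[t --> +oo%R] --> (0 : R)%R.
  by apply/(gtr0_cvgV0 (f := id)) => //; apply: nbhs_pinfty_gt; exact: num_real.
have := continuous_cvg _ (@exprn_continuous R n 0%R) h.
rewrite expr0n eqn0Ngt n0 /=; move=> /(_ _).
have -> // : (fun t : R => t ^- n)%R = (fun t => (t^-1) ^+ n)%R.
by apply/funext => t; rewrite exprVn.
Qed.

Lemma measurable_expV d (T : measurableType d) n (f : T -> R) :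
  measurable_fun setT f -> measurable_fun setT (fun x => f x ^- n)%R.
Proof.
move=> mf; have -> : (fun x => f x ^- n)%R = (fun x => (f x)^-1 ^+ n)%R.
  by apply/funext => t; rewrite exprVn.
apply: (@measurable_funX _ T R setT (fun x => (f x)^-1)%R n).
exact: (measurableT_comp (@measurable_inv R) mf).
Qed.

Lemma integral_power_tail (n : nat) (a : R) : (0 < a)%R -> (0 < n)%N ->
  \int[@lebesgue_measure R]_t (n%:R * t ^- n.+1 * posr (t - a))%:E = (a ^- n)%:E.
Proof.
move=> a0 n0; have tn0 t : (a <= t)%R -> t != 0%R by move=> at0; rewrite gt_eqF// (lt_le_trans a0).
have Fd t : (a <= t)%R -> is_derive t (1%R : R) (fun t : R => - t ^- n)%R (n%:R * t ^- n.+1)%R.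
  move=> at0; have h := is_deriveN (is_derive1_expV n (tn0 _ at0)).
  by apply: (is_derive_eq h); rewrite opprK.
rewrite (integral_ray_FTC (l := 0%R) _ _ Fd) ?sub0r ?opprK//.
- apply: continuous_in_subspaceT => t; rewrite inE /= in_itv /= andbT => at0.
  apply: cvgM; first exact: cvg_cst.
  apply: cvgV; first by rewrite expf_neq0// tn0.
  exact: exprn_continuous.
- by move=> t at0; rewrite mulr_ge0// invr_ge0 exprn_ge0// ltW// (lt_le_trans a0).
- by rewrite -oppr0; apply: cvgN; exact: cvg_expV_pinfty.
Qed.

Lemma tonelli_Rn n (f : R * 'rV[R]_n -> \bar R) :
  measurable_fun [set: measurableTypeR R * 'rV[R]_n] f -> (forall p, 0 <= f p) ->
  \int[@lebesgue_measure R]_r \int[leb n]_y f (r, y) =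
  \int[leb n]_y \int[@lebesgue_measure R]_r f (r, y).
Proof. by move=> mf f0; exact: fubini_tonelli. Qed.

Lemma ae_off0 n (P : 'rV[R]_n -> Prop) : (0 < n)%N ->
  (forall z, z != 0%R -> P z) -> {ae leb n, forall z, P z}.
Proof.
move=> n0 H; exists [set 0%R]; split; [exact: measurable_rv0|exact: leb_set0|].
move=> z /= nP; apply: contrapT => z0; apply: nP; apply: H; exact/eqP.
Qed.

Lemma integral_eq_off0 n (f g : 'rV[R]_n -> \bar R) : (0 < n)%N ->
  measurable_fun setT f -> measurable_fun setT g ->
  (forall z, z != 0%R -> f z = g z) -> \int[leb n]_z f z = \int[leb n]_z g z.
Proof.
move=> n0 mf mg fg; apply: ae_eq_integral => //.
by apply: ae_off0 => // z z0 _; exact: fg.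
Qed.

Section polar_formula.
Context (n : nat) (F : 'rV[R]_n -> \bar R).
Hypothesis n0 : (0 < n)%N.
Hypothesis mF : measurable_fun setT F.
Hypothesis F0 : forall z, 0 <= F z.
Local Notation L := (@lebesgue_measure R).
Local Notation V := 'rV[R]_n.
Local Notation M := (measurableTypeR R).

Let ind (y : 'rV[R]_n) : R := (posr (enorm y) * posr (1 - enorm y))%R.

Let menorm d (T : measurableType d) (f : T -> 'rV[R]_n) :
  measurable_fun setT f -> measurable_fun setT (fun x => enorm (f x)).
Proof. by move=> mf; exact: measurable_enorm. Qed.

Let mind d (T : measurableType d) (f : T -> 'rV[R]_n) :
  measurable_fun setT f -> measurable_fun setT (fun x => ind (f x)).
Proof.
move=> mf; apply: measurable_funM; apply: measurable_posr_comp; first exact: menorm.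
by apply: measurable_funB => //; exact: menorm.
Qed.

Let ind_ge0 y : (0 <= ind y)%R. Proof. by rewrite mulr_ge0// posr_ge0. Qed.

Let indE y : ind y = (y \in @pball R n)%:R.
Proof.
rewrite /ind !posrE subr_gt0 -natrM mulnb; congr (nat_of_bool _)%:R.
by apply/idP/idP; rewrite inE.
Qed.

(** [K1] is the polar integrand with [sphm] unfolded to the punctured unit ball. Replacing r by |y|
    r, with factor |y|, turns it into [K2], where the normalisation has disappeared; replacing y by
    y / r, with factor r^(-n), turns [K2] into [K3], where F no longer depends on r. *)
Let K1 (p : M * V) := (n%:R * p.1 ^+ n.-1 * posr p.1 * ind p.2)%:E * F (p.1 *: nrm p.2)%R.
Let K2 (p : V * M) := (n%:R * p.2 ^+ n.-1 * enorm p.1 ^+ n * posr p.2 * ind p.1)%:E * F (p.2 *: p.1)%R.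
Let K3 (p : M * V) := (n%:R * p.1 ^- n.+1 * enorm p.2 ^+ n * posr (enorm p.2) * posr (p.1 - enorm p.2))%:E * F p.2.

Let mK1 : measurable_fun setT K1.
Proof.
apply: emeasurable_funM.
  apply/measurable_EFinP; apply: measurable_funM; last exact: mind.
  apply: measurable_funM; last exact: measurable_posr_comp.
  by apply: measurable_funM => //; exact: measurable_funX.
apply: (measurableT_comp mF); apply: measurable_rvZ => //.
by apply: (measurableT_comp (@measurable_nrm R n)).
Qed.

Let mK2 : measurable_fun setT K2.
Proof.
apply: emeasurable_funM.
  apply/measurable_EFinP; apply: measurable_funM; last exact: mind.
  apply: measurable_funM; last exact: measurable_posr_comp.
  apply: measurable_funM; last by apply: measurable_funX; exact: menorm.
  by apply: measurable_funM => //; exact: measurable_funX.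
by apply: (measurableT_comp mF); apply: measurable_rvZ.
Qed.

Let mK3 : measurable_fun setT K3.
Proof.
apply: emeasurable_funM; last exact: (measurableT_comp mF).
apply/measurable_EFinP; apply: measurable_funM; last first.
  by apply: measurable_posr_comp; apply: measurable_funB => //; exact: menorm.
apply: measurable_funM; last by apply: measurable_posr_comp; exact: menorm.
apply: measurable_funM; last by apply: measurable_funX; exact: menorm.
by apply: measurable_funM => //; exact: measurable_expV.
Qed.

Let K1_ge0 p : 0 <= K1 p.
Proof.
apply: mule_ge0 => //; rewrite lee_fin mulr_ge0//.
rewrite posrE; case: ltP => p0; last by rewrite mulr0.
by rewrite mulr1 mulr_ge0// exprn_ge0// ltW.
Qed.

Let K2_ge0 p : 0 <= K2 p.
Proof.
apply: mule_ge0 => //; rewrite lee_fin mulr_ge0//.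
rewrite posrE; case: ltP => p0; last by rewrite mulr0.
by rewrite mulr1 !mulr_ge0// exprn_ge0// ?enorm_ge0// ltW.
Qed.

Let K3_ge0 p : 0 <= K3 p.
Proof.
apply: mule_ge0 => //; rewrite lee_fin.
rewrite (posrE (_ - _)) subr_gt0; case: ltP => p0; last by rewrite mulr0.
have p1 : (0 <= p.1)%R by apply: ltW (le_lt_trans _ p0); exact: enorm_ge0.
by rewrite mulr1 !mulr_ge0// ?posr_ge0// ?invr_ge0 exprn_ge0// enorm_ge0.
Qed.

Let step1 : \int[L]_r ((r ^+ n.-1 * posr r)%:E * \int[@sphm R n]_w F (r *: w)%R) =
  \int[L]_r \int[leb n]_y K1 (r, y).
Proof.
apply: eq_integral => r _.
have mFr : measurable_fun [set: 'rV[R]_n] (fun w => F (r *: w)%R).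
  by apply: (measurableT_comp mF); apply: measurable_rvZ.
rewrite ge0_integral_sphm// muleA integral_mkcond -ge0_integralZlT; last 3 first.
- apply/(measurable_restrictT _ (@measurable_pball R n)); apply: measurable_funTS.
  by apply: (measurableT_comp mFr); exact: measurable_nrm.
- by move=> y; rewrite patchE; case: ifPn.
- rewrite -EFinM lee_fin mulr_ge0//; rewrite posrE; case: ltP => p0; last by rewrite mulr0.
  by rewrite mulr1 exprn_ge0// ltW.
apply: eq_integral => y _; rewrite /K1 /= patchE indE.
case: ifPn => _; rewrite ?mulr1 ?mulr0 ?mule0 ?mul0e//; congr (_ * _).
by rewrite -EFinM; congr EFin; ring.
Qed.

Let step2 : \int[L]_r \int[leb n]_y K1 (r, y) = \int[leb n]_y \int[L]_r K2 (y, r).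
Proof.
rewrite (tonelli_Rn mK1 K1_ge0); apply: eq_integral => y _.
have [yb|yb] := boolP (y \in @pball R n); last first.
  by rewrite !integral0_eq// => r _; rewrite /K1 /K2 /= indE (negbTE yb) mulr0 mul0e.
have y0 : (0 < enorm y)%R by move: yb; rewrite inE => /andP[].
have mK1y : measurable_fun [set: R] (fun r => K1 (r, y)).
  by apply: (measurableT_comp mK1); exact: measurable_pair2.
have := ge0_integral_affine1 0%R y0 mK1y (fun r => K1_ge0 _).
move=> /(congr1 (fun z => (enorm y)%:E * z)).
rewrite muleA -EFinM mulfV ?gt_eqF// mul1e => <-.
rewrite -ge0_integralZlT//; last 2 first.
- apply: (measurableT_comp mK1y).
  by apply: measurable_funD => //; exact: measurable_funM.
- by rewrite lee_fin ltW.
apply: eq_integral => r _; rewrite /K1 /K2 /= addr0 muleA -EFinM.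
have -> : (enorm y * r *: nrm y = r *: y)%R.
  by rewrite /nrm scalerA mulrC mulrA mulVf ?mul1r// gt_eqF.
congr (EFin _ * _).
have -> : posr (enorm y * r) = posr r by rewrite !posrE pmulr_rgt0.
have E : (enorm y * enorm y ^+ n.-1 = enorm y ^+ n)%R by rewrite -exprS prednK.
by rewrite exprMn -E; ring.
Qed.

Let step3 : \int[leb n]_y \int[L]_r K2 (y, r) = \int[L]_r \int[leb n]_y K3 (r, y).
Proof.
have mK2' : measurable_fun [set: M * V] (fun p => K2 (p.2, p.1)).
  by apply: (measurableT_comp mK2); exact: measurable_fun_pair.
have := tonelli_Rn mK2' (fun p => K2_ge0 _) => /= <-; apply: eq_integral => r _.
have [r0|r0] := ltP 0%R r; last first.
  rewrite !integral0_eq// => y _; rewrite /K3 /K2 /=.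
    by rewrite (posrE (_ - _)) subr_gt0 ltNge (le_trans r0 (enorm_ge0 _)) /= mulr0 mul0e.
  by rewrite (posrE r) ltNge r0 mulr0 mul0r mul0e.
have mK2r : measurable_fun [set: 'rV[R]_n] (fun y => K2 (y, r)).
  by apply: (measurableT_comp mK2); exact: measurable_pair2.
have ri0 : (0 < r^-1)%R by rewrite invr_gt0.
have := integral_scaling ri0 mK2r.
move=> /(congr1 (fun z => ((r ^-1) ^+ n)%:E * z)).
rewrite muleA -EFinM mulfV ?mul1e; last by rewrite expf_neq0// gt_eqF.
move=> <-; rewrite -ge0_integralZlT//; last 2 first.
- by apply: (measurableT_comp mK2r); exact: measurable_rvZ.
- by rewrite lee_fin exprn_ge0// ltW.
apply: eq_integral => y _; rewrite /K2 /K3 /= scalerA mulfV ?gt_eqF// scale1r muleA -EFinM.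
congr (EFin _ * _).
rewrite /ind enormZ ger0_norm ?(ltW ri0)// exprMn posrE r0 mulr1.
have -> : posr (r^-1 * enorm y) = posr (enorm y) by rewrite !posrE pmulr_rgt0.
have -> : posr (1 - r^-1 * enorm y) = posr (r - enorm y).
  by rewrite !posrE !subr_gt0 mulrC ltr_pdivrMr// mul1r.
have E : (r^-1 ^+ n * (r ^+ n.-1 * r^-1 ^+ n) = r ^- n.+1)%R.
  case: (n) n0 => // m _; rewrite /= !exprVn !exprS; field.
  by rewrite expf_neq0 gt_eqF.
by rewrite -E; ring.
Qed.

(* Insert |z|^n * (integral of n r^(-n-1) over r > |z|) = 1 and swap; the inner integral over the ball |z| < r
   scales to the unit ball, that is, to [sphm]. *)
Lemma ge0_polar : \int[leb n]_z F z =
  \int[L]_r ((r ^+ n.-1 * posr r)%:E * \int[@sphm R n]_w F (r *: w)%R).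
Proof.
rewrite step1 step2 step3 (tonelli_Rn mK3 K3_ge0).
apply: integral_eq_off0 => //.
  exact: (@measurable_fun_fubini_tonelli_G _ _ _ _ R lebesgue_measure _ mK3 K3_ge0).
move=> y y0.
have ye : (0 < enorm y)%R by rewrite enorm_gt0.
have h r : K3 (r, y) = ((enorm y ^+ n)%:E * F y) * (n%:R * r ^- n.+1 * posr (r - enorm y))%:E.
  rewrite /K3 /= [posr (enorm y)]posrE ye mulr1 muleAC -EFinM; congr (EFin _ * _).
  by ring.
under eq_integral do rewrite h.
rewrite ge0_integralZlT//.
- by rewrite integral_power_tail// muleAC -EFinM mulfV ?mul1e// expf_neq0// gt_eqF.
- apply/measurable_EFinP; apply: measurable_funM.
    by apply: measurable_funM => //; exact: measurable_expV.
  by apply: measurable_posr_comp; exact: measurable_funB.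
- move=> r; rewrite lee_fin posrE subr_gt0; case: ltP => p0; last by rewrite mulr0.
  by rewrite mulr1 mulr_ge0// invr_ge0 exprn_ge0// ltW// (lt_trans ye).
- by rewrite mule_ge0// lee_fin exprn_ge0// enorm_ge0.
Qed.

End polar_formula.

End polar.

Lemma cont_comp {U T V : topologicalType} (h : U -> T) (f : T -> V) :
  continuous h -> continuous f -> continuous (f \o h).
Proof. by move=> ch cf x; apply: continuous_comp; [exact: ch|exact: cf]. Qed.

Section continuous_ops.
Context {R : realType} {T : topologicalType}.
Implicit Types f g : T -> R.

Lemma cont_mul f g : continuous f -> continuous g -> continuous (fun x => f x * g x).
Proof. by move=> cf cg x; exact: (@cvgM _ _ (nbhs x) _ f g _ _ (cf x) (cg x)). Qed.

Lemma cont_add f g : continuous f -> continuous g -> continuous (fun x => f x + g x).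
Proof. by move=> cf cg x; exact: (@cvgD _ _ _ (nbhs x) _ f g _ _ (cf x) (cg x)). Qed.

Lemma cont_opp f : continuous f -> continuous (fun x => - f x).
Proof. by move=> cf x; exact: (@cvgN _ _ _ (nbhs x) _ f _ (cf x)). Qed.

Lemma cont_sub f g : continuous f -> continuous g -> continuous (fun x => f x - g x).
Proof. by move=> cf cg; apply: cont_add => //; exact: cont_opp. Qed.

Lemma cont_norm f : continuous f -> continuous (fun x => `|f x|).
Proof. by move=> cf x; exact: (@cvg_norm _ _ _ (nbhs x) _ f _ (cf x)). Qed.

Lemma cont_cst (c : R) : continuous (fun _ : T => c).
Proof. by move=> x; exact: cvg_cst. Qed.

Lemma cont_exp f n : continuous f -> continuous (fun x => f x ^+ n).
Proof.
move=> cf; elim: n => [|n IH]; first exact: cont_cst.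
rewrite (_ : (fun x => _) = (fun x => f x * f x ^+ n)); first exact: cont_mul.
by apply/funext => x; rewrite exprS.
Qed.

Lemma cont_sqrt f : continuous f -> continuous (fun x => Num.sqrt (f x)).
Proof. by move=> cf x; apply: (@continuous_comp _ _ _ f Num.sqrt x); [exact: cf|exact: sqrt_continuous]. Qed.

End continuous_ops.

(** * The hemisphere as a graph *)

Section graph1.
Local Open Scope ereal_scope.
Context {R : realType}.
Local Notation L := (@lebesgue_measure R).

Lemma ge0_integral_opp (f : R -> \bar R) : measurable_fun setT f ->
  (forall x, 0 <= f x) -> \int[L]_x f (- x)%R = \int[L]_x f x.
Proof.
move=> mf f0.
pose phi (x : measurableTypeR R) : measurableTypeR R := (- x)%R.
have mphi : measurable_fun [set: measurableTypeR R] phi by exact: oppr_measurable.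
pose push : {measure set (measurableTypeR R) -> \bar R} :=
  measure_function_pushforward__canonical__measure_function_Measure L mphi.
transitivity (\int[push]_x f x).
  by rewrite /push ge0_integral_pushforward//= preimage_setT.
by apply: eq_measure_integral => A mA _; exact: lebesgue_measureN.
Qed.

Lemma ge0_integral_even (f : R -> R) : measurable_fun setT f ->
  (forall x, 0 <= f x)%R -> (forall x, f (- x) = f x)%R ->
  \int[L]_x (f x)%:E = 2%:E * \int[L]_x (f x * posr x)%:E.
Proof.
move=> mf f0 fN.
have mfp : measurable_fun setT (fun x => f x * posr x)%R.
  by apply: measurable_funM => //; exact: measurable_posr.
have mfp' : measurable_fun setT (fun x : R => f x * posr (- x))%R.
  apply: measurable_funM => //; apply: measurableT_comp; first exact: measurable_posr.
  exact: oppr_measurable.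
have mEp : measurable_fun setT (fun x => (f x * posr x)%:E) by exact/measurable_EFinP.
have mEp' : measurable_fun setT (fun x : R => (f x * posr (- x))%:E) by exact/measurable_EFinP.
(* The splitting holds only off 0, because [posr] vanishes at 0; hence equality almost
   everywhere. *)
transitivity (\int[L]_x ((f x * posr x)%:E + (f x * posr (- x))%:E)).
  apply: ae_eq_integral => //; first exact/measurable_EFinP.
    exact: emeasurable_funD.
  exists [set 0%R]; split; [exact: measurable_set1|exact: lebesgue_measure_set1|].
  move=> x /= h; apply: contrapT => x0; apply: h => _.
  rewrite -EFinD -mulrDr !posrE oppr_gt0.
  by case: (ltgtP x 0%R) x0 => // _ _; rewrite ?add0r ?addr0 mulr1.
rewrite ge0_integralD//; last 2 first.
- by move=> x _; rewrite lee_fin mulr_ge0// posr_ge0.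
- by move=> x _; rewrite lee_fin mulr_ge0// posr_ge0.
rewrite -(ge0_integral_opp mEp'); last first.
  by move=> x; rewrite lee_fin mulr_ge0// posr_ge0.
under [X in _ + X]eq_integral do rewrite fN opprK.
have -> : 2%:E = 1 + 1 :> \bar R by rewrite -EFinD; congr EFin; rewrite -[1%R]/(1%:R) -natrD.
by rewrite ge0_muleDl// !mul1e.
Qed.

Context (a : R) (h : R -> R).
Hypothesis a0 : (0 < a)%R.
Hypothesis ch : forall r : R, (0 < r)%R -> {for r, continuous h}.
Hypothesis h_ge0 : forall r, (0 <= h r)%R.
Let N (s : R) : R := Num.sqrt (s ^+ 2 + a ^+ 2).

Let s2a (s : R) : (0 < s ^+ 2 + a ^+ 2)%R.
Proof. by rewrite ltr_wpDl ?sqr_ge0// exprn_gt0. Qed.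

Let N_gt0 s : (0 < N s)%R. Proof. by rewrite sqrtr_gt0. Qed.

Let N_der s : is_derive s (1%R : R) N (s / N s)%R.
Proof.
have h1 := @is_derive1_sqrt R _ (s2a s).
have h2 : is_derive s (1%R : R) (fun s : R => s ^+ 2 + a ^+ 2)%R (2 * s)%R.
  have := @is_deriveD _ _ _ _ _ _ _ _ _ (is_derive1_exp 2 s) (is_derive_cst (a ^+ 2)%R s 1%R).
  by move=> h3; apply: (is_derive_eq h3); rewrite addr0 expr1.
have := @is_derive1_comp R Num.sqrt (fun s : R => s ^+ 2 + a ^+ 2)%R s _ _ h1 h2.
move=> h3; apply: (is_derive_eq h3).
by rewrite -/(N s); have := N_gt0 s => /lt0r_neq0 ?; field.
Qed.

Let N_der1 : N^`()%classic = (fun s : R => s / N s)%R.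
Proof. by apply/funext => s; rewrite derive1E; have [_ ->] := N_der s. Qed.

Let N_cont : continuous N.
Proof.
move=> s; apply: (@differentiable_continuous _ _ _ s N).
by apply/derivable1_diffP; have [] := N_der s.
Qed.

Let N'_cont : continuous (fun s : R => s / N s)%R.
Proof.
move=> s; apply: cvgM; first exact: cvg_id.
apply: cvgV; first by rewrite gt_eqF.
exact: N_cont.
Qed.

(** Substitution r = N(s) = sqrt (s^2 + a^2) with dr = (s / N(s)) ds on s > 0, doubled by evenness.
    The range runs from N(0) = a to N(s1) = 1 with s1 = sqrt (1 - a^2), so h has to be continuous
    only at positive arguments. *)
Lemma ge0_integral_graph1 : (a < 1)%R ->
  \int[L]_s ((`|s| / N s * h (N s)) * posr (1 - N s))%:E =
  2%:E * \int[L]_(r in `[a, 1%R]) (h r)%:E.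
Proof.
move=> a1.
rewrite ge0_integral_even; last 3 first.
- apply: measurable_funM.
    apply: continuous_measurable_fun => s; apply: cvgM.
      have -> : (fun s => `|s| / N s)%R = (fun s => `|s| * (N s)^-1)%R by [].
      apply: cvgM; first exact: norm_continuous.
      by apply: cvgV; [rewrite gt_eqF|exact: N_cont].
    apply: (@continuous_comp _ _ _ N h s); first exact: N_cont.
    exact: ch.
  apply: measurableT_comp; first exact: measurable_posr.
  apply: measurable_funB => //.
  exact: continuous_measurable_fun.
- move=> s; rewrite !mulr_ge0// ?posr_ge0//.
  by rewrite invr_ge0 ltW.
- by move=> s; rewrite normrN /N sqrrN.
congr (_ * _).
pose s1 := Num.sqrt (1 - a ^+ 2).
have a21 : (0 < 1 - a ^+ 2)%R by rewrite subr_gt0 expr_lt1// ltW.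
have s10 : (0 < s1)%R by rewrite sqrtr_gt0.
have Na : N 0%R = a by rewrite /N expr0n add0r sqrtr_sqr ger0_norm// ltW.
have N1 : N s1 = 1%R by rewrite /N /s1 sqr_sqrtr ?(ltW a21)// subrK sqrtr1.
have Nlt : {in `[0%R, s1] &, {homo N : x y / (x < y)%R}}.
  move=> x y; rewrite !in_itv /= => /andP[x0 _] /andP[y0 _] xy.
  by rewrite ltr_sqrt// ltrD2r ltr_pXn2r.
rewrite -[in RHS]Na -[in RHS]N1 (integration_by_substitution_increasing (F := N))//.
- rewrite integral_itv_bndoo; last first.
    apply/measurable_EFinP; rewrite N_der1; apply: measurable_funTS.
    apply: continuous_measurable_fun => s; apply: cvgM; last exact: N'_cont.
    apply: (@continuous_comp _ _ _ N h s); first exact: N_cont.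
    exact: ch.
  rewrite [RHS]integral_mkcond; apply: eq_integral => s _.
  rewrite patchE N_der1 /=.
  have -> : (s \in `]0%R, s1[%classic) = (0 < s < s1)%R.
    by apply/idP/idP; rewrite inE /= in_itv.
  rewrite !posrE.
  case: (ltP 0%R s) => s0 /=; last by rewrite mulr0.
  have -> : (0 < 1 - N s)%R = (s < s1)%R.
    rewrite subr_gt0 -[X in (_ < X)%R]N1 ltr_sqrt// ltrD2r ltr_pXn2r// nnegrE ltW//.
  case: ifPn => _; last by rewrite mulr0 mul0r.
  by rewrite !mulr1 gtr0_norm// mulrC.
- by rewrite ltW.
- by rewrite N_der1 => s _; exact: N'_cont.
- rewrite N_der1; apply/cvg_ex; exists (0%R / N 0%R)%R.
  by apply: cvg_at_right_filter; exact: N'_cont.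
- rewrite N_der1; apply/cvg_ex; exists (s1 / N s1)%R.
  by apply: cvg_at_left_filter; exact: N'_cont.
- split.
  + by move=> s _; have [] := N_der s.
  + by apply: cvg_at_right_filter; exact: N_cont.
  + by apply: cvg_at_left_filter; exact: N_cont.
- apply: continuous_in_subspaceT => r; rewrite inE /= in_itv /= => /andP[ar _].
  by apply: ch; apply: lt_le_trans ar; rewrite Na.
Qed.

End graph1.

Lemma rtailZ {R : realType} k (c : R) (x : 'rV[R]_k.+1) : rtail (c *: x) = c *: rtail x.
Proof. by apply/rowP => i; rewrite !mxE. Qed.

Section graph.
Local Open Scope ereal_scope.
Context {R : realType} (k : nat) (H : 'rV[R]_k -> R).
Local Notation L := (@lebesgue_measure R).
Hypothesis k0 : (0 < k)%N.
Hypothesis cH : continuous H.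
Hypothesis H0 : forall v, (1 <= enorm v)%R -> H v = 0%R.

Let mH : measurable_fun setT H.
Proof. exact: continuous_measurable_rv. Qed.

Definition graph_fun (x : 'rV[R]_k.+1) : R := (`|rhead x| * H (rtail x))%R.

(* The integral over the sphere is, up to a constant, that of this 0-homogeneous extension over the ball. *)
Definition graph_ext (y : 'rV[R]_k.+1) : R :=
  (if (0 < enorm y)%R && (enorm y < 1)%R then graph_fun ((enorm y)^-1 *: y)%R else 0%R).

Let N (s : R) (v : 'rV[R]_k) := enorm (rcons0 (s, v)).

Lemma graph_ext_rcons0 s v : v != 0%R ->
  graph_ext (rcons0 (s, v)) = (`|s| / N s v * H ((N s v)^-1 *: v) * posr (1 - N s v))%R.
Proof.
move=> v0; have N0 : (0 < N s v)%R.
  by apply: lt_le_trans (enorm_tail_le s v); rewrite enorm_gt0.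
rewrite /graph_ext -/(N s v) N0 /= posrE subr_gt0.
case: ifPn => _; last by rewrite mulr0.
rewrite mulr1 /graph_fun; congr (_ * H _)%R.
  rewrite /rhead mxE rcons0_0 /= normrM ger0_norm ?invr_ge0 ?ltW// mulrC//.
by rewrite rtailZ rtail_rcons0.
Qed.

Hypothesis H_ge0 : forall v, (0 <= H v)%R.

Let mHr v : measurable_fun [set: R] (fun r : R => H (r^-1 *: v)).
Proof.
apply: (measurableT_comp mH); apply: measurable_rvZ => //.
exact: (@measurable_inv R).
Qed.

(** The substitution r = |(s, v)| gives an integral over |v| < r < 1. For 0 < r <= |v| the point v /
    r lies outside the open unit ball, where H vanishes, so the lower limit can be 0; the limits no
    longer depend on v, which allows the order of integration to be swapped. *)
Lemma ge0_integral_graph_inner v : v != 0%R ->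
  \int[L]_s (graph_ext (rcons0 (s, v)))%:E =
  2%:E * \int[L]_r (posr r * posr (1 - r) * H (r^-1 *: v))%:E.
Proof.
move=> v0; have a0 : (0 < enorm v)%R by rewrite enorm_gt0.
pose h (r : R) := H (r^-1 *: v).
have ch (r : R) : (0 < r)%R -> {for r, continuous h}.
  move=> r0; apply: (@continuous_comp _ _ _ (fun r : R => r^-1 *: v)%R H r); last exact: cH.
  apply: (@cvgZr_tmp _ _ _ _ _ (fun r : R => r^-1)%R r^-1%R v).
  by apply: cvgV; [rewrite gt_eqF|exact: cvg_id].
have h0 r : (0 < r)%R -> (r <= enorm v)%R -> H (r^-1 *: v)%R = 0%R.
  move=> r0 rv; apply: H0; rewrite enormZ ger0_norm ?invr_ge0 ?(ltW r0)//.
  by rewrite mulrC ler_pdivlMr// mul1r.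
under eq_integral do rewrite graph_ext_rcons0// /N enorm_rcons0.
have [a1|a1] := ltP (enorm v) 1%R; last first.
  rewrite !integral0_eq ?mule0// => s _.
    rewrite !posrE subr_gt0; case: (ltP 0%R s) => s0; last by rewrite !mul0r.
    by case: (ltP s 1%R) => s1; rewrite ?mulr0 ?mul0r// h0 ?mulr0//; apply: le_trans a1; exact: ltW.
  rewrite posrE subr_gt0 ltNge (_ : (1 <= _)%R = true) ?mulr0//.
  rewrite -sqrtr1 ler_sqrt ?addr_ge0 ?sqr_ge0//.
  by rewrite ler_wpDl ?sqr_ge0// exprn_ege1.
rewrite (ge0_integral_graph1 a0 ch (fun r => H_ge0 _) a1); congr (_ * _).
rewrite integral_itv_bndoo; last first.
  by apply: measurable_funTS; apply/measurable_EFinP; exact: mHr.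
rewrite integral_mkcond; apply: eq_integral => r _; rewrite patchE.
have -> : (r \in `]enorm v, 1%R[%classic) = (enorm v < r < 1)%R.
  by apply/idP/idP; rewrite inE /= in_itv.
rewrite !posrE subr_gt0; case: (ltP 0%R r) => r0 /=; last first.
  by rewrite !mul0r ltNge (le_trans r0 (ltW a0)).
case: (ltP r 1%R) => r1; rewrite ?andbT ?andbF ?mulr0 ?mul0r//.
by case: ltP => rv; rewrite ?mul1r// h0// mulr0.
Qed.

Lemma integral_power_unit (m : nat) :
  \int[L]_r (posr r * posr (1 - r) * r ^+ m)%:E = (m.+1%:R^-1)%:E.
Proof.
transitivity (\int[L]_(r in `[0%R, 1%R]) (r ^+ m)%:E).
  rewrite integral_itv_bndoo; last first.
    by apply: measurable_funTS; apply/measurable_EFinP; exact: exprn_measurable.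
  rewrite [RHS]integral_mkcond; apply: eq_integral => r _; rewrite patchE.
  have -> : (r \in `]0%R, 1%R[%classic) = (0 < r < 1)%R.
    by apply/idP/idP; rewrite inE /= in_itv.
  by rewrite !posrE subr_gt0; case: (ltP 0%R r); case: (ltP r 1%R) => _ _;
    rewrite ?mul1r ?mul0r ?mulr0 ?mul0r.
pose F (r : R) := (m.+1%:R^-1 * r ^+ m.+1)%R.
have Fd r : is_derive r (1%R : R) F (r ^+ m)%R.
  have := is_deriveZ (m.+1%:R^-1 : R) (is_derive1_exp m.+1 r).
  by move=> h; apply: (is_derive_eq h); rewrite /GRing.scale /= mulrA mulVf// mul1r.
have Fc : continuous F.
  move=> r; apply: (@differentiable_continuous _ _ _ r F).
  by apply/derivable1_diffP; have [] := Fd r.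
rewrite (@continuous_FTC2 _ _ F)//.
- by rewrite /F expr1n mulr1 expr0n mulr0 sube0.
- by apply: continuous_subspaceT; exact: exprn_continuous.
- split.
  + by move=> r _; have [] := Fd r.
  + by apply: cvg_at_right_filter; exact: Fc.
  + by apply: cvg_at_left_filter; exact: Fc.
- by move=> r _; rewrite derive1E; have [_ ->] := Fd r.
Qed.

Lemma measurable_graph_fun : measurable_fun setT graph_fun.
Proof.
apply: measurable_funM; last by apply: (measurableT_comp mH); exact: measurable_rtail.
by apply: (measurableT_comp (@normr_measurable R setT)); exact: measurable_rhead.
Qed.

Lemma graph_extE y : graph_ext y = ((graph_fun \o @nrm R k.+1) \_ (@pball R k.+1)) y.
Proof.
rewrite patchE /graph_ext.
by have -> : (y \in (@pball R k.+1)) = (0 < enorm y < 1)%R by apply/idP/idP; rewrite inE.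
Qed.

Lemma measurable_graph_ext : measurable_fun setT graph_ext.
Proof.
have -> : graph_ext = (graph_fun \o @nrm R k.+1) \_ (@pball R k.+1).
  by apply/funext => y; exact: graph_extE.
apply/(measurable_restrictT _ (@measurable_pball R k.+1)); apply: measurable_funTS.
by apply: (measurableT_comp measurable_graph_fun); exact: measurable_nrm.
Qed.

Lemma graph_ext_ge0 y : (0 <= graph_ext y)%R.
Proof. by rewrite /graph_ext; case: ifPn => // _; rewrite mulr_ge0. Qed.

(** After the swap, scaling v by r produces r^k times the integral of H, and the integral of r^k
    over (0, 1) is 1 / (k+1). This denominator later cancels the dimension factor in the definition
    of [sphInt]. *)
Lemma ge0_integral_graph_ext :
  \int[leb k.+1]_y (graph_ext y)%:E = (2 / k.+1%:R)%:E * \int[leb k]_v (H v)%:E.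
Proof.
have mge : measurable_fun setT (EFin \o graph_ext) by apply/measurable_EFinP; exact: measurable_graph_ext.
rewrite ge0_integral_lebS//; last by move=> y; rewrite lee_fin graph_ext_ge0.
have mgr : measurable_fun [set: measurableTypeR R * 'rV[R]_k] (fun p => (graph_ext (rcons0 p))%:E).
  by apply: (measurableT_comp mge); exact: measurable_rcons0.
have := tonelli_Rn mgr (fun p => graph_ext_ge0 _) => /= ->.
pose K (p : measurableTypeR R * 'rV[R]_k) := (posr p.1 * posr (1 - p.1) * H (p.1^-1 *: p.2))%R.
have K_ge0 p : (0 <= (K p)%:E) by rewrite lee_fin !mulr_ge0// posr_ge0.
have mp1 : measurable_fun [set: measurableTypeR R * 'rV[R]_k] (fun p => posr p.1).
  by apply: (measurableT_comp measurable_posr).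
have mp2 : measurable_fun [set: measurableTypeR R * 'rV[R]_k] (fun p => posr (1 - p.1)).
  by apply: (measurableT_comp measurable_posr); exact: measurable_funB.
have mK : measurable_fun [set: measurableTypeR R * 'rV[R]_k] (fun p => (K p)%:E).
  apply/measurable_EFinP; apply: measurable_funM; first exact: measurable_funM.
  apply: (measurableT_comp mH); apply: measurable_rvZ => //.
  by apply: (measurableT_comp (@measurable_inv R)).
transitivity (\int[leb k]_v (2%:E * \int[L]_r (K (r, v))%:E)).
  apply: integral_eq_off0 => //.
  - apply: (@measurable_fun_fubini_tonelli_G _ _ _ _ R lebesgue_measure _ mgr).
    by move=> p; rewrite lee_fin graph_ext_ge0.
  - apply: measurable_funeM.
    exact: (@measurable_fun_fubini_tonelli_G _ _ _ _ R lebesgue_measure _ mK).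
  - by move=> v v0; rewrite ge0_integral_graph_inner.
rewrite ge0_integralZlT//; last 2 first.
- exact: (@measurable_fun_fubini_tonelli_G _ _ _ _ R lebesgue_measure _ mK).
- by move=> v; apply: integral_ge0 => r _.
have := tonelli_Rn mK K_ge0 => /= <-.
have mHE : measurable_fun setT (EFin \o H) by exact/measurable_EFinP.
transitivity (2%:E * \int[L]_r ((posr r * posr (1 - r) * r ^+ k)%:E * \int[leb k]_v (H v)%:E)).
  congr (_ * _); apply: eq_integral => r _.
  have [r0|r0] := ltP 0%R r; last first.
    rewrite (posrE r) ltNge r0 !mul0r mul0e integral0_eq// => v _.
    by rewrite /K /= (posrE r) ltNge r0 !mul0r.
  under eq_integral do rewrite /K /= EFinM.
  rewrite ge0_integralZlT; [|by apply: (measurableT_comp mHE); apply: measurable_rvZ| |]; last 2 first.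
  - by move=> v; rewrite lee_fin.
  - by rewrite lee_fin mulr_ge0// posr_ge0.
  have ri0 : (0 < r^-1)%R by rewrite invr_gt0.
  by rewrite (integral_scaling ri0 mHE) muleA -EFinM exprVn invrK.
rewrite ge0_integralZrT//.
- by rewrite integral_power_unit muleA -EFinM.
- apply/measurable_EFinP; apply: measurable_funM; last exact: exprn_measurable.
  apply: measurable_funM; first exact: measurable_posr.
  by apply: (measurableT_comp measurable_posr); exact: measurable_funB.
- move=> r; rewrite lee_fin; have [r0|r0] := ltP 0%R r.
    by rewrite !mulr_ge0 ?posr_ge0// exprn_ge0// ltW.
  by rewrite (posrE r) ltNge r0 !mul0r.
- by apply: integral_ge0 => v _; rewrite lee_fin.
Qed.

End graph.

Section sphInt_graph.
Context {R : realType} (k : nat).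
Implicit Types (H : 'rV[R]_k -> R).

Lemma graph_ext_bdsupp H (M : R) : continuous H -> (forall v, 1 <= enorm v -> H v = 0) ->
  (forall v, `|H v| <= M) -> bdsupp (graph_ext H).
Proof.
move=> cH H0 HM; split; first exact: measurable_graph_ext.
have M0 : 0 <= M by apply: le_trans (HM 0).
exists (M + 1) => y; rewrite /graph_ext; case: ifPn => [/andP[y0 y1]|_]; last first.
  by rewrite normr0 eqxx addr_ge0.
split; last by move=> _; rewrite (le_trans (ltW y1))// lerDr.
rewrite /graph_fun normrM normr_id.
apply: (@le_trans _ _ (1 * M)); last by rewrite mul1r lerDl.
apply: ler_pM => //.
apply: le_trans (coord_le_enorm _ _) _.
by rewrite enorm_normalize// -enorm_gt0.
Qed.

Lemma bdsupp_unit_ball H (M : R) : continuous H -> (forall v, 1 <= enorm v -> H v = 0) ->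
  (forall v, `|H v| <= M) -> bdsupp H.
Proof.
move=> cH H0 HM; split; first exact: continuous_measurable_rv.
exists (Num.max M 1) => v; rewrite !le_max; split; first by rewrite HM.
move=> Hv; apply/orP; right; rewrite leNgt; apply/negP => /ltW /H0 h.
by rewrite h eqxx in Hv.
Qed.

(** Over the disc the surface element of the sphere is dv / |s|, which the factor |s| cancels; the 2
    counts the two hemispheres. *)
Lemma sphInt_graph (G : 'rV[R]_k.+1 -> R) H (M : R) : (0 < k)%N ->
  continuous H -> (forall v, 1 <= enorm v -> H v = 0) -> (forall v, `|H v| <= M) ->
  (forall s v, enorm (rcons0 (s, v)) = 1 -> G (rcons0 (s, v)) = `|s| * H v) ->
  sphInt G = 2 * \int[leb k]_v H v.
Proof.
move=> k0 cH H0 HM GH.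
rewrite (@sphInt_eq_on _ _ _ (graph_fun H)); last first.
  by move=> y y1; rewrite -(rcons0K y) GH ?rcons0K.
(* Positive and negative parts written through the absolute value, so that their continuity is
   immediate. *)
pose Hp v : R := (`|H v| + H v) / 2; pose Hn v : R := (`|H v| - H v) / 2.
have HE v : H v = Hp v - Hn v by rewrite /Hp /Hn; lra.
have cHp : continuous Hp.
  by apply: cont_mul; [apply: cont_add => //; exact: cont_norm|exact: cont_cst].
have cHn : continuous Hn.
  by apply: cont_mul; [apply: cont_sub => //; exact: cont_norm|exact: cont_cst].
have Hlr v : - H v <= `|H v| /\ H v <= `|H v| by split; [rewrite -normrN|]; exact: ler_norm.
have Hp_ge0 v : 0 <= Hp v by have [] := Hlr v; rewrite /Hp; lra.
have Hn_ge0 v : 0 <= Hn v by have [] := Hlr v; rewrite /Hn; lra.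
have Hp0 v : 1 <= enorm v -> Hp v = 0 by move=> /H0 h; rewrite /Hp h normr0 addr0 mul0r.
have Hn0 v : 1 <= enorm v -> Hn v = 0 by move=> /H0 h; rewrite /Hn h normr0 subr0 mul0r.
have HpM v : `|Hp v| <= M.
  by rewrite ger0_norm//; have [] := Hlr v; have := HM v; rewrite /Hp; lra.
have HnM v : `|Hn v| <= M.
  by rewrite ger0_norm//; have [] := Hlr v; have := HM v; rewrite /Hn; lra.
have main (F : 'rV[R]_k -> R) : continuous F -> (forall v, 0 <= F v) -> (forall v, 1 <= enorm v -> F v = 0) ->
    (forall v, `|F v| <= M) ->
    \int[leb k.+1]_y graph_ext F y = 2 / k.+1%:R * \int[leb k]_v F v.
  move=> cF F0 F1 FM; rewrite /Rintegral ge0_integral_graph_ext// fineM//.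
  exact: (integrable_fin_num measurableT (bdsupp_integrable (bdsupp_unit_ball cF F1 FM))).
rewrite /sphInt -/(graph_ext H) intRkE; last exact: graph_ext_bdsupp cH H0 HM.
have -> : \int[leb k.+1]_y graph_ext H y = 2 / k.+1%:R * \int[leb k]_v H v.
  transitivity (\int[leb k.+1]_y (graph_ext Hp y - graph_ext Hn y)).
    apply: eq_Rintegral => y _; rewrite /graph_ext; case: ifPn; rewrite ?subr0//.
    by rewrite /graph_fun HE mulrBr.
  rewrite RintegralB//; last 2 first.
  - exact: (bdsupp_integrable (graph_ext_bdsupp cHp Hp0 HpM)).
  - exact: (bdsupp_integrable (graph_ext_bdsupp cHn Hn0 HnM)).
  rewrite !main// -mulrBr -RintegralB//.
  - by congr (_ * _); apply: eq_Rintegral => v _; rewrite HE.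
  - exact: (bdsupp_integrable (bdsupp_unit_ball cHp Hp0 HpM)).
  - exact: (bdsupp_integrable (bdsupp_unit_ball cHn Hn0 HnM)).
by rewrite mulrA mulrCA mulfV// mulr1.
Qed.

End sphInt_graph.

Section continuous_rv.
Context {R : realType} {T : topologicalType}.

Lemma cont_rv k (g : T -> 'rV[R]_k) :
  (forall i, continuous (fun x => g x 0 i)) -> continuous g.
Proof.
move=> cg x; apply/cvgrPdist_le => e e0.
have : \forall y \near x, forall i, `|g x 0 i - g y 0 i| <= e.
  apply: filter_forall => i.
  by have /cvgrPdist_le /(_ _ e0) := cg i x.
apply: filterS => y h; apply: rv_norm_le; first exact: ltW.
by move=> i; rewrite !mxE; exact: h.
Qed.

Lemma cont_sum (I : Type) (r : seq I) (F : I -> T -> R) :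
  (forall i, continuous (F i)) -> continuous (fun x => \sum_(i <- r) F i x).
Proof.
move=> cF; elim: r => [|i r IH].
  by rewrite (_ : (fun x => _) = fun=> 0); [exact: cont_cst|apply/funext => x; rewrite big_nil].
rewrite (_ : (fun x => _) = fun x => F i x + \sum_(j <- r) F j x); first exact: cont_add.
by apply/funext => x; rewrite big_cons.
Qed.

Lemma cont_coord k (g : T -> 'rV[R]_k) i : continuous g -> continuous (fun x => g x 0 i).
Proof. move=> cg; apply: (@cont_comp _ _ _ g (fun v : 'rV[R]_k => v 0 i) cg).
exact: coord_continuous. Qed.

Lemma cont_mulmx k l (g : T -> 'rV[R]_k) (A : 'M[R]_(k, l)) : continuous g ->
  continuous (fun x => g x *m A).
Proof.
move=> cg; apply: cont_rv => i.
rewrite (_ : (fun x => _) = fun x => \sum_j g x 0 j * A j i); last first.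
  by apply/funext => x; rewrite mxE.
by apply: cont_sum => j; apply: cont_mul; [exact: cont_coord|exact: cont_cst].
Qed.

Lemma cont_rvD k (g h : T -> 'rV[R]_k) : continuous g -> continuous h ->
  continuous (fun x => g x + h x).
Proof. by move=> cg ch x; exact: (@cvgD _ _ _ (nbhs x) _ g h _ _ (cg x) (ch x)). Qed.

Lemma cont_rvZ k (a : T -> R) (g : T -> 'rV[R]_k) : continuous a -> continuous g ->
  continuous (fun x => a x *: g x).
Proof.
move=> ca cg; apply: cont_rv => i.
rewrite (_ : (fun x => _) = fun x => a x * g x 0 i); last by apply/funext => x; rewrite mxE.
by apply: cont_mul => //; exact: cont_coord.
Qed.

Lemma cont_dotv k (g h : T -> 'rV[R]_k) : continuous g -> continuous h ->
  continuous (fun x => dotv (g x) (h x)).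
Proof.
move=> cg ch; rewrite (_ : (fun x => _) = fun x => \sum_i g x 0 i * h x 0 i); last first.
  by apply/funext => x; rewrite dotvE.
by apply: cont_sum => j; apply: cont_mul; exact: cont_coord.
Qed.

Lemma cont_enorm k (g : T -> 'rV[R]_k) : continuous g -> continuous (fun x => enorm (g x)).
Proof. by move=> cg; apply: cont_sqrt; exact: cont_dotv. Qed.

Lemma cont_rcons0 k (a : T -> R) (g : T -> 'rV[R]_k) : continuous a -> continuous g ->
  continuous (fun x => rcons0 (a x, g x)).
Proof.
move=> ca cg; apply: cont_rv => i; case: (unliftP 0 i) => [j ->|->].
  rewrite (_ : (fun x => _) = fun x => g x 0 j); first exact: cont_coord.
  by apply/funext => x; rewrite rcons0_lift.
by rewrite (_ : (fun x => _) = a) //; apply/funext => x; rewrite rcons0_0.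
Qed.

End continuous_rv.

Lemma cont_id {T : topologicalType} : continuous (fun x : T => x).
Proof. by move=> x; exact: cvg_id. Qed.

Section sphInt_rotation.
Context {R : realType} (k : nat).

Lemma sphInt_rotation (F : 'rV[R]_k -> R) (M : R) (Q : 'M[R]_k) : (0 < k)%N ->
  Q *m Q^T = 1%:M -> measurable_fun setT F -> (forall y, usphere y -> `|F y| <= M) ->
  sphInt (fun y => F (y *m Q)) = sphInt F.
Proof.
move=> k0 QQ mF FM; rewrite (sphIntE k0 mF FM).
have mFQ : measurable_fun setT (fun y => F (y *m Q)).
  by apply: (measurableT_comp mF); exact: measurable_mulmx.
have FQM y : usphere y -> `|F (y *m Q)| <= M.
  by move=> y1; apply: FM; rewrite /usphere /= enorm_orth.
rewrite (sphIntE k0 mFQ FQM) /Rintegral; congr fine.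
rewrite -[RHS]mul1e.
apply: (integral_change_var (phi := fun y => y *m Q) ltr01 _ (f := EFin \o F)); last exact/measurable_EFinP.
by move=> g mg g0; rewrite mul1e; exact: sphm_rotation.
Qed.

End sphInt_rotation.

(** * From slices to the Radon transform *)

(** For orthogonal O this is the integral over the hyperplane of the points y with y.theta = t,
    where theta is row 0 of O and the other rows give orthonormal coordinates. Carrying the frame
    instead of theta avoids choosing one again for each theta. *)
Definition radon {R : realType} {m : nat} (O : 'M[R]_m.+1) (psi : 'rV[R]_m.+1 -> R) (t : R) : R :=
  \int[leb m]_v psi (rcons0 (t, v) *m O).

Lemma radon_bdsupp {R : realType} {m : nat} (O : 'M[R]_m.+1) (psi : 'rV[R]_m.+1 -> R)
    (t M rho : R) : O *m O^T = 1%:M -> measurable_fun setT psi ->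
  (forall y, `|psi y| <= M) -> (forall y, rho < enorm y -> psi y = 0) ->
  bdsupp (fun v : 'rV[R]_m => psi (rcons0 (t, v) *m O)).
Proof.
move=> OO mpsi psiM psi0; split.
  apply: (measurableT_comp mpsi); apply: measurable_mulmx.
  by apply: (measurableT_comp (@measurable_rcons0 R m)); exact: measurable_pair1.
exists (Num.max M rho) => v; rewrite !le_max psiM; split => // Fv; apply/orP; right.
rewrite leNgt; apply/negP => rv; move/negP: Fv; apply; apply/eqP/psi0.
by rewrite enorm_orth//; apply: lt_le_trans rv (enorm_tail_le _ _).
Qed.

Lemma bdsupp_scale {R : realType} {m : nat} (r : R) (F : 'rV[R]_m -> R) : 0 < r ->
  bdsupp F -> bdsupp (fun v => F (r *: v)).
Proof.
move=> r0 [mF [M FM]]; split.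
  by apply: (measurableT_comp mF); exact: measurable_rvZ.
exists (Num.max M (M / r)) => v; rewrite !le_max (FM _).1; split => //.
move=> /(FM _).2; rewrite enormZ gtr0_norm// => h.
by rewrite ler_pdivlMr// mulrC h orbT.
Qed.

Section slice_radon.
Context {R : realType} {m : nat}.
Local Notation n := m.+1.
Variables (f : 'rV[R]_(n + 1) -> R) (phi : 'rV[R]_n -> R) (M : R).
Hypothesis m0 : (0 < m)%N.
Hypothesis cphi : continuous phi.
Hypothesis phiM : forall y, `|phi y| <= M.
Hypothesis phi0 : forall y, 1 <= enorm y -> phi y = 0.
Hypothesis f_phi : forall x, on_sphere x -> f x = `|xlast x| * phi (xprime x).
Variables (theta : 'rV[R]_n) (O : 'M[R]_n).
Hypothesis OO : O *m O^T = 1%:M.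
Hypothesis theta1 : enorm theta = 1.
Hypothesis Otheta : rcons0 (1, 0) *m O = theta.

Let Theta : 'rV[R]_(n + 1) := row_mx theta 0.
Let Q := frameQ Theta.
Let U : 'M[R]_(n, n + 1) := usubmx Q.
Let e0 : 'rV[R]_n := rcons0 (1, 0).

Lemma dotv_row_mx a b (u u' : 'rV[R]_a) (v v' : 'rV[R]_b) :
  dotv (row_mx u v) (row_mx u' v') = dotv u u' + dotv v v'.
Proof. by rewrite /dotv tr_row_mx mul_row_col mxE. Qed.

Let Theta1 : enorm Theta = 1.
Proof. by rewrite /enorm dotv_row_mx dotv0l addr0 -/(enorm theta). Qed.

Let elast1 : enorm (elast R n) = 1.
Proof.
rewrite /enorm dotv_row_mx dotv0l add0r dotvE big_ord1 !mxE mulr1 sqrtr1//.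
Qed.

(** A Householder reflection shows that the set from which [frameQ] chooses is inhabited, so the
    choice has the defining properties instead of being the default identity. *)
Let QP : Q *m Q^T = 1%:M /\ elast R n *m Q = Theta.
Proof.
rewrite /Q /frameQ; case: (xgetP 1%:M [set Q : 'M[R]_(n + 1) | Q *m Q^T = 1%:M /\ elast R n *m Q = Theta]).
  by [].
move=> h; have [P hP] := exists_orthogonal elast1 Theta1.
by case: (h P).
Qed.

Let mulU w : row_mx w (0 : 'rV[R]_1) *m Q = w *m U.
Proof. by rewrite -[in LHS](vsubmxK Q) mul_row_col mul0mx addr0. Qed.

Let dQ : dsubmx Q = Theta.
Proof.
have [_ <-] := QP; rewrite -[in RHS](vsubmxK Q) /elast mul_row_col mul0mx add0r.
have -> : const_mx 1 = 1%:M :> 'M[R]_1 by apply/matrixP => i j; rewrite !mxE !ord1.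
by rewrite mul1mx.
Qed.

Let UU : U *m U^T = 1%:M /\ Theta *m U^T = 0.
Proof.
have [h _] := QP; move: h; rewrite -(vsubmxK Q) tr_col_mx mul_col_row -/U dQ.
rewrite scalar_mx_block => /eq_block_mx[h1 _ h3 _].
by split.
Qed.

Let UtU : U^T *m U + Theta^T *m Theta = 1%:M.
Proof.
have [h _] := QP; have := orthogonal_trmx h.
by rewrite -(vsubmxK Q) tr_col_mx mul_row_col -/U dQ.
Qed.

Let D : 'M[R]_n := 1%:M - e0^T *m e0.
(** A second orthonormal basis of the orthogonal complement of [Theta], adapted to graphs: its first
    row is the vertical vector e_(n+1), the others are the rows of O orthogonal to theta, placed in
    the horizontal hyperplane. [U] is the basis that [frameQ] happened to choose, and the orthogonal
    matrix [P] below passes from one to the other. *)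
Let W : 'M[R]_(n, n + 1) := row_mx (D *m O) e0^T.

Let e0e0 : e0 *m e0^T = 1%:M.
Proof. by rewrite [LHS]mx11_scalar -/(dotv e0 e0) dotv_rcons0 mulr1 dotv0l addr0. Qed.

Let D_e0 : D *m e0^T = 0.
Proof. by rewrite mulmxBl mul1mx -mulmxA e0e0 mulmx1 subrr. Qed.

Let mulW s v : rcons0 (s, v) *m W = row_mx (rcons0 (0, v) *m O) s%:M.
Proof.
rewrite mul_mx_row mulmxA; congr row_mx.
  congr (_ *m O); rewrite mulmxBr mulmx1 mulmxA.
  have -> : rcons0 (s, v) *m e0^T = s%:M.
    by rewrite [LHS]mx11_scalar -/(dotv _ e0) dotv_rcons0 mulr1 dotv0r addr0.
  rewrite mul_scalar_mx; apply/rowP => i; case: (unliftP 0 i) => [j ->|->].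
    by rewrite mxE [X in _ + X]mxE [X in _ - X]mxE !rcons0_lift mxE mulr0 subr0.
  by rewrite mxE [X in _ + X]mxE [X in _ - X]mxE !rcons0_0 mulr1 subrr.
by rewrite [LHS]mx11_scalar -/(dotv _ e0) dotv_rcons0 mulr1 dotv0r addr0.
Qed.

Let Dt : D^T = D.
Proof. by rewrite /D linearB /= trmx1 trmx_mul trmxK. Qed.

Let WW : W *m W^T = 1%:M.
Proof.
rewrite tr_row_mx mul_row_col trmxK trmx_mul mulmxA -(mulmxA D) OO mulmx1 Dt.
rewrite {2}/D mulmxBr mulmx1 mulmxA D_e0 mul0mx subr0.
by rewrite /D subrK.
Qed.

Let WTheta : W *m Theta^T = 0.
Proof.
rewrite tr_row_mx trmx0 mul_row_col mulmx0 addr0 -Otheta trmx_mul mulmxA.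
by rewrite -(mulmxA D) OO mulmx1 D_e0.
Qed.

Let P : 'M[R]_n := W *m U^T.

Let PU : P *m U = W.
Proof.
have h : U^T *m U = 1%:M - Theta^T *m Theta by rewrite -UtU addrK.
by rewrite -mulmxA h mulmxBr mulmx1 mulmxA WTheta mul0mx subr0.
Qed.

Let PP : P *m P^T = 1%:M.
Proof. by rewrite trmx_mul trmxK mulmxA PU WW. Qed.

Let enorm_section t w : `|t| <= 1 -> usphere w ->
  enorm (t *: Theta + Num.sqrt (1 - t ^+ 2) *: (w *m U)) = 1.
Proof.
move=> t1 w1; rewrite /enorm.
have r2 : Num.sqrt (1 - t ^+ 2) ^+ 2 = 1 - t ^+ 2.
  by rewrite sqr_sqrtr// subr_ge0 -real_normK ?num_real// expr_le1.
rewrite dotvDl !dotvDr !dotvZl !dotvZr -enorm2 Theta1.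
have -> : dotv Theta (w *m U) = 0.
  by rewrite dotvC /dotv -mulmxA; have [_ h] := UU; rewrite -[U *m _]trmxK trmx_mul trmxK h trmx0 mulmx0 mxE.
have -> : dotv (w *m U) Theta = 0.
  by rewrite /dotv -mulmxA; have [_ h] := UU; rewrite -[U *m _]trmxK trmx_mul trmxK h trmx0 mulmx0 mxE.
have -> : dotv (w *m U) (w *m U) = 1.
  rewrite /dotv trmx_mul mulmxA -(mulmxA w); have [-> _] := UU.
  by rewrite mulmx1 -/(dotv w w) -enorm2 w1 expr1n.
rewrite !mulr0 addr0 add0r mulr1 expr1n mulr1 -!expr2 r2 addrC subrK sqrtr1//.
Qed.

Let cont_xlast : continuous (fun x : 'rV[R]_(n + 1) => xlast x).
Proof.
rewrite (_ : (fun x => _) = fun x : 'rV[R]_(n + 1) => x 0 (rshift n 0)); first exact: coord_continuous.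
by apply/funext => x; rewrite /xlast mxE.
Qed.

Let cont_xprime : continuous (fun x : 'rV[R]_(n + 1) => xprime x).
Proof.
apply: cont_rv => i.
rewrite (_ : (fun x => _) = fun x : 'rV[R]_(n + 1) => x 0 (lshift 1 i)); first exact: coord_continuous.
by apply/funext => x; rewrite /xprime mxE.
Qed.

(** All powers of r = sqrt (1 - t^2) cancel: r^m from the surface measure of the slice, r from
    |x_(n+1)| = r |s|, r^(-m) from rescaling the disc, and r^(-1) from the weight. Rotation
    invariance of [sphInt] replaces the chosen frame by the adapted one. *)
Lemma Vweight_radon t : Vweight f theta t = 2 * radon O phi t.
Proof.
have e0v (s : R) (v : 'rV[R]_m) : enorm (rcons0 (s, v) *m O) ^+ 2 = s ^+ 2 + enorm v ^+ 2.
  by rewrite enorm_orth// enorm_rcons0 sqr_sqrtr// addr_ge0 ?sqr_ge0.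
have ge1 (v : 'rV[R]_n) : 1 <= enorm v ^+ 2 -> 1 <= enorm v.
  by rewrite expr_ge1 ?enorm_ge0.
rewrite /Vweight /vslice -/Theta -/Q.
(* For |t| >= 1 the truncated square root and its inverse are 0, so the weight vanishes; so does the
   Radon transform, as the hyperplane misses the open unit ball. *)
have [t1|t1] := leP 1 `|t|.
  have t2 : 1 <= t ^+ 2 by rewrite -real_normK ?num_real// expr_ge1.
  have -> : Num.sqrt (1 - t ^+ 2) = 0 by apply/eqP; rewrite sqrtr_eq0 subr_le0.
  rewrite invr0 mulr0 /radon (_ : \int[_]_v _ = 0) ?mulr0//.
  rewrite /Rintegral integral0_eq// => v _; rewrite phi0// ge1// e0v.
  by rewrite (le_trans t2)// lerDl sqr_ge0.
set r := Num.sqrt (1 - t ^+ 2).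
have r2p : 0 < 1 - t ^+ 2 by rewrite subr_gt0 -real_normK ?num_real// expr_lt1.
have r0 : 0 < r by rewrite sqrtr_gt0.
have r2 : r ^+ 2 = 1 - t ^+ 2 by rewrite sqr_sqrtr// ltW.
pose X w := t *: Theta + r *: (w *m U).
pose G w := `|xlast (X w)| * phi (xprime (X w)).
have cX : continuous X.
  by apply: cont_rvD; [exact: cst_continuous|apply: cont_rvZ; [exact: cont_cst|apply: cont_mulmx; exact: cont_id]].
have cG : continuous G.
  apply: cont_mul; first by apply: cont_norm; exact: (cont_comp cX cont_xlast).
  exact: (cont_comp (cont_comp cX cont_xprime) cphi).
have Xsph w : usphere w -> on_sphere (X w) by move=> w1; apply: enorm_section => //; exact: ltW.
have GM w : usphere w -> `|G w| <= M.
  move=> /Xsph X1; rewrite normrM normr_id -[leRHS]mul1r; apply: ler_pM => //.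
  have -> : xlast (X w) = X w 0 (rshift n 0) by rewrite /xlast mxE.
  by apply: le_trans (coord_le_enorm _ _) _; rewrite X1.
have -> : sphInt (fun w => f (t *: Theta + r *: (row_mx w (0 : 'rV[R]_1) *m Q))) = sphInt G.
  by apply: sphInt_eq_on => w /Xsph X1; rewrite mulU -/(X w) f_phi.
rewrite -(sphInt_rotation (ltn0Sn m) PP (continuous_measurable_rv cG) GM).
(* In the adapted frame the point of the slice with parameters (s, v) has height r s and horizontal
   part (t, r v) O, so the integrand has the graph form |s| H(v). *)
pose H (v : 'rV[R]_m) : R := r * phi (rcons0 (t, r *: v) *m O).
have cH : continuous H.
  apply: cont_mul; first exact: cont_cst.
  apply: (@cont_comp _ _ _ (fun v : 'rV[R]_m => rcons0 (t, r *: v) *m O) phi) => //.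
  apply: cont_mulmx; apply: cont_rcons0; first exact: cont_cst.
  by apply: cont_rvZ; [exact: cont_cst|exact: cont_id].
rewrite (@sphInt_graph _ _ _ H (r * M) m0 cH).
- have b1 : bdsupp (fun v : 'rV[R]_m => phi (rcons0 (t, v) *m O)).
    apply: (radon_bdsupp t OO (continuous_measurable_rv cphi) phiM (rho := 1)).
    by move=> y /ltW; exact: phi0.
  have i1 := bdsupp_integrable b1.
  have E : (\int[leb m]_v (phi (rcons0 (t, r *: v) *m O))%:E =
      ((r ^+ m)^-1)%:E * \int[leb m]_v (phi (rcons0 (t, v) *m O))%:E)%E.
    by apply: (integral_scaling r0 (f := fun v => (phi (rcons0 (t, v) *m O))%:E)); apply/measurable_EFinP; have [] := b1.
  have -> : \int[leb m]_v H v = r * ((r ^+ m)^-1 * radon O phi t).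
    rewrite /radon /Rintegral.
    have -> : (\int[leb m]_v (H v)%:E = r%:E * (((r ^+ m)^-1)%:E * \int[leb m]_v (phi (rcons0 (t, v) *m O))%:E))%E.
      rewrite -E -integralZl//.
      exact: (bdsupp_integrable (bdsupp_scale r0 b1)).
    rewrite fineM//= ?fineM//.
    - exact: (integrable_fin_num measurableT i1).
    - by rewrite fin_numM//; exact: (integrable_fin_num measurableT i1).
  by rewrite /=; field; rewrite expf_neq0 gt_eqF.
- move=> v v1; rewrite /H phi0 ?mulr0// ge1// e0v enormZ exprMn real_normK ?num_real// r2.
  have : 1 <= enorm v ^+ 2 by rewrite expr_ge1 ?enorm_ge0.
  nra.
- by move=> v; rewrite normrM (gtr0_norm r0) ler_pM2l.
- move=> s v sv1; have w1 : usphere (rcons0 (s, v)) by [].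
  have XE : X (rcons0 (s, v) *m P) = row_mx (rcons0 (t, r *: v) *m O) (r * s)%:M.
    rewrite /X -mulmxA PU mulW /Theta scale_row_mx scaler0 scale_row_mx add_row_mx add0r.
    congr row_mx; last by apply/matrixP => i j; rewrite !mxE mulrnAr.
    rewrite -Otheta !scalemxAl -mulmxDl; congr (_ *m O).
    apply/rowP => i; case: (unliftP 0 i) => [j ->|->].
      by rewrite mxE [X in X + _]mxE [X in _ + X]mxE !rcons0_lift !mxE mulr0 add0r.
    by rewrite mxE [X in X + _]mxE [X in _ + X]mxE !rcons0_0 mulr1 mulr0 addr0.
  rewrite /G XE /xlast /xprime row_mxKl row_mxKr mxE eqxx mulr1n.
  by rewrite normrM (gtr0_norm r0) /H; ring.
Qed.

End slice_radon.

Section differentiable_local.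
Context {R : numFieldType} {V W : normedModType R}.

Lemma near0_differentiable (h : V -> W) (x : V) :
  (\forall y \near x, h y = 0) -> differentiable h x.
Proof.
move=> h0.
have hx : h x = 0 by exact: (nbhs_singleton h0).
have key : h \o shift x = cst (h x) + \0 +o_ (0 : V) id.
  apply/eqaddoP => _/posnumP[e].
  have : \forall y \near (0 : V), h (y + x) = 0.
    by move: h0; rewrite (near_shift 0); apply: filterS => y /=; rewrite subr0.
  apply: filterS => y /= hy.
  rewrite (_ : (h \o shift x - (cst (h x) + \0)) y = 0) ?normr0 ?mulr_ge0//.
  by rewrite !fctE /= hy hx addr0 subrr.
have c0 : continuous (\0 : V -> W) by move=> y; exact: cvg_cst.
apply/diff_locallyP; have -> := @diff_unique _ _ _ h (\0 : {linear V -> W}) x c0 key.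
by split.
Qed.

Lemma near_eq_differentiable (f g : V -> W) (x : V) :
  (\forall y \near x, f y = g y) -> differentiable f x -> differentiable g x.
Proof.
move=> fg df.
have -> : g = f + (g - f) by rewrite addrC subrK.
apply: differentiableD => //; apply: near0_differentiable.
by apply: filterS fg => y fgy; rewrite !fctE fgy subrr.
Qed.

End differentiable_local.

Lemma derive_comp1 {R : realType} {V : normedModType R} (u : V -> R) (g : R -> R) (x v : V)
    (dg : R) : differentiable u x -> is_derive (u x) 1 g dg ->
  differentiable (g \o u) x /\ 'D_v (g \o u) x = dg * 'D_v u x.
Proof.
move=> du [dg1 <-].
have dg' : differentiable g (u x) by apply/derivable1_diffP.
have dgu : differentiable (g \o u) x by exact: differentiable_comp.
split => //; rewrite !deriveE// (diff_comp du dg') /=.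
by rewrite -[RHS]mulrC -[in LHS](mulr1 ('d u x v)) -/(GRing.scale _ _) linearZ.
Qed.

(** * Smooth functions *)

Section Ck.
Context {R : realType} {k : nat}.
Implicit Types (V : set 'rV[R]_k) (f g h : 'rV[R]_k -> R).

(* [smooth_on] quantifies over lists of directions; [Ck] allows induction on the order of differentiation. *)
Fixpoint Ck (n : nat) V h : Prop :=
  (forall x, V x -> differentiable h x) /\
  match n with 0 => True | n'.+1 => forall v, Ck n' V ('D_v h) end.

Lemma Ck_diff n V h x : Ck n V h -> V x -> differentiable h x.
Proof. by case: n => [|n] [H _]; exact: H. Qed.

Lemma smooth_onP V h : smooth_on V h <-> forall n, Ck n V h.
Proof.
split=> [sh n|H].
  elim: n h sh => [|n IH] h sh; split => //; try by move=> x Vx; exact: (sh [::]).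
  move=> v; apply: IH => vs x Vx; have := sh (rcons vs v) x Vx.
  by rewrite foldr_rcons.
(* The fold applies the last direction of the list first, whereas [Ck] differentiates from the
   inside; hence the induction from the end of the list. *)
move=> vs; elim/last_ind: vs h H => [|vs v IH] h H x Vx; first exact: (Ck_diff (H 0%N)).
by rewrite foldr_rcons; apply: IH => // n; have [_] := H n.+1; exact.
Qed.

Lemma CkS n V h : Ck n.+1 V h -> Ck n V h.
Proof.
elim: n h => [|n IH] h [H1 H2]; split => //.
by move=> v; apply: IH; exact: H2.
Qed.

Lemma Ck_near_eq n V f g : open V -> (forall x, V x -> f x = g x) ->
  Ck n V f -> Ck n V g.
Proof.
move=> oV; elim: n f g => [|n IH] f g fg [H1 H2].
  split => // x Vx; apply: near_eq_differentiable (H1 x Vx).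
  by move: (oV x Vx); apply: filterS.
have nfg x : V x -> \forall y \near x, f y = g y by move=> /oV; apply: filterS.
split; first by move=> x Vx; apply: near_eq_differentiable (H1 x Vx); exact: nfg.
move=> v; apply: IH (H2 v) => x Vx; apply: near_eq_derive; exact: nfg.
Qed.

Lemma Ck_union n V V' f : Ck n V f -> Ck n V' f -> Ck n (V `|` V') f.
Proof.
elim: n f => [|n IH] f [H1 H2] [H1' H2']; split=> //;
  try by move=> x [/H1|/H1'].
by move=> v; apply: IH; [exact: H2|exact: H2'].
Qed.

Lemma Ck_cst n V c : Ck n V (fun=> c).
Proof.
elim: n c => [|n IH] c; split => //; try by move=> x _; exact: differentiable_cst.
move=> v; have -> : 'D_v (fun _ : 'rV[R]_k => c) = fun=> 0.
  by apply/funext => x; exact: derive_cst.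
exact: IH.
Qed.

Lemma Ck_add n V f g : open V -> Ck n V f -> Ck n V g -> Ck n V (fun x => f x + g x).
Proof.
move=> oV; elim: n f g => [|n IH] f g [H1 H2] [H1' H2']; split => //;
  try by move=> x Vx; apply: differentiableD; [exact: H1|exact: H1'].
move=> v; apply: (@Ck_near_eq _ _ (fun x => 'D_v f x + 'D_v g x)) => //; last first.
  by apply: IH; [exact: H2|exact: H2'].
move=> x Vx; rewrite -[RHS]/('D_v (f + g) x) deriveD//; apply: diff_derivable.
  exact: H1.
exact: H1'.
Qed.

Lemma Ck_mul n V f g : open V -> Ck n V f -> Ck n V g -> Ck n V (fun x => f x * g x).
Proof.
move=> oV; elim: n f g => [|n IH] f g Hf Hg.
  by split => // x Vx; apply: differentiableM; [exact: (Ck_diff Hf)|exact: (Ck_diff Hg)].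
split; first by move=> x Vx; apply: differentiableM; [exact: (Ck_diff Hf)|exact: (Ck_diff Hg)].
move=> v; apply: (@Ck_near_eq _ _ (fun x => f x * 'D_v g x + g x * 'D_v f x)) => //; last first.
  apply: Ck_add => //; apply: IH; try exact: CkS.
    by case: Hg => _; exact.
  by case: Hf => _; exact.
move=> x Vx; rewrite -[RHS]/('D_v (f * g) x) deriveM//; apply: diff_derivable.
  exact: (Ck_diff Hf).
exact: (Ck_diff Hg).
Qed.

Lemma Ck_sum n V (I : Type) (r : seq I) (F : I -> 'rV[R]_k -> R) : open V ->
  (forall i, Ck n V (F i)) -> Ck n V (fun x => \sum_(i <- r) F i x).
Proof.
move=> oV H; elim: r => [|i r IH].
  rewrite (_ : (fun x => _) = fun=> 0); first exact: Ck_cst.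
  by apply/funext => x; rewrite big_nil.
rewrite (_ : (fun x => _) = fun x => F i x + \sum_(j <- r) F j x); first exact: Ck_add.
by apply/funext => x; rewrite big_cons.
Qed.

Lemma derive_coord (i : 'I_k) v x : 'D_v (fun y : 'rV[R]_k => y 0 i) x = v 0 i.
Proof.
have d := @differentiable_coord R 1 k x 0 i.
rewrite (deriveE _ d).
have @f : {linear 'rV[R]_k -> R}.
  by exists (fun N : 'rV[R]_k => N 0 i : R); do 2![eexists]; do ?[constructor];
     rewrite ?mxE// => ? *; rewrite ?mxE//; move=> ?; rewrite !mxE.
rewrite (_ : (fun _ => _) = f) //.
rewrite (@diff_lin _ _ _ f)//; exact: coord_continuous.
Qed.

Lemma Ck_coord n V (i : 'I_k) : Ck n V (fun x => x 0 i).
Proof.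
case: n => [|n]; split => //; try by move=> x _; exact: differentiable_coord.
move=> v; rewrite (_ : 'D_v _ = fun=> v 0 i); first exact: Ck_cst.
by apply/funext => x; exact: derive_coord.
Qed.

(** The derivative of u^(-1/2) is a cube of u^(-1/2) times a derivative of u, so the induction on
    the order closes on products without any other root. *)
Lemma Ck_invsqrt n V u : open V -> (forall x, V x -> 0 < u x) -> (forall m, Ck m V u) ->
  Ck n V (fun x => (Num.sqrt (u x))^-1).
Proof.
move=> oV u0 Hu.
pose psi (t : R) := (Num.sqrt t)^-1.
have dpsi (t : R) : 0 < t -> is_derive t 1 psi (- 2^-1 * ((Num.sqrt t)^-1 * ((Num.sqrt t)^-1 * (Num.sqrt t)^-1))).
  move=> t0; have st : Num.sqrt t != 0 by rewrite gt_eqF// sqrtr_gt0.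
  have h := @is_deriveV R Num.sqrt t _ 1 st (@is_derive1_sqrt R _ t0).
  apply: (is_derive_eq h); rewrite /GRing.scale /=; field; exact: st.
have dif x : V x -> differentiable (fun x => (Num.sqrt (u x))^-1) x.
  by move=> Vx; have [] := derive_comp1 0 (Ck_diff (Hu 0%N) Vx) (dpsi _ (u0 _ Vx)).
elim: n => [|n IH]; split => //.
move=> v; apply: (@Ck_near_eq _ _ (fun x =>
   (- 2^-1 * ((Num.sqrt (u x))^-1 * ((Num.sqrt (u x))^-1 * (Num.sqrt (u x))^-1))) * 'D_v u x)) => //.
  by move=> x Vx; have [_ <-] := derive_comp1 v (Ck_diff (Hu 0%N) Vx) (dpsi _ (u0 _ Vx)).
apply: Ck_mul => //; last by have [_] := Hu n.+1; exact.
apply: Ck_mul => //; first exact: Ck_cst.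
by apply: Ck_mul => //; exact: Ck_mul.
Qed.

End Ck.

Section Ck_comp.
Context {R : realType} {k l : nat}.
Variables (V : set 'rV[R]_k) (U : set 'rV[R]_l) (sigma : 'rV[R]_k -> 'rV[R]_l).
Hypothesis oV : open V.
Hypothesis VU : forall x, V x -> U (sigma x).
Hypothesis Csigma : forall i n, Ck n V (fun x => sigma x 0 i).

Let sigmaE x : sigma x = \sum_(i < l) sigma x 0 i *: delta_mx 0 i.
Proof. exact: row_sum_delta. Qed.

Lemma diff_rv_coords x v : V x ->
  differentiable sigma x /\ 'd sigma x v = \sum_(i < l) ('D_v (fun x => sigma x 0 i) x) *: delta_mx 0 i.
Proof.
move=> Vx.
have di i : differentiable (fun x => sigma x 0 i) x by exact: (Ck_diff (Csigma i 0%N)).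
have dz i : differentiable (fun x => sigma x 0 i *: (delta_mx 0 i : 'rV[R]_l)) x.
  exact: differentiableZl.
have sE : sigma = \sum_(i < l) (fun x => sigma x 0 i *: (delta_mx 0 i : 'rV[R]_l)).
  by apply/funext => y; rewrite {1}sigmaE fct_sumE.
have ds : differentiable sigma x by rewrite sE; exact: differentiable_sum.
split=> //; rewrite -deriveE// {1}sE derive_sum; last by move=> i; apply: diff_derivable; exact: dz.
apply: eq_bigr => i _; rewrite (deriveE v (dz i)) diffZl//.
by rewrite -(deriveE v (di i)).
Qed.

Lemma Ck_comp n g : smooth_on U g -> Ck n V (g \o sigma).
Proof.
elim: n g => [|n IH] g sg.
  split => // x Vx; apply: differentiable_comp; first exact: (diff_rv_coords 0 Vx).1.
  exact: (sg [::] _ (VU Vx)).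
have dif x : V x -> differentiable (g \o sigma) x.
  move=> Vx; apply: differentiable_comp; first exact: (diff_rv_coords 0 Vx).1.
  exact: (sg [::] _ (VU Vx)).
split => // v.
apply: (@Ck_near_eq _ _ _ _ (fun x => \sum_(i < l) 'D_v (fun x => sigma x 0 i) x * (('D_(delta_mx 0 i) g) \o sigma) x)) => //.
  move=> x Vx; have [ds dsE] := diff_rv_coords v Vx.
  have dg : differentiable g (sigma x) by exact: (sg [::] _ (VU Vx)).
  rewrite [RHS]deriveE; last exact: dif.
  rewrite (diff_comp ds dg) /= dsE linear_sum; apply: eq_bigr => i _.
  by rewrite linearZ /= -deriveE.
apply: Ck_sum => // i; apply: Ck_mul => //.
  by have [_] := Csigma i n.+1; exact.
apply: IH => vs x Ux; have := sg (rcons vs (delta_mx 0 i)) x Ux.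
by rewrite foldr_rcons.
Qed.

End Ck_comp.

Section smooth_compact.
Context {R : realType} {k : nat}.
Implicit Types psi : 'rV[R]_k -> R.

Definition Cc (rho : R) psi := smooth_on setT psi /\ forall y, rho < enorm y -> psi y = 0.

Lemma Cc_diff rho psi x : Cc rho psi -> differentiable psi x.
Proof. by move=> [s _]; exact: (s [::]). Qed.

Lemma Cc_cont rho psi : Cc rho psi -> continuous psi.
Proof. by move=> h x; apply: (@differentiable_continuous _ _ _ x psi); exact: Cc_diff h. Qed.

Lemma Cc_derive rho psi v : Cc rho psi -> Cc rho ('D_v psi).
Proof.
move=> [s z]; split.
  by move=> vs x _; have := s (rcons vs v) x I; rewrite foldr_rcons.
move=> y ry.
have oy : \forall z \near y, (cst 0 : 'rV[R]_k -> R) z = psi z.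
  have cn := @cont_enorm R _ k _ (@cont_id 'rV[R]_k).
  have : \forall z \near y, rho < enorm z by exact: (cvgr_gt (enorm y) (cn y) rho ry).
  by apply: filterS => x /z ->.
by rewrite -(near_eq_derive v oy) derive_cst.
Qed.

Lemma Cc_sum (I : Type) (r : seq I) (F : I -> 'rV[R]_k -> R) rho :
  (forall i, Cc rho (F i)) -> Cc rho (fun x => \sum_(i <- r) F i x).
Proof.
move=> H; split; last by move=> y ry; rewrite big1// => i _; have [_] := H i; exact.
apply/smooth_onP => n; apply: Ck_sum; first exact: openT.
by move=> i; have [/smooth_onP + _] := H i; exact.
Qed.

Lemma Cc_laplacian rho psi : Cc rho psi -> Cc rho (laplacian psi).
Proof.
move=> H; apply: (Cc_sum (index_enum _)) => i.
by apply: Cc_derive; exact: Cc_derive.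
Qed.

Lemma Cc_iter_laplacian rho psi j : Cc rho psi -> Cc rho (iter j (@laplacian R k) psi).
Proof. by move=> H; elim: j => // j IH; exact: Cc_laplacian. Qed.

Lemma Cc_bounded rho psi : Cc rho psi -> exists M, forall y, `|psi y| <= M.
Proof.
move=> H; have cpsi := Cc_cont H.
have cA : compact [set y : 'rV[R]_k | enorm y <= rho].
  apply: bounded_closed_compact.
    exists rho; split; first exact: num_real.
    move=> z rz y /= yr; apply: le_trans (ltW rz); apply: le_trans yr; exact: norm_le_enorm.
  rewrite (_ : [set y : 'rV[R]_k | enorm y <= rho] = (@enorm R k) @^-1` [set x | x <= rho]) //.
  apply: closed_comp; last exact: closed_le.
  by move=> x _; exact: (@cont_enorm R _ k _ (@cont_id 'rV[R]_k)).
(* The extreme value theorem needs a nonempty set; if the closed ball is empty then psi vanishes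
   identically. *)
have [[y0 Ay0]|nA] := pselect ([set y : 'rV[R]_k | enorm y <= rho] !=set0); last first.
  exists 0 => y; rewrite (proj2 H) ?normr0// ltNge; apply/negP => h; apply: nA; by exists y.
have cn : {within [set y : 'rV[R]_k | enorm y <= rho], continuous (fun y => `|psi y|)}.
  by apply: continuous_subspaceT; exact: cont_norm.
have [c _ hc] := @EVT_max_rV R k (fun y => `|psi y|) _ (ex_intro _ y0 Ay0) cA cn.
exists `|psi c| => y; have [yr|yr] := leP (enorm y) rho; last by rewrite (proj2 H)// normr0.
by apply: hc; rewrite inE.
Qed.

End smooth_compact.

(** * The density of f over the equatorial disc *)

Section slice_density.
Context {R : realType} {n : nat}.
Implicit Types (f g : 'rV[R]_(n + 1) -> R) (y : 'rV[R]_n).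

Lemma open_enorm_lt r : open [set y : 'rV[R]_n | enorm y < r].
Proof.
rewrite (_ : [set _ | _] = (@enorm R n) @^-1` [set x | x < r]) //.
apply: open_comp; last exact: open_lt.
by move=> x _; exact: (@cont_enorm R _ n _ (@cont_id 'rV[R]_n)).
Qed.

Lemma open_enorm_gt r : open [set y : 'rV[R]_n | r < enorm y].
Proof.
rewrite (_ : [set _ | _] = (@enorm R n) @^-1` [set x | r < x]) //.
apply: open_comp; last exact: open_gt.
by move=> x _; exact: (@cont_enorm R _ n _ (@cont_id 'rV[R]_n)).
Qed.

Definition height y : R := Num.sqrt (1 - dotv y y).
Definition lift_sphere y : 'rV[R]_(n + 1) := row_mx y (const_mx (height y)).

Lemma Ck_height2 m V : open V -> Ck m V (fun y => 1 - dotv y y).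
Proof.
move=> oV.
apply: (@Ck_near_eq _ _ _ _ (fun y => 1 + -1 * \sum_i (y 0 i * y 0 i))) => //.
  by move=> y _; rewrite dotvE mulN1r.
apply: Ck_add => //; first exact: Ck_cst.
apply: Ck_mul => //; first exact: Ck_cst.
by apply: Ck_sum => // i; apply: Ck_mul => //; exact: Ck_coord.
Qed.

Lemma height2_gt0 y : enorm y < 1 -> 0 < 1 - dotv y y.
Proof.
by move=> y1; rewrite -enorm2 subr_gt0 expr_lt1// enorm_ge0.
Qed.

Lemma lift_sphere_on y : enorm y < 1 -> on_sphere (lift_sphere y).
Proof.
move=> y1; rewrite /on_sphere /enorm dotv_row_mx.
have -> : dotv (const_mx (height y) : 'rV[R]_1) (const_mx (height y)) = height y ^+ 2.
  by rewrite dotvE big_ord1 !mxE.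
by rewrite sqr_sqrtr ?ltW ?height2_gt0// addrC subrK sqrtr1.
Qed.

Lemma Ck_lift_sphere m i : Ck m [set y | enorm y < 1] (fun y => lift_sphere y 0 i).
Proof.
have [j ->|j ->] := split_ordP i.
  rewrite (_ : (fun y => _) = fun y => y 0 j); first exact: Ck_coord.
  by apply/funext => y; rewrite row_mxEl.
have oV := @open_enorm_lt 1.
(* Writing the square root as u times u^(-1/2) reduces its smoothness to [Ck_invsqrt]. *)
apply: (@Ck_near_eq _ _ _ _ (fun y => (1 - dotv y y) * (Num.sqrt (1 - dotv y y))^-1)) => //.
  move=> y /height2_gt0 h; rewrite row_mxEr mxE /height.
  by rewrite -{1}(sqr_sqrtr (ltW h)) expr2 mulfK// gt_eqF// sqrtr_gt0.
apply: Ck_mul => //; first exact: Ck_height2.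
apply: Ck_invsqrt => //; first by move=> y; exact: height2_gt0.
by move=> ?; exact: Ck_height2.
Qed.

(** Dividing f on the upper hemisphere by the height is harmless because f vanishes near the
    equator, where the height degenerates; evenness then transfers the formula to the lower
    hemisphere. *)
Lemma sphere_density f : Ctilde_e f -> exists (rho : R) (phi : 'rV[R]_n -> R),
  [/\ 0 <= rho, rho < 1, Cc rho phi &
      forall x, on_sphere x -> f x = `|xlast x| * phi (xprime x)].
Proof.
move=> [[U [g [oU [SU [sg fg]]]]] [feven [e [e0 fe]]]].
(* The width of the equatorial band is shrunk below 1 so that 1 - e1^2 stays positive; |y| > rho
   means that the height is below e1. *)
pose e1 := Num.min e 2^-1.
have e1e : e1 <= e by rewrite ge_min lexx.
have e1h : e1 <= 2^-1 by rewrite ge_min lexx orbT.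
have e10 : 0 < e1 by rewrite lt_min e0 invr_gt0 ltr0n.
pose rho := Num.sqrt (1 - e1 ^+ 2).
have rho2 : 0 < 1 - e1 ^+ 2 by nra.
have rho1 : rho < 1.
  by rewrite -[ltRHS]sqrtr1 ltr_sqrt// ltrBlDr ltrDl exprn_gt0.
pose phi y : R := if enorm y < 1 then f (lift_sphere y) * (height y)^-1 else 0.
have phi0 y : rho < enorm y -> phi y = 0.
  move=> ry; rewrite /phi; case: ifPn => // y1; rewrite fe ?mul0r//.
    exact: lift_sphere_on.
  rewrite /xlast /lift_sphere row_mxKr mxE ger0_norm ?sqrtr_ge0//.
  apply: lt_le_trans e1e; rewrite -(gtr0_norm e10) -sqrtr_sqr ltr_sqrt ?exprn_gt0//.
  have : rho ^+ 2 < enorm y ^+ 2 by rewrite ltrXn2r// ?nnegrE ?sqrtr_ge0// enorm_ge0.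
  by rewrite sqr_sqrtr ?ltW// enorm2; lra.
have vl (x : 'rV[R]_(n + 1)) : x = row_mx (xprime x) (const_mx (xlast x)).
  rewrite -[LHS]hsubmxK; congr row_mx; apply/rowP => i; rewrite !mxE /xlast ord1.
  by rewrite mxE.
exists rho, phi; split => //; first exact: sqrtr_ge0.
  split => //; apply: (smooth_onP _ _).2 => m.
  (* As rho < 1, two overlapping open sets cover R^n: on one phi is given by a smooth formula, on
     the other it is 0. *)
  have VE : [set: 'rV[R]_n] = [set y | enorm y < 1] `|` [set y | rho < enorm y].
    apply/seteqP; split => // y _ /=; have [h|h] := ltP (enorm y) 1; first by left.
    by right; exact: lt_le_trans rho1 h.
  rewrite VE; apply: Ck_union; last first.
    apply: (@Ck_near_eq _ _ _ _ (fun=> 0)); first exact: open_enorm_gt.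
      by move=> x /phi0 ->.
    exact: Ck_cst.
  apply: (@Ck_near_eq _ _ _ _ (fun y => (g \o lift_sphere) y * (Num.sqrt (1 - dotv y y))^-1)).
  - exact: open_enorm_lt.
  - by move=> y /= y1; rewrite /phi y1 fg//; exact: lift_sphere_on.
  apply: Ck_mul; first exact: open_enorm_lt.
    apply: (@Ck_comp _ _ _ _ U) => //; first exact: open_enorm_lt.
      by move=> y y1; apply: SU; exact: lift_sphere_on.
    by move=> i q; exact: Ck_lift_sphere.
  apply: Ck_invsqrt; first exact: open_enorm_lt.
    by move=> y; exact: height2_gt0.
  by move=> q; apply: Ck_height2; exact: open_enorm_lt.
move=> x Sx.
have [x0|x0] := eqVneq (xlast x) 0.
  by rewrite fe ?x0 ?normr0 ?mul0r.
have xE : dotv (xprime x) (xprime x) + xlast x ^+ 2 = 1.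
  have := enorm2 x; rewrite Sx expr1n (vl x) dotv_row_mx => ->.
  rewrite /xprime /xlast row_mxKl row_mxKr; congr +%R.
  by rewrite dotvE big_ord1 !mxE.
have x2 : 0 < xlast x ^+ 2 by rewrite exprn_even_gt0.
have x1 : enorm (xprime x) < 1.
  by rewrite -(@expr_lt1 _ 2)// ?enorm_ge0// enorm2; lra.
have hx : height (xprime x) = `|xlast x|.
  by rewrite /height (_ : 1 - _ = xlast x ^+ 2) ?sqrtr_sqr//; lra.
rewrite /phi x1 hx mulrC divfK ?normr_eq0// /lift_sphere hx.
have [h|h] := ger0P (xlast x); first by rewrite -vl.
by rewrite feven.
Qed.

End slice_density.

Section directional.
Context {R : realType} {k : nat}.
Implicit Types (psi : 'rV[R]_k -> R) (y w : 'rV[R]_k).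

Lemma line_quotient psi y w (a : R) :
  (fun h : R => h^-1 *: (((fun t : R => psi (y + t *: w)) \o shift a) (h *: 1) - psi (y + a *: w)))
  = (fun h : R => h^-1 *: ((psi \o shift (y + a *: w)) (h *: w) - psi (y + a *: w))).
Proof.
apply/funext => h /=; congr (_ *: (psi _ - _)).
have -> : h *: (1 : R) = h by rewrite /GRing.scale /= mulr1.
by rewrite scalerDl addrCA.
Qed.

Lemma derivable_line psi y w (a : R) : derivable psi (y + a *: w) w ->
  is_derive a 1 (fun t : R => psi (y + t *: w)) ('D_w psi (y + a *: w)).
Proof.
move=> d.
by split; rewrite /derivable /derive line_quotient.
Qed.

Lemma derive_line psi y w : 'D_w psi y = ((fun t : R => psi (y + t *: w))^`())%classic 0.
Proof.
have h := line_quotient psi y w 0.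
rewrite derive1E /derive h (_ : y + 0 *: w = y)//.
by rewrite scale0r addr0.
Qed.

End directional.

(** * Differentiation under the integral *)

Section locally_integrable.
Context {R : realType} {m : nat}.
Implicit Types (K h : 'rV[R]_m -> R).

(** The only condition under which singular kernels enter: it makes their pairing with bounded
    measurable functions of bounded support integrable. *)
Definition locint K := measurable_fun setT K /\
  forall r, (leb m).-integrable (@eball R m r) (EFin \o K).

Lemma locint_mul K h (M r : R) : locint K -> measurable_fun setT h ->
  (forall v, `|h v| <= M) -> (forall v, r <= enorm v -> h v = 0) ->
  (leb m).-integrable setT (EFin \o (fun v => h v * K v)).
Proof.
move=> [mK iK] mh hM h0.
have mB := @measurable_eball R m r.
have iKr := (integrable_mkcond _ mB).1 (iK r).
have iM := @integrableZl _ _ _ (leb m) _ measurableT M _ iKr.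
apply: le_integrable iM => //.
  by apply/measurable_EFinP; exact: measurable_funM.
move=> v _ /=; rewrite patchE; case: ifPn => [|/negP vr].
  rewrite lee_fin !normrM => _; apply: ler_wpM2r => //.
  by apply: le_trans (hM v) _; exact: ler_norm.
rewrite h0 ?mul0r ?normr0 ?mule0//; first by rewrite abse0.
by rewrite leNgt; apply/negP => hr; apply: vr; rewrite inE.
Qed.

Lemma le_locint K h : locint K -> measurable_fun setT h ->
  (forall v, `|h v| <= K v) -> locint h.
Proof.
move=> [mK iK] mh hK; split => // r.
apply: le_integrable (iK r) => //; first exact: measurable_eball.
  by apply/measurable_EFinP; exact: measurable_funTS.
by move=> v _ /=; rewrite lee_fin; apply: le_trans (hK v) (ler_norm _).
Qed.

Lemma locintD K h : locint K -> locint h -> locint (fun v => K v + h v).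
Proof.
move=> [mK iK] [mh ih]; split; first exact: measurable_funD.
move=> r; have := integrableD (@measurable_eball R m r) (iK r) (ih r).
by apply: eq_integrable => //; exact: measurable_eball.
Qed.

Lemma locintZ c K : locint K -> locint (fun v => c * K v).
Proof.
move=> [mK iK]; split; first exact: measurable_funM.
move=> r; have := integrableZl (@measurable_eball R m r) c (iK r).
by apply: eq_integrable => //; exact: measurable_eball.
Qed.

Lemma locint_bounded h : measurable_fun setT h ->
  (forall r, exists M, forall v, enorm v < r -> `|h v| <= M) -> locint h.
Proof.
move=> mh hM; split => // r; have [M HM] := hM r.
apply: (@le_integrable _ _ _ _ _ (@measurable_eball R m r) _ (cst M%:E)).
- by apply/measurable_EFinP; exact: measurable_funTS.
- by move=> v vr /=; rewrite lee_fin; apply: le_trans (HM v vr) (ler_norm _).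
- apply/integrableP; split => //; rewrite integral_cst; last exact: measurable_eball.
  by rewrite lte_mul_pinfty ?lee_fin// ?leb_eball_lty.
Qed.

Lemma locint_cst c : locint (fun=> c).
Proof. by apply: locint_bounded => // r; exists `|c|. Qed.

End locally_integrable.

Section derivative_under_integral.
Context {R : realType} {m k : nat}.
Variables (A : 'rV[R]_m -> 'rV[R]_k) (C : R) (w : 'rV[R]_k) (K : 'rV[R]_m -> R).
Variables (rho : R) (psi : 'rV[R]_k -> R).
Hypothesis mA : measurable_fun [set: 'rV[R]_m] A.
Hypothesis AC : forall v, enorm v <= enorm (A v) + C.
Hypothesis iK : locint K.
Hypothesis psiC : Cc rho psi.

Let radius (t : R) := rho + t * enorm w + C + 1.

Lemma integrable_shift_mul (chi : 'rV[R]_k -> R) (t : R) : Cc rho chi ->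
  (leb m).-integrable setT (EFin \o (fun v => chi (A v + t *: w) * K v)).
Proof.
move=> chiC; have [M HM] : exists M : R, forall y, `|chi y| <= M := Cc_bounded chiC.
apply: (@locint_mul _ _ _ _ M (radius `|t|)) => //.
  have mc := continuous_measurable_rv (Cc_cont chiC).
  apply: (measurableT_comp mc); exact: measurable_rvD.
move=> v hv; apply: (proj2 chiC).
have h1 := AC v; have h2 := enormD (A v + t *: w) (- (t *: w)).
move: hv h1 h2; rewrite addrK enormN enormZ /radius; lra.
Qed.

(** The map A is kept general to cover translations of R^k as well as parametrised hyperplanes. By
    [AC], a point v where psi (A v + t w) is nonzero satisfies |v| <= rho + |t| |w| + C; so for t
    within 1 of a all integrands live in one ball, and a multiple of |K| on that ball dominates the
    derivatives. *)
Lemma is_derive_under_integral (a : R) :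
  is_derive a 1 (fun t : R => \int[leb m]_v (psi (A v + t *: w) * K v))
    (\int[leb m]_v ('D_w psi (A v + a *: w) * K v)).
Proof.
pose F (t : R) v := psi (A v + t *: w) * K v.
have dpsi := Cc_derive w psiC.
have [M HM] : exists M : R, forall y, `|'D_w psi y| <= M := Cc_bounded dpsi.
have dF (t : R) v : is_derive t 1 (F ^~ v) ('D_w psi (A v + t *: w) * K v).
  have d : derivable psi (A v + t *: w) w by apply: diff_derivable; exact: Cc_diff psiC.
  have h := @is_deriveM R R (fun t : R => psi (A v + t *: w)) (cst (K v)) t 1 _ _
    (derivable_line d) (is_derive_cst _ _ _).
  by apply: (is_derive_eq h); rewrite scaler0 add0r /GRing.scale /= mulrC.
have dFE t v : partial1of2 F t v = 'D_w psi (A v + t *: w) * K v.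
  by rewrite partial1of2E; exact: (@derive_val _ _ _ _ _ _ _ (dF t v)).
have Ia : `]a - 1, a + 1[%classic a by rewrite /= in_itv /=; apply/andP; split; lra.
pose r := radius (`|a| + 1).
pose G v := `|M| * (`|K v| * posr (r - enorm v)).
have G0 v : 0 <= G v by rewrite /G !mulr_ge0// posr_ge0.
have mposr' : measurable_fun setT (fun v : 'rV[R]_m => posr (r - enorm v)).
  apply: (measurableT_comp (@measurable_posr R)).
  by apply: measurable_funB => //; exact: measurable_enorm.
have iG : (leb m).-integrable setT (EFin \o G).
  have iK' : locint (fun v => `|M| * `|K v|).
    apply: locintZ; split; first by apply: measurableT_comp => //; case: iK.
    by move=> s; exact: (integrable_norm ((proj2 iK) s)).
  have := @locint_mul _ _ _ (fun v => posr (r - enorm v)) 1 r iK' mposr'.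
  have p1 v : `|posr (r - enorm v)| <= 1 by rewrite posrE; case: ltP => //= _; rewrite ?normr1 ?normr0.
  have p2 v : r <= enorm v -> posr (r - enorm v) = 0.
    by move=> h; rewrite posrE subr_gt0 ltNge h.
  move=> /(_ (p1 m) (p2 m)); apply: eq_integrable => // v _ /=.
  by rewrite /G mulrA mulrC.
have GF t v : `]a - 1, a + 1[%classic t -> setT v -> `|partial1of2 F t v| <= G v.
  rewrite /= in_itv/= => /andP[t1 t2] _; rewrite dFE.
  have ta : `|t| <= `|a| + 1.
    have := ler_norm a; have := ler_norm (- a); rewrite normrN => ??.
    by rewrite ler_norml; apply/andP; split; lra.
  rewrite normrM /G posrE; case: ltP => hr; last first.
    rewrite (proj2 dpsi) ?normr0 ?mul0r ?mulr0//.
    have h1 := AC v; have h2 := enormD (A v + t *: w) (- (t *: w)).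
    have h3 : `|t| * enorm w <= (`|a| + 1) * enorm w by apply: ler_wpM2r => //; exact: enorm_ge0.
    move: hr h1 h2; rewrite addrK enormN enormZ /r /radius; lra.
  rewrite mulr1; apply: ler_wpM2r => //.
  by apply: le_trans (HM _) (ler_norm _).
have iF t : `]a - 1, a + 1[%classic t -> (leb m).-integrable setT (EFin \o F t).
  by move=> _; exact: integrable_shift_mul.
have derF t v : `]a - 1, a + 1[%classic t -> setT v -> derivable (F ^~ v) t 1.
  by move=> _ _; exact: (@ex_derive _ _ _ _ _ _ _ (dF t v)).
have cv := @cvg_differentiation_under_integral R _ _ (leb m) F setT measurableT a _ _ Ia iF derF G G0 iG GF.
have e : (\int[leb m]_v partial1of2 F a v) = \int[leb m]_v ('D_w psi (A v + a *: w) * K v).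
  by congr Rintegral; apply/funext => v; exact: dFE.
rewrite /= e in cv.
have cv' : h^-1 *: (((fun t : R => \int[leb m]_v F t v) \o shift a) (h *: 1) - \int[leb m]_v F a v)
   @[h --> 0^'] --> \int[leb m]_v ('D_w psi (A v + a *: w) * K v).
  have qe : (fun h : R => h^-1 *: (((fun t : R => \int[leb m]_v F t v) \o shift a) (h *: 1) -
      \int[leb m]_v F a v)) = (fun h : R => h^-1 *: (\int[leb m]_y F (h + a) y - \int[leb m]_y F a y)).
    apply/funext => h /=; congr (_ *: (_ - _)).
    by rewrite /GRing.scale /= mulr1.
  by rewrite qe.
split; first by apply/cvg_ex; eexists; exact: cv'.
exact: (cvg_lim _ cv').
Qed.

End derivative_under_integral.

(** * Correlation with kernels and integration by parts *)

Section correlation.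
Context {R : realType} {k : nat}.
Implicit Types (psi K L : 'rV[R]_k -> R) (y w z : 'rV[R]_k).

Lemma locint_Cc rho psi K : locint K -> Cc rho psi ->
  (leb k).-integrable setT (EFin \o (fun z => psi z * K z)).
Proof.
move=> iK Hpsi.
have [M HM] : exists M : R, forall y, `|psi y| <= M := Cc_bounded Hpsi.
apply: (@locint_mul _ _ _ _ M (rho + 1)) => //.
  exact: continuous_measurable_rv (Cc_cont Hpsi).
by move=> v hv; apply: (proj2 Hpsi); lra.
Qed.

Lemma Cc_translate rho psi y : Cc rho psi -> Cc (rho + enorm y) (fun z => psi (y + z)).
Proof.
move=> [s z]; split; last first.
  move=> v hv; apply: z; have := enormD (y + v) (- y); rewrite addrAC subrr add0r enormN.
  lra.
apply: (smooth_onP _ _).2 => n.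
apply: (@Ck_comp _ _ _ setT setT) => //; first exact: openT.
move=> i q; apply: (@Ck_near_eq _ _ _ _ (fun z => y 0 i + z 0 i)); first exact: openT.
  by move=> x _; rewrite mxE.
by apply: Ck_add; [exact: openT|exact: Ck_cst|exact: Ck_coord].
Qed.

Lemma integrable_corr rho psi K y : locint K -> Cc rho psi ->
  (leb k).-integrable setT (EFin \o (fun z => psi (y + z) * K z)).
Proof. by move=> iK H; exact: locint_Cc iK (Cc_translate y H). Qed.

(** A convolution with the reflected kernel. Since y occurs only in the smooth factor, derivatives
    in y never touch the kernel, which may therefore be singular. *)
Definition corr K psi y : R := \int[leb k]_z (psi (y + z) * K z).

Lemma derive_corr rho K psi w : locint K -> Cc rho psi ->
  'D_w (corr K psi) = corr K ('D_w psi).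
Proof.
move=> iK H; apply/funext => y; rewrite derive_line.
have mA : measurable_fun [set: 'rV[R]_k] (fun z : 'rV[R]_k => y + z).
  exact: measurable_rvD.
have AC (v : 'rV[R]_k) : enorm v <= enorm (y + v) + enorm y.
  by have := enormD (y + v) (- y); rewrite addrAC subrr add0r enormN.
have h := is_derive_under_integral w mA AC iK H 0.
rewrite derive1E.
rewrite (_ : (fun t : R => corr K psi (y + t *: w)) =
  fun t : R => \int[leb k]_v (psi (y + v + t *: w) * K v)); last first.
  apply/funext => t; congr Rintegral; apply/funext => v.
  by rewrite addrAC.
rewrite (@derive_val _ _ _ _ _ _ _ h); congr Rintegral; apply/funext => v.
by rewrite scale0r addr0.
Qed.

Lemma corr_sum (I : Type) (r : seq I) (F : I -> 'rV[R]_k -> R) rho K y :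
  locint K -> (forall i, Cc rho (F i)) ->
  corr K (fun x => \sum_(i <- r) F i x) y = \sum_(i <- r) corr K (F i) y.
Proof.
move=> iK H; elim: r => [|i r IH].
  rewrite big_nil /corr; transitivity (\int[leb k]_z (0 : R)).
    by congr Rintegral; apply/funext => z; rewrite big_nil mul0r.
  by rewrite Rintegral_cst// mul0r.
rewrite big_cons -IH /corr -RintegralD//; last 2 first.
- exact: integrable_corr.
- exact: (@integrable_corr rho (fun x => \sum_(j <- r) F j x) K y iK (Cc_sum r H)).
by congr Rintegral; apply/funext => z; rewrite big_cons mulrDl.
Qed.

Lemma laplacian_corr rho K psi : locint K -> Cc rho psi ->
  laplacian (corr K psi) = corr K (laplacian psi).
Proof.
move=> iK H; apply/funext => y; rewrite /laplacian.
rewrite (@corr_sum _ _ _ rho)//; last by move=> i; do 2 apply: Cc_derive.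
apply: eq_bigr => i _; have e1 := derive_corr (ebasis R i) iK H.
have e2 := derive_corr (ebasis R i) iK (Cc_derive (ebasis R i) H).
by rewrite e1; exact: (congr1 (fun g : 'rV[R]_k -> R => g y) e2).
Qed.

(** By translation invariance the integral of psi (z + t w) does not depend on t; its derivative at
    t = 0 is the claim. *)
Lemma integral_derive0 rho psi w : Cc rho psi -> \int[leb k]_z 'D_w psi z = 0.
Proof.
move=> H.
have AC (v : 'rV[R]_k) : enorm v <= enorm v + 0 by rewrite addr0.
have mA : measurable_fun [set: 'rV[R]_k] (fun z : 'rV[R]_k => z) by [].
have h := is_derive_under_integral w mA AC (locint_cst 1) H 0.
have e : (fun t : R => \int[leb k]_v (psi (v + t *: w) * 1)) = cst (\int[leb k]_v psi v).
  apply/funext => t; rewrite /Rintegral; congr fine.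
  rewrite -(@integral_translation _ _ (t *: w) (EFin \o psi)).
    by apply: eq_integral => v _ /=; rewrite mulr1.
  by apply/measurable_EFinP; exact: continuous_measurable_rv (Cc_cont H).
rewrite e in h.
have := @derive_val _ _ _ _ _ _ _ h; rewrite derive_cst => ->.
by congr Rintegral; apply/funext => z; rewrite mulr1 scale0r addr0.
Qed.

Definition smooth K := forall n, Ck n setT K.

Lemma smooth_diff K x : smooth K -> differentiable K x.
Proof. by move=> H; exact: (Ck_diff (H 0%N)). Qed.

Lemma smooth_derive K w : smooth K -> smooth ('D_w K).
Proof. by move=> H n; have [_] := H n.+1; exact. Qed.

Lemma smooth_measurable K : smooth K -> measurable_fun [set: 'rV[R]_k] K.
Proof.
move=> H; apply: continuous_measurable_rv => x.
by apply: (@differentiable_continuous _ _ _ x K); exact: smooth_diff.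
Qed.

Lemma Cc_mul rho psi K : Cc rho psi -> smooth K -> Cc rho (fun z => psi z * K z).
Proof.
move=> [s z] sK; split; last by move=> y ry; rewrite z// mul0r.
by apply: (smooth_onP _ _).2 => n; apply: Ck_mul; [exact: openT|exact: (smooth_onP _ _).1|].
Qed.

Lemma integrable_Cc rho psi : Cc rho psi -> (leb k).-integrable setT (EFin \o psi).
Proof.
move=> H; have := locint_Cc (locint_cst 1) H.
by apply: eq_integrable => // x _ /=; rewrite mulr1.
Qed.

(** The product psi K is again smooth with compact support, so its derivative along w integrates to
    0. *)
Lemma integral_by_parts rho psi K w : Cc rho psi -> smooth K ->
  \int[leb k]_z ('D_w psi z * K z) = - \int[leb k]_z (psi z * 'D_w K z).
Proof.
move=> H sK; apply/eqP; rewrite -addr_eq0; apply/eqP.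
rewrite -RintegralD//; last 2 first.
- exact: integrable_Cc (Cc_mul (Cc_derive w H) sK).
- exact: integrable_Cc (Cc_mul H (smooth_derive w sK)).
rewrite -[RHS](integral_derive0 w (Cc_mul H sK)).
congr Rintegral; apply/funext => z.
rewrite -[RHS]/('D_w (psi * K) z) deriveM; first by rewrite addrC [X in _ + X]mulrC.
  by apply: diff_derivable; exact: Cc_diff H.
by apply: diff_derivable; exact: smooth_diff.
Qed.

Lemma integral_laplacian rho psi K : Cc rho psi -> smooth K ->
  \int[leb k]_z (laplacian psi z * K z) = \int[leb k]_z (psi z * laplacian K z).
Proof.
move=> H sK.
have dC (v : 'rV[R]_k) : Cc rho ('D_v psi) := Cc_derive v H.
have sum1 (I : Type) (r : seq I) (F : I -> 'rV[R]_k -> R) : (forall i, (leb k).-integrable setT (EFin \o F i)) ->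
  (leb k).-integrable setT (EFin \o (fun z => \sum_(i <- r) F i z)) /\
  \int[leb k]_z (\sum_(i <- r) F i z) = \sum_(i <- r) \int[leb k]_z F i z.
  move=> iF; elim: r => [|i r [IH1 IH2]].
    rewrite big_nil (_ : (fun z => _) = cst 0); last by apply/funext => z; rewrite big_nil.
    split; first exact: integrable0.
    by rewrite Rintegral_cst// mul0r.
  rewrite big_cons -IH2 -RintegralD// (_ : (fun z => _) = (fun z => F i z + \sum_(i <- r) F i z)).
    by split => //; have := integrableD measurableT (iF i) IH1; apply: eq_integrable.
  by apply/funext => z; rewrite big_cons.
rewrite (_ : (fun z => laplacian psi z * K z) =
  (fun z => \sum_(i < k) ('D_(ebasis R i) ('D_(ebasis R i) psi) z * K z))); last first.
  by apply/funext => z; rewrite mulr_suml.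
rewrite (_ : (fun z => psi z * laplacian K z) =
  (fun z => \sum_(i < k) (psi z * 'D_(ebasis R i) ('D_(ebasis R i) K) z))); last first.
  by apply/funext => z; rewrite mulr_sumr.
rewrite (sum1 _ _ _ _).2; last first.
  by move=> i; exact: integrable_Cc (Cc_mul (Cc_derive _ (dC _)) sK).
rewrite (sum1 _ _ _ _).2; last first.
  by move=> i; exact: integrable_Cc (Cc_mul H (smooth_derive _ (smooth_derive _ sK))).
apply: eq_bigr => i _.
rewrite (integral_by_parts _ (dC _) sK) (integral_by_parts _ H (smooth_derive _ sK)).
by rewrite opprK.
Qed.

Lemma derive_basis psi x v : differentiable psi x ->
  'D_v psi x = \sum_i v 0 i * 'D_(ebasis R i) psi x.
Proof.
move=> d; rewrite deriveE// {1}(row_sum_delta v) linear_sum; apply: eq_bigr => i _.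
by rewrite linearZ /= /ebasis deriveE.
Qed.

(** Invariance of the trace of the Hessian: expanding each row in the standard basis, the second
    partial derivative in (i, j) gets the coefficient (O^T O)_(ij), that is 1 or 0. *)
Lemma laplacian_frame rho psi (O : 'M[R]_k) x : O *m O^T = 1%:M -> Cc rho psi ->
  laplacian psi x = \sum_i 'D_(row i O) ('D_(row i O) psi) x.
Proof.
move=> HO H.
have D2 v : 'D_v ('D_v psi) x = \sum_i \sum_j v 0 i * v 0 j * 'D_(ebasis R i) ('D_(ebasis R j) psi) x.
  rewrite derive_basis; last exact: Cc_diff (Cc_derive v H).
  apply: eq_bigr => i _.
  have -> : 'D_v psi = \sum_j (fun x => v 0 j *: 'D_(ebasis R j) psi x).
    apply/funext => y; rewrite derive_basis; last exact: Cc_diff H.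
    by rewrite fct_sumE.
  have dj (j : 'I_k) : differentiable ('D_(ebasis R j) psi) x by exact: Cc_diff (Cc_derive _ H).
  rewrite derive_sum; last by move=> j; apply: diff_derivable; exact: differentiableZ.
  rewrite mulr_sumr; apply: eq_bigr => j _.
  have -> : 'D_(ebasis R i) (fun y => v 0 j *: 'D_(ebasis R j) psi y) x =
      v 0 j *: 'D_(ebasis R i) ('D_(ebasis R j) psi) x.
    by apply: deriveZ; exact: diff_derivable.
  by rewrite mulrA.
under [RHS]eq_bigr => l _ do rewrite D2.
rewrite exchange_big /=.
apply: eq_bigr => i _; rewrite exchange_big /=.
rewrite (bigD1 i)//= [X in _ + X]big1 ?addr0.
  rewrite -mulr_suml.
  rewrite (_ : \sum_l _ = (O^T *m O) i i); last first.
    by rewrite mxE; apply: eq_bigr => l _; rewrite !mxE.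
  by rewrite (orthogonal_trmx HO) mxE eqxx mul1r.
move=> j ji; rewrite -mulr_suml.
rewrite (_ : \sum_l _ = (O^T *m O) i j); last first.
  by rewrite mxE; apply: eq_bigr => l _; rewrite !mxE.
by rewrite (orthogonal_trmx HO) mxE eq_sym (negbTE ji) mul0r.
Qed.

End correlation.

(** * Derivatives of the Radon transform *)

Section radon_derivatives.
Context {R : realType} {m : nat}.
Variables (O : 'M[R]_m.+1).
Hypothesis HO : O *m O^T = 1%:M.
Implicit Types psi : 'rV[R]_m.+1 -> R.

Lemma row_frame0 : row 0 O = rcons0 (1, 0 : 'rV[R]_m) *m O.
Proof.
rewrite rowE; congr mulmx; apply/rowP => i; case: (unliftP ord0 i) => [j ->|->].
  by rewrite rcons0_lift !mxE.
by rewrite rcons0_0 mxE.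
Qed.

Lemma row_frame_lift i : row (lift 0 i) O = rcons0 (0, delta_mx 0 i : 'rV[R]_m) *m O.
Proof.
rewrite rowE; congr mulmx; apply/rowP => j; case: (unliftP ord0 j) => [j' ->|->].
  by rewrite rcons0_lift !mxE.
by rewrite rcons0_0 mxE.
Qed.

Lemma rcons0D (s t : R) (u v : 'rV[R]_m) : rcons0 (s + t, u + v) = rcons0 (s, u) + rcons0 (t, v).
Proof.
apply/rowP => j; case: (unliftP ord0 j) => [j' ->|->].
  by rewrite rcons0_lift [LHS]mxE [RHS]mxE !rcons0_lift.
by rewrite rcons0_0 [RHS]mxE !rcons0_0.
Qed.

Lemma rcons0Z (s t : R) (u : 'rV[R]_m) : rcons0 (t * s, t *: u) = t *: rcons0 (s, u).
Proof.
apply/rowP => j; case: (unliftP ord0 j) => [j' ->|->].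
  by rewrite rcons0_lift [LHS]mxE [RHS]mxE rcons0_lift.
by rewrite rcons0_0 [RHS]mxE !rcons0_0.
Qed.

Lemma is_derive_radon rho psi (t : R) : Cc rho psi ->
  is_derive t 1 (radon O psi) (radon O ('D_(row 0 O) psi) t).
Proof.
move=> H.
have mA : measurable_fun [set: 'rV[R]_m] (fun v : 'rV[R]_m => rcons0 (0, v) *m O).
  apply: measurable_mulmx; apply: (measurableT_comp (@measurable_rcons0 R m)).
  exact: measurable_fun_pair.
have AC (v : 'rV[R]_m) : enorm v <= enorm (rcons0 (0, v) *m O) + 0.
  by rewrite addr0 enorm_orth// enorm_tail_le.
have h := is_derive_under_integral (row 0 O) mA AC (locint_cst 1) H t.
have e (chi : 'rV[R]_m.+1 -> R) (s : R) :
    \int[leb m]_v (chi (rcons0 (0, v) *m O + s *: row 0 O) * 1) = radon O chi s.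
  congr Rintegral; apply/funext => v; rewrite mulr1 row_frame0 scalemxAl -mulmxDl.
  by rewrite -rcons0Z -rcons0D mulr1 add0r scaler0 addr0.
rewrite -e; rewrite (_ : radon O psi = fun s : R => \int[leb m]_v (psi (rcons0 (0, v) *m O + s *: row 0 O) * 1)) //.
by apply/funext => s; rewrite e.
Qed.

(** Moving psi along a row other than row 0 is a translation inside the hyperplane, which leaves its
    integral unchanged. *)
Lemma radon_tangent rho psi t i : Cc rho psi -> radon O ('D_(row (lift 0 i) O) psi) t = 0.
Proof.
move=> H; set w := row _ O.
have mA : measurable_fun [set: 'rV[R]_m] (fun v : 'rV[R]_m => rcons0 (t, v) *m O).
  apply: measurable_mulmx; apply: (measurableT_comp (@measurable_rcons0 R m)).
  exact: measurable_fun_pair.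
have AC (v : 'rV[R]_m) : enorm v <= enorm (rcons0 (t, v) *m O) + 0.
  by rewrite addr0 enorm_orth// enorm_tail_le.
have h := is_derive_under_integral w mA AC (locint_cst 1) H 0.
have e : (fun s : R => \int[leb m]_v (psi (rcons0 (t, v) *m O + s *: w) * 1)) = cst (radon O psi t).
  apply/funext => s; rewrite /radon /Rintegral; congr fine.
  pose g v := (psi (rcons0 (t, v) *m O))%:E.
  rewrite -(@integral_translation _ _ (s *: delta_mx 0 i) g); last first.
    apply/measurable_EFinP.
    exact: (measurableT_comp (continuous_measurable_rv (Cc_cont H)) mA).
  apply: eq_integral => v _ /=; rewrite mulr1 /w row_frame_lift scalemxAl -mulmxDl.
  by rewrite -rcons0Z -rcons0D mulr0 addr0.
rewrite e in h.
have := @derive_val _ _ _ _ _ _ _ h; rewrite derive_cst => ->.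
by congr Rintegral; apply/funext => z; rewrite mulr1 scale0r addr0.
Qed.

Lemma integrable_radon rho psi t : Cc rho psi ->
  (leb m).-integrable setT (EFin \o (fun v => psi (rcons0 (t, v) *m O))).
Proof.
move=> H; have [M HM] : exists M : R, forall y, `|psi y| <= M := Cc_bounded H.
apply: bdsupp_integrable; apply: (@radon_bdsupp _ _ _ _ _ M rho) => //.
  exact: continuous_measurable_rv (Cc_cont H).
exact: (proj2 H).
Qed.

Lemma radon_sum (I : Type) (r : seq I) (F : I -> 'rV[R]_m.+1 -> R) rho t :
  (forall i, Cc rho (F i)) ->
  radon O (fun x => \sum_(i <- r) F i x) t = \sum_(i <- r) radon O (F i) t.
Proof.
move=> H; elim: r => [|i r IH].
  rewrite big_nil /radon; transitivity (\int[leb m]_z (0 : R)).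
    by congr Rintegral; apply/funext => z; rewrite big_nil.
  by rewrite Rintegral_cst// mul0r.
rewrite big_cons -IH /radon -RintegralD//; last 2 first.
- exact: integrable_radon.
- exact: (@integrable_radon rho (fun x => \sum_(j <- r) F j x) t (Cc_sum r H)).
by congr Rintegral; apply/funext => z; rewrite big_cons.
Qed.

(** In the frame O only the second derivative along row 0 survives the integration over the
    hyperplane, and that one is the t-derivative of the first. *)
Lemma radon_laplacian rho psi (t : R) : Cc rho psi ->
  is_derive t 1 (radon O ('D_(row 0 O) psi)) (radon O (laplacian psi) t).
Proof.
move=> H; rewrite (_ : radon O (laplacian psi) t = radon O ('D_(row 0 O) ('D_(row 0 O) psi)) t).
  exact: is_derive_radon (Cc_derive _ H).
rewrite (_ : laplacian psi = fun x => \sum_i 'D_(row i O) ('D_(row i O) psi) x); last first.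
  by apply/funext => x; exact: laplacian_frame H.
rewrite (@radon_sum _ _ _ rho); last by move=> i; do 2 apply: Cc_derive.
rewrite big_ord_recl [X in _ + X]big1 ?addr0// => i _.
by apply: (@radon_tangent rho); exact: Cc_derive.
Qed.

Lemma derive1n_radon rho psi j : Cc rho psi ->
  derive1n (2 * j) (radon O psi) = radon O (iter j (@laplacian R m.+1) psi).
Proof.
move=> H; elim: j => [|j IH]; first by rewrite muln0.
have HC := Cc_iter_laplacian j H.
rewrite mulnS addnC addn2 !derive1nS IH.
have -> : (radon O (iter j (@laplacian R m.+1) psi))^`()%classic = radon O ('D_(row 0 O) (iter j (@laplacian R m.+1) psi)).
  apply/funext => t; rewrite derive1E.
  exact: (@derive_val _ _ _ _ _ _ _ (is_derive_radon t HC)).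
apply/funext => t; rewrite derive1E.
exact: (@derive_val _ _ _ _ _ _ _ (radon_laplacian t HC)).
Qed.

End radon_derivatives.

(** * Radial integrals and dominated convergence *)

Section radial.
Context {R : realType} {n : nat}.
Hypothesis n0 : (0 < n)%N.
Local Notation V := 'rV[R]_n.
Local Notation L := (@lebesgue_measure R).

Definition area : R := fine (@sphm R n setT).

Lemma areaE : (area%:E = @sphm R n setT)%E.
Proof. by rewrite /area fineK// fin_num_measure. Qed.

Lemma area_ge0 : 0 <= area.
Proof. by rewrite fine_ge0. Qed.

Lemma integral_sphm_eq_on (f g : V -> \bar R) : measurable_fun setT f -> measurable_fun setT g ->
  (forall y, usphere y -> f y = g y) -> (\int[@sphm R n]_y f y = \int[@sphm R n]_y g y)%E.
Proof.
move=> mf mg fg; rewrite sphm_integral_on// [RHS]sphm_integral_on//.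
by apply: eq_integral => y; rewrite inE => /fg.
Qed.

Lemma ge0_integral_radial (h : R -> R) : measurable_fun [set: R] h -> (forall r, 0 <= h r) ->
  (\int[leb n]_z (h (enorm z))%:E = area%:E * \int[L]_r (r ^+ n.-1 * posr r * h r)%:E)%E.
Proof.
move=> mh h0.
have men := @measurable_enorm R n _ _ _ (@measurable_id _ V setT).
have mF : measurable_fun [set: V] (fun z : V => (h (enorm z))%:E).
  by apply/measurable_EFinP; exact: (measurableT_comp mh men).
rewrite (ge0_polar n0 mF); last by move=> z; rewrite lee_fin.
rewrite -ge0_integralZlT; last 3 first.
- apply/measurable_EFinP; apply: measurable_funM => //; apply: measurable_funM => //.
  exact: measurable_posr.
- move=> r; rewrite lee_fin posrE; case: ltP => r0; last by rewrite mulr0 mul0r.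
  by rewrite mulr1 mulr_ge0// exprn_ge0// ltW.
- by rewrite lee_fin area_ge0.
apply: eq_integral => r _; rewrite posrE; case: ltP => r0; last by rewrite mulr0 !mul0r mul0e mule0.
rewrite (@integral_sphm_eq_on _ (fun=> (h r)%:E)) => //; last 2 first.
- apply/measurable_EFinP; apply: (measurableT_comp mh); apply: measurable_enorm.
  exact: measurable_rvZ.
- by move=> y y1; rewrite enormZ (gtr0_norm r0) y1 mulr1.
have -> : (\int[@sphm R n]__ (h r)%:E = (h r)%:E * area%:E)%E by rewrite areaE; exact: integral_cst.
by rewrite -!EFinM; congr EFin; ring.
Qed.

(** In polar coordinates the integrand becomes t^(n-1-p) on 0 < t < r. The exponent is nonnegative
    as p < n, so the integrand is bounded there. *)
Lemma locint_expV p : (p < n)%N -> @locint R n (fun z => enorm z ^- p).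
Proof.
move=> pn.
have men := @measurable_enorm R n _ _ _ (@measurable_id _ V setT).
have mexp : measurable_fun [set: V] (fun z : V => enorm z ^- p).
  exact: measurable_expV.
split => // r; apply/integrableP; split; first by apply/measurable_EFinP; exact: measurable_funTS.
have -> : (\int[leb n]_(x in @eball R n r) `|(EFin \o (fun z => enorm z ^- p)) x| =
  \int[leb n]_z (enorm z ^- p * posr (r - enorm z))%:E)%E.
  rewrite [LHS]integral_mkcond; apply: eq_integral => z _.
  rewrite patchE posrE subr_gt0.
  have -> : (z \in @eball R n r) = (enorm z < r) by apply/idP/idP; rewrite inE.
  case: ifPn => _; rewrite ?mulr1 ?mulr0//=.
  by rewrite ger0_norm// invr_ge0 exprn_ge0// enorm_ge0.
have mpr : measurable_fun [set: R] (fun t : R => posr (r - t)).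
  by apply: (measurableT_comp (@measurable_posr R)); exact: measurable_funB.
pose h (t : R) : R := `|t| ^- p * posr (r - t).
have -> : (\int[leb n]_z (enorm z ^- p * posr (r - enorm z))%:E =
    \int[leb n]_z (h (enorm z))%:E)%E.
  by apply: eq_integral => z _; rewrite /h ger0_norm// enorm_ge0.
rewrite (@ge0_integral_radial h); last 2 first.
- apply: measurable_funM => //; apply: measurable_expV.
  exact: (@normr_measurable R setT).
- by move=> t; rewrite mulr_ge0 ?posr_ge0// invr_ge0 exprn_ge0.
apply: lte_mul_pinfty; [by rewrite lee_fin area_ge0|by []|].
apply: (@le_lt_trans _ _ (\int[L]_t (`|r| ^+ (n.-1 - p) * \1_(`[0%R, r]%classic : set R) t)%:E)%E).
  apply: ge0_le_integral => //.
  - move=> t _; rewrite lee_fin posrE; case: ltP => t0; last by rewrite mulr0 mul0r.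
    by rewrite !mulr_ge0 ?posr_ge0// ?invr_ge0// exprn_ge0// ltW.
  - apply/measurable_EFinP; apply: measurable_funM => //.
      by apply: measurable_funM => //; exact: measurable_posr.
    apply: measurable_funM => //; apply: measurable_expV.
    exact: (@normr_measurable R setT).
  - by apply/measurable_EFinP; apply: measurable_funM.
  move=> t _; rewrite /h lee_fin !posrE subr_gt0 indicE.
  have [t0|t0] := ltP 0 t; last by rewrite mulr0 mul0r mulr_ge0// exprn_ge0.
  have [tr|tr] := ltP t r; last by rewrite !mulr0 mulr_ge0// exprn_ge0.
  rewrite mem_set; last by rewrite /= in_itv /= !ltW.
  rewrite !mulr1 (gtr0_norm t0) -expfB_cond; last by rewrite gt_eqF// -ltnS prednK.
  by apply: lerXn2r; rewrite ?nnegrE ?ltW// gtr0_norm// (lt_trans t0).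
rewrite (integral_indicM _ _ (fun=> _)) integral_cst//=.
rewrite lebesgue_measure_itv /=; case: ifPn => _; rewrite ?mule0// -EFinB -EFinM ltry//.
Qed.

End radial.

Section dominated.
Context {R : realType} {n : nat}.
Hypothesis n0 : (0 < n)%N.
Local Notation V := 'rV[R]_n.

(** Nothing is asked at z = 0, a null set: the regularised kernels converge, and are bounded by the
    limit kernels, only off the singularity. *)
Lemma cvg_integral_dominated (F : nat -> V -> R) (F0 G : V -> R) :
  (forall j, measurable_fun [set: V] (F j)) -> measurable_fun [set: V] F0 ->
  (forall z, z != 0 -> F j z @[j --> \oo] --> F0 z) ->
  (leb n).-integrable setT (EFin \o G) -> (forall j z, z != 0 -> `|F j z| <= G z) ->
  (\int[leb n]_z F j z) @[j --> \oo] --> \int[leb n]_z F0 z.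
Proof.
move=> mF mF0 cF iG FG.
have [] := @dominated_convergence _ _ _ (leb n) setT measurableT
  (fun j => EFin \o F j) (EFin \o F0) (EFin \o G).
- by move=> j; apply/measurable_EFinP; exact: mF.
- exact/measurable_EFinP.
- apply: ae_off0 => // z z0 _; apply: cvg_EFin; first by near=> j.
  exact: cF.
- exact: iG.
- by apply: ae_off0 => // z z0 j _ /=; rewrite lee_fin; exact: FG.
move=> iF0 _ cv; apply: fine_cvg; rewrite fineK; first exact: cv.
exact: integrable_fin_num.
Unshelve. all: by end_near.
Qed.

End dominated.

(** * Laplacians of radial kernels *)

Section kernels.
Context {R : realType} {n : nat}.
Local Notation V := 'rV[R]_n.
Implicit Types (z w : V) (e : R).

(* [invN e], [regN e] and [lnN e] are 1/|z|, |z| and ln |z| with |z|^2 replaced by |z|^2 + e^2. *)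
Definition invN e z : R := (Num.sqrt (dotv z z + e ^+ 2))^-1.

Lemma N2_gt0 e z : 0 < e -> 0 < dotv z z + e ^+ 2.
Proof. by move=> e0; rewrite ltr_wpDl ?exprn_gt0// dotvv_ge0. Qed.

Lemma invN_gt0 e z : 0 < e -> 0 < invN e z.
Proof. by move=> e0; rewrite invr_gt0 sqrtr_gt0 N2_gt0. Qed.

Lemma invN2 e z : 0 < e -> (dotv z z + e ^+ 2) * invN e z ^+ 2 = 1.
Proof.
move=> e0; rewrite /invN exprVn sqr_sqrtr ?ltW ?N2_gt0// mulfV// gt_eqF// N2_gt0//.
Qed.

Lemma smooth_dotvr w : smooth (fun z => dotv z w).
Proof.
move=> m; rewrite (_ : (fun z => _) = fun z => \sum_i z 0 i * w 0 i); last first.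
  by apply/funext => z; rewrite dotvE.
apply: Ck_sum; first exact: openT.
by move=> i; apply: Ck_mul; [exact: openT|exact: Ck_coord|exact: Ck_cst].
Qed.

Lemma smooth_N2 e : smooth (fun z => dotv z z + e ^+ 2).
Proof.
move=> m; rewrite (_ : (fun z => _) = fun z => \sum_i z 0 i * z 0 i + e ^+ 2); last first.
  by apply/funext => z; rewrite dotvE.
apply: Ck_add; [exact: openT| |exact: Ck_cst].
apply: Ck_sum; first exact: openT.
by move=> i; apply: Ck_mul; [exact: openT|exact: Ck_coord|exact: Ck_coord].
Qed.

Lemma smoothM (f g : V -> R) : smooth f -> smooth g -> smooth (fun z => f z * g z).
Proof. by move=> sf sg m; apply: Ck_mul => //; exact: openT. Qed.

Lemma smooth_invN e : 0 < e -> smooth (invN e).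
Proof.
move=> e0 m; apply: Ck_invsqrt; first exact: openT.
  by move=> z _; exact: N2_gt0.
exact: smooth_N2.
Qed.

Lemma smooth_invNX e p : 0 < e -> smooth (fun z => invN e z ^+ p).
Proof.
move=> e0; elim: p => [|p IH].
  by move=> m; rewrite (_ : (fun z => _) = fun=> 1)//; exact: Ck_cst.
rewrite (_ : (fun z => _) = fun z => invN e z * invN e z ^+ p).
  by apply: smoothM => //; exact: smooth_invN.
by apply/funext => z; rewrite exprS.
Qed.

Lemma derive_N2 e w z : 'D_w (fun z => dotv z z + e ^+ 2) z = 2 * dotv z w.
Proof.
rewrite derive_line.
have -> : (fun t : R => dotv (z + t *: w) (z + t *: w) + e ^+ 2) =
  (fun t : R => (dotv z z + e ^+ 2) + t * (2 * dotv z w) + t * t * dotv w w).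
  apply/funext => t; rewrite !(dotvDl, dotvDr, dotvZl, dotvZr) (dotvC w z); ring.
rewrite derive1E.
have h : is_derive (0 : R) 1 (fun t : R => (dotv z z + e ^+ 2) + t * (2 * dotv z w) + t * t * dotv w w) (2 * dotv z w).
  apply: is_derive_eq.
  by rewrite /GRing.scale /=; ring.
exact: (@derive_val _ _ _ _ _ _ _ h).
Qed.

Lemma is_derive_invsqrt (t : R) : 0 < t ->
  is_derive t 1 (fun t : R => (Num.sqrt t)^-1) (- 2^-1 * (Num.sqrt t)^-1 ^+ 3).
Proof.
move=> t0; have st : Num.sqrt t != 0 by rewrite gt_eqF// sqrtr_gt0.
have h := @is_deriveV R Num.sqrt t _ 1 st (@is_derive1_sqrt R _ t0).
apply: (is_derive_eq h); rewrite /GRing.scale /=; field; exact: st.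
Qed.

Lemma derive_invN e w z : 0 < e -> 'D_w (invN e) z = - dotv z w * invN e z ^+ 3.
Proof.
move=> e0.
have [_ h] := derive_comp1 w (smooth_diff z (@smooth_N2 e)) (is_derive_invsqrt (N2_gt0 z e0)).
rewrite -[LHS]/('D_w ((fun t : R => (Num.sqrt t)^-1) \o (fun z => dotv z z + e ^+ 2)) z) h derive_N2.
rewrite /invN; field; by rewrite gt_eqF// sqrtr_gt0 N2_gt0.
Qed.

Lemma derive_invNX e p w z : 0 < e ->
  'D_w (fun z => invN e z ^+ p) z = - p%:R * dotv z w * invN e z ^+ p.+2.
Proof.
move=> e0.
have [_ h] := derive_comp1 w (smooth_diff z (smooth_invN e0)) (is_derive1_exp p (invN e z)).
rewrite -[LHS]/('D_w ((fun t : R => t ^+ p) \o invN e) z) h derive_invN//.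
case: p {h} => [|p]; first by rewrite !mul0r oppr0 !mul0r.
by rewrite /= !exprS; ring.
Qed.

Definition regN e z : R := (dotv z z + e ^+ 2) * invN e z.

Lemma regNE e z : 0 < e -> regN e z = Num.sqrt (dotv z z + e ^+ 2).
Proof.
move=> e0; rewrite /regN /invN -{1}(sqr_sqrtr (ltW (N2_gt0 z e0))) expr2 mulfK//.
by rewrite gt_eqF// sqrtr_gt0 N2_gt0.
Qed.

Lemma smooth_regN e : 0 < e -> smooth (regN e).
Proof. by move=> e0; apply: smoothM; [exact: smooth_N2|exact: smooth_invN]. Qed.

Lemma derive_regN e w z : 0 < e -> 'D_w (regN e) z = 1 * dotv z w * invN e z ^+ 1.
Proof.
move=> e0; rewrite -[regN e]/((fun z => dotv z z + e ^+ 2) * invN e) deriveM; last 2 first.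
- by apply: diff_derivable; exact: smooth_diff (@smooth_N2 e).
- by apply: diff_derivable; exact: smooth_diff (smooth_invN e0).
rewrite derive_invN// derive_N2 /GRing.scale /=.
have h := invN2 z e0; rewrite expr1.
transitivity (- dotv z w * invN e z * ((dotv z z + e ^+ 2) * invN e z ^+ 2) + invN e z * (2 * dotv z w)).
  ring.
rewrite h; ring.
Qed.

Definition lnN e z : R := 2^-1 * ln (dotv z z + e ^+ 2).

Lemma lnN_derive e w z : 0 < e ->
  differentiable (lnN e) z /\ 'D_w (lnN e) z = 1 * dotv z w * invN e z ^+ 2.
Proof.
move=> e0; have N0 := N2_gt0 z e0.
have hg : is_derive (dotv z z + e ^+ 2) 1 (fun t : R => 2^-1 * ln t) (2^-1 * (dotv z z + e ^+ 2)^-1).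
  have h := is_deriveM (is_derive_cst (2^-1 : R) _ _) (is_derive1_ln N0).
  by apply: (is_derive_eq h); rewrite scaler0 addr0.
have [d h] := derive_comp1 w (smooth_diff z (@smooth_N2 e)) hg.
split; first exact: d.
rewrite -[LHS]/('D_w ((fun t : R => 2^-1 * ln t) \o (fun z => dotv z z + e ^+ 2)) z) h derive_N2.
rewrite /invN exprVn sqr_sqrtr ?ltW//; field; by rewrite gt_eqF.
Qed.

Lemma smooth_of_derive (f : V -> R) : (forall z, differentiable f z) ->
  (forall w, smooth ('D_w f)) -> smooth f.
Proof.
move=> df sf [|m]; split => //; try by move=> x _; exact: df.
by move=> v; exact: sf.
Qed.

Lemma smooth_lnN e : 0 < e -> smooth (lnN e).
Proof.
move=> e0; apply: smooth_of_derive.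
  by move=> z; have [] := lnN_derive 0 z e0.
move=> w; rewrite (_ : 'D_w _ = fun z => dotv z w * invN e z ^+ 2).
  by apply: smoothM; [exact: smooth_dotvr|exact: smooth_invNX].
by apply/funext => z; have [_ ->] := lnN_derive w z e0; rewrite mul1r.
Qed.

(** The shape of the gradient is common to |z|, ln |z| and all |z|^(-q) after regularisation. Of the
    two terms of the Laplacian, the first has as its limit the next kernel |z|^(-p), with
    coefficient n - p; the second carries e^2 and disappears in the limit if p < n, but concentrates
    at 0 if p = n. *)
Lemma laplacian_radial e (K : V -> R) (a : R) p : 0 < e ->
  (forall w z, 'D_w K z = a * dotv z w * invN e z ^+ p) ->
  forall z, laplacian K z =
    a * ((n%:R - p%:R) * invN e z ^+ p + p%:R * e ^+ 2 * invN e z ^+ p.+2).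
Proof.
move=> e0 DK z.
have D2 w : 'D_w ('D_w K) z =
   a * (dotv w w * invN e z ^+ p - p%:R * dotv z w ^+ 2 * invN e z ^+ p.+2).
  rewrite (_ : 'D_w K = (fun z => a * dotv z w) * (fun z => invN e z ^+ p)); last first.
    by apply/funext => y; rewrite DK.
  rewrite deriveM; last 2 first.
  - apply: diff_derivable; apply: differentiableM; first exact: differentiable_cst.
    exact: smooth_diff (smooth_dotvr w).
  - by apply: diff_derivable; exact: smooth_diff (smooth_invNX p e0).
  rewrite derive_invNX// (_ : 'D_w (fun z => a * dotv z w) z = a * dotv w w); last first.
    rewrite derive_line derive1E.
    have -> : (fun t : R => a * dotv (z + t *: w) w) = (fun t : R => a * dotv z w + t * (a * dotv w w)).
      by apply/funext => t; rewrite dotvDl dotvZl; ring.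
    have h : is_derive (0 : R) 1 (fun t : R => a * dotv z w + t * (a * dotv w w)) (a * dotv w w).
      by apply: is_derive_eq; rewrite /GRing.scale /=; ring.
    exact: (@derive_val _ _ _ _ _ _ _ h).
  by rewrite /GRing.scale /=; ring.
rewrite /laplacian (eq_bigr (fun i => a * (invN e z ^+ p - p%:R * (z 0 i * z 0 i) * invN e z ^+ p.+2))); last first.
  move=> i _; rewrite D2.
  have -> : dotv (ebasis R i) (ebasis R i) = 1.
    rewrite dotvE (bigD1 i)//= big1 ?addr0; first by rewrite !mxE !eqxx mulr1.
    by move=> j ji; rewrite !mxE (negbTE ji) andbF mul0r.
  have -> : dotv z (ebasis R i) = z 0 i.
    rewrite dotvE (bigD1 i)//= big1 ?addr0; first by rewrite !mxE !eqxx mulr1.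
    by move=> j ji; rewrite !mxE (negbTE ji) andbF mulr0.
  by rewrite mul1r expr2.
rewrite -mulr_sumr; congr (_ * _).
rewrite big_split /= sumrN sumr_const card_ord -mulr_suml -mulr_sumr -dotvE.
have -> : dotv z z = (dotv z z + e ^+ 2) - e ^+ 2 by ring.
have h := invN2 z e0; rewrite -mulr_natl.
have -> : invN e z ^+ p.+2 = invN e z ^+ p * invN e z ^+ 2 by rewrite -exprD addn2.
transitivity (n%:R * invN e z ^+ p - p%:R * invN e z ^+ p * ((dotv z z + e ^+ 2) * invN e z ^+ 2)
  + p%:R * e ^+ 2 * (invN e z ^+ p * invN e z ^+ 2)).
  ring.
rewrite h; ring.
Qed.

End kernels.

Section kernel_bounds.
Context {R : realType} {n : nat}.
Local Notation V := 'rV[R]_n.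
Implicit Types (z w : V) (e : R).
Local Notation eps j := (harmonic j : R).

Lemma eps_gt0 j : 0 < eps j. Proof. by rewrite invr_gt0 ltr0n. Qed.

Lemma eps_le1 j : eps j <= 1. Proof. by rewrite invf_le1 ?ltr0n// ler1n. Qed.

Lemma cvg_regularized z : (dotv z z + eps j ^+ 2) @[j --> \oo] --> dotv z z.
Proof.
have c := @cvg_harmonic R.
have h : (eps j ^+ 2) @[j --> \oo] --> (0 ^+ 2 : R).
  rewrite (_ : (fun j => _) = (fun j => eps j * eps j)); last by apply/funext => j; rewrite expr2.
  exact: cvgM.
rewrite expr0n /= in h.
by have := cvgD (cvg_cst (dotv z z)) h; rewrite addr0; apply.
Qed.

Lemma cvg_sqrt_regularized z : Num.sqrt (dotv z z + eps j ^+ 2) @[j --> \oo] --> enorm z.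
Proof.
by apply: continuous_cvg; [exact: sqrt_continuous|exact: cvg_regularized].
Qed.

Lemma cvg_invN z : z != 0 -> invN (eps j) z @[j --> \oo] --> (enorm z)^-1.
Proof.
move=> z0; apply: cvgV; first by rewrite enorm_eq0.
exact: cvg_sqrt_regularized.
Qed.

Lemma invN_le e z : z != 0 -> 0 < e -> invN e z <= (enorm z)^-1.
Proof.
move=> z0 e0; rewrite /invN /enorm lef_pV2 ?Num.Theory.posrE ?sqrtr_gt0 ?N2_gt0//; last first.
  by rewrite -enorm2 exprn_gt0// enorm_gt0.
by rewrite ler_wsqrtr// lerDl sqr_ge0.
Qed.

Lemma eps_invN_le1 e z : 0 < e -> e ^+ 2 * invN e z ^+ 2 <= 1.
Proof.
move=> e0; rewrite -(invN2 z e0) ler_wpM2r ?sqr_ge0// lerDr; exact: dotvv_ge0.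
Qed.

Lemma sqrt_regularized_le e z : 0 < e -> e <= 1 -> Num.sqrt (dotv z z + e ^+ 2) <= enorm z + 1.
Proof.
move=> e0 e1; have h := enorm_ge0 z.
rewrite -[leRHS]ger0_norm; last by rewrite addr_ge0.
rewrite -sqrtr_sqr ler_wsqrtr// -enorm2; nra.
Qed.

End kernel_bounds.

(** * Moving one Laplacian onto a kernel *)

Section chain.
Context {R : realType} {n : nat}.
Hypothesis n0 : (0 < n)%N.
Local Notation V := 'rV[R]_n.
Local Notation eps j := (harmonic j : R).
Variables (rho : R) (psi : V -> R).
Hypothesis psiC : Cc rho psi.

Let mpsi : measurable_fun [set: V] psi.
Proof. exact: continuous_measurable_rv (Cc_cont psiC). Qed.

Let mlap : measurable_fun [set: V] (laplacian psi).
Proof. exact: continuous_measurable_rv (Cc_cont (Cc_laplacian psiC)). Qed.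

Lemma integrable_normM (chi B : V -> R) : Cc rho chi -> locint B ->
  (leb n).-integrable setT (EFin \o (fun z => `|chi z| * B z)).
Proof.
move=> H iB; have [M HM] : exists M : R, forall y, `|chi y| <= M := Cc_bounded H.
apply: (@locint_mul _ _ _ _ M (rho + 1)) => //.
- apply: (measurableT_comp (@normr_measurable R setT)).
  exact: continuous_measurable_rv (Cc_cont H).
- by move=> v; rewrite normr_id.
- by move=> v hv; rewrite (proj2 H) ?normr0//; lra.
Qed.

Section kernel.
Variables (K : nat -> V -> R) (K0 B : V -> R) (a : R) (p : nat).
Hypothesis sK : forall j, smooth (K j).
Hypothesis DK : forall j w z, 'D_w (K j) z = a * dotv z w * invN (eps j) z ^+ p.
Hypothesis mK0 : measurable_fun [set: V] K0.
Hypothesis KK0 : forall z, z != 0 -> K j z @[j --> \oo] --> K0 z.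
Hypothesis KB : forall j z, z != 0 -> `|K j z| <= B z.
Hypothesis iB : locint B.

Lemma cvg_laplacian_kernel : (\int[leb n]_z (laplacian psi z * K j z)) @[j --> \oo] -->
  \int[leb n]_z (laplacian psi z * K0 z).
Proof.
apply: (@cvg_integral_dominated _ _ n0 _ _ (fun z => `|laplacian psi z| * B z)).
- by move=> j; apply: measurable_funM => //; exact: smooth_measurable.
- exact: measurable_funM.
- by move=> z z0; apply: cvgM; [exact: cvg_cst|exact: KK0].
- exact: integrable_normM (Cc_laplacian psiC) iB.
- by move=> j z z0; rewrite normrM ler_wpM2l// KB.
Qed.

Lemma laplacian_kernelE j : \int[leb n]_z (laplacian psi z * K j z) =
  \int[leb n]_z (psi z * (a * ((n%:R - p%:R) * invN (eps j) z ^+ p +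
     p%:R * eps j ^+ 2 * invN (eps j) z ^+ p.+2))).
Proof.
rewrite (integral_laplacian psiC (sK j)); congr Rintegral; apply/funext => z.
by rewrite (laplacian_radial (eps_gt0 j) (DK j)).
Qed.

(** The error term is controlled by e^2 / (|z|^2 + e^2) <= 1: it is at most p |z|^(-p), which is
    locally integrable for p < n, and it tends to 0 at each z != 0. *)
Lemma chain_step : (p < n)%N -> \int[leb n]_z (laplacian psi z * K0 z) =
  a * (n%:R - p%:R) * \int[leb n]_z (psi z * enorm z ^- p).
Proof.
move=> pn; have iP := @locint_expV R n n0 p pn.
have minv j q : measurable_fun [set: V] (fun z : V => invN (eps j) z ^+ q).
  exact: smooth_measurable (smooth_invNX q (eps_gt0 j)).
transitivity (\int[leb n]_z (psi z * (a * ((n%:R - p%:R) * enorm z ^- p)))); last first.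
  rewrite -RintegralZl//; last exact: locint_Cc iP psiC.
  by congr Rintegral; apply/funext => z; ring.
apply: (cvg_unique (@Rhausdorff R) cvg_laplacian_kernel).
rewrite (_ : (fun j => _) = fun j => \int[leb n]_z (psi z * (a * ((n%:R - p%:R) * invN (eps j) z ^+ p +
     p%:R * eps j ^+ 2 * invN (eps j) z ^+ p.+2)))); last first.
  by apply/funext => j; exact: laplacian_kernelE.
apply: (@cvg_integral_dominated _ _ n0 _ _
   (fun z => `|psi z| * (`|a| * (n%:R - p%:R + p%:R) * enorm z ^- p))).
- move=> j; apply: measurable_funM => //; apply: measurable_funM => //.
  by apply: measurable_funD; apply: measurable_funM.
- by apply: measurable_funM => //; apply: measurable_funM => //; apply: measurable_funM => //; case: iP.
- move=> z z0; have ci := cvg_invN z0.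
  have cX q : invN (eps j) z ^+ q @[j --> \oo] --> (enorm z)^-1 ^+ q.
    exact: (continuous_cvg _ (@exprn_continuous R q (enorm z)^-1) ci).
  have ce := @cvg_harmonic R.
  apply: cvgM; first exact: cvg_cst.
  apply: cvgM; first exact: cvg_cst.
  have -> : (n%:R - p%:R) * enorm z ^- p = (n%:R - p%:R) * (enorm z)^-1 ^+ p +
     p%:R * 0 ^+ 2 * (enorm z)^-1 ^+ p.+2 by rewrite expr0n/= mulr0 mul0r addr0 exprVn.
  apply: cvgD.
    apply: cvgM; [exact: cvg_cst|exact: cX].
  apply: cvgM; last exact: cX.
  apply: cvgM; first exact: cvg_cst.
  exact: (continuous_cvg _ (@exprn_continuous R 2 0) ce).
- exact: integrable_normM psiC (locintZ _ iP).
move=> j z z0; rewrite normrM ler_wpM2l// normrM.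
rewrite -[X in _ <= X]mulrA ler_wpM2l//.
have e0 : 0 < eps j := eps_gt0 j.
have i0 := invN_gt0 z e0; have ile := invN_le z0 e0; have i1 := eps_invN_le1 z e0.
have np : 0 <= n%:R - p%:R :> R by rewrite subr_ge0 ler_nat ltnW.
have pX : invN (eps j) z ^+ p <= enorm z ^- p.
  by rewrite -exprVn lerXn2r// nnegrE ?invr_ge0 ?enorm_ge0// ltW.
have p0 : 0 <= invN (eps j) z ^+ p by rewrite exprn_ge0// ltW.
rewrite ger0_norm; last first.
  apply: addr_ge0; apply: mulr_ge0 => //; first by rewrite mulr_ge0// sqr_ge0.
  by rewrite exprn_ge0// ltW.
rewrite [X in _ <= X]mulrDl lerD//; first by rewrite ler_wpM2l.
rewrite -mulrA ler_wpM2l//.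
have -> : invN (eps j) z ^+ p.+2 = invN (eps j) z ^+ 2 * invN (eps j) z ^+ p by rewrite -exprD.
rewrite mulrA; apply: le_trans pX.
by rewrite ler_piMl.
Qed.

Lemma invN_scale (e : R) (v : V) : 0 < e -> invN e (e *: v) = e^-1 * invN 1 v.
Proof.
move=> e0; rewrite /invN dotvZl dotvZr expr1n mulrA -expr2 -{2}(mulr1 (e ^+ 2)) -mulrDr.
by rewrite sqrtrM ?sqr_ge0// sqrtr_sqr gtr0_norm// invfM.
Qed.

Lemma Rintegral_scaling (e : R) (f : V -> R) : 0 < e ->
  (leb n).-integrable setT (EFin \o f) ->
  \int[leb n]_z f z = e ^+ n * \int[leb n]_z f (e *: z).
Proof.
move=> e0 iF; rewrite /Rintegral.
have mf : measurable_fun [set: V] (EFin \o f) by have /integrableP[] := iF.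
rewrite (_ : (\int[leb n]_x (f (e *: x))%:E = (e ^+ n)^-1%:E * \int[leb n]_x (f x)%:E)%E).
  rewrite fineM//; last exact: integrable_fin_num.
  by rewrite /= mulrA mulfV ?mul1r// gt_eqF// exprn_gt0.
exact: (@integral_scaling R n e (EFin \o f)).
Qed.

End kernel.
End chain.

Section poisson_mass.
Context {R : realType} {n : nat}.
Hypothesis n0 : (0 < n)%N.
Local Notation V := 'rV[R]_n.
Local Notation L := (@lebesgue_measure R).

Let s (r : R) : R := (Num.sqrt (r ^+ 2 + 1))^-1.
Let r1_gt0 (r : R) : 0 < r ^+ 2 + 1.
Proof. by rewrite ltr_wpDl// sqr_ge0. Qed.
Let s_gt0 r : 0 < s r.
Proof. by rewrite invr_gt0 sqrtr_gt0. Qed.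

Let s_der (r : R) : is_derive r 1 s (- r * s r ^+ 3).
Proof.
have h0 : is_derive r 1 (fun t : R => t ^+ 2 + 1) (2 * r).
  by apply: is_derive_eq; rewrite /GRing.scale /=; ring.
have h1 := is_derive_invsqrt (r1_gt0 r).
have h := @is_derive1_comp R _ _ r _ _ h1 h0.
by apply: (is_derive_eq h); rewrite /s; field; rewrite gt_eqF// sqrtr_gt0.
Qed.

Let s_cont : continuous s.
Proof.
move=> r; apply: (@differentiable_continuous _ _ _ r s).
by apply/derivable1_diffP; have [] := s_der r.
Qed.

(* r^(n-1) (r^2 + 1)^(-(n+2)/2) is the derivative of (r / sqrt (r^2 + 1))^n / n. *)
Lemma integral_poisson_radial :
  (\int[L]_r (r ^+ n.-1 * posr r * s r ^+ n.+2)%:E = (n%:R^-1)%:E)%E.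
Proof.
pose F (t : R) := (t * s t) ^+ n * n%:R^-1.
have Fd (t : R) : is_derive t 1 F (t ^+ n.-1 * s t ^+ n.+2).
  have h0 : is_derive t 1 (fun t : R => t * s t) (s t ^+ 3).
    have h := is_deriveM (is_derive_id t 1) (s_der t).
    apply: (is_derive_eq h); rewrite /GRing.scale /= mulr1.
    have e : (t ^+ 2 + 1) * s t ^+ 2 = 1.
      by rewrite /s exprVn sqr_sqrtr ?ltW// mulfV// gt_eqF.
    transitivity (s t * ((t ^+ 2 + 1) * s t ^+ 2) - t ^+ 2 * s t ^+ 3); last by ring.
    by rewrite e; ring.
  have h1 := is_derive1_exp n (t * s t).
  have h := @is_derive1_comp R _ _ t _ _ h1 h0.
  have h2 := is_deriveM h (is_derive_cst (n%:R^-1 : R) t 1).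
  apply: (is_derive_eq h2); rewrite scaler0 add0r /GRing.scale /=.
  have nn : n%:R != 0 :> R by rewrite pnatr_eq0 -lt0n.
  rewrite -[n.+2](_ : n.-1 + 3 = n.+2)%N; last by rewrite addnS addn2 prednK.
  by rewrite exprMn exprD; field.
have -> : (\int[L]_r (r ^+ n.-1 * posr r * s r ^+ n.+2)%:E =
    \int[L]_r (r ^+ n.-1 * s r ^+ n.+2 * posr (r - 0))%:E)%E.
  by apply: eq_integral => t _; rewrite subr0 mulrAC.
rewrite (integral_ray_FTC (l := n%:R^-1) _ _ (fun t _ => Fd t)) //.
- by rewrite /F mul0r expr0n eqn0Ngt n0 /= mul0r subr0.
- apply: continuous_subspaceT; apply: cont_mul; first exact: exprn_continuous.
  exact: cont_exp.
- by move=> t t0; rewrite mulr_ge0// exprn_ge0// ltW.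
- have c1 : t * s t @[t --> +oo] --> (1 : R).
    have c2 : (Num.sqrt (1 + t ^- 2))^-1 @[t --> +oo] --> (Num.sqrt (1 + 0 : R))^-1.
      apply: cvgV; first by rewrite addr0 sqrtr1 oner_neq0.
      apply: (continuous_cvg _ (@sqrt_continuous R (1 + 0))).
      by apply: cvgD; [exact: cvg_cst|exact: cvg_expV_pinfty].
    rewrite addr0 sqrtr1 invr1 in c2.
    apply: cvg_trans c2; apply: near_eq_cvg; near=> t.
    have t0 : 0 < t by near: t; exact: nbhs_pinfty_gt.
    rewrite /s (_ : t ^+ 2 + 1 = t ^+ 2 * (1 + t ^- 2)).
      rewrite sqrtrM ?sqr_ge0// sqrtr_sqr gtr0_norm//; set q := Num.sqrt _.
      rewrite invfM mulrA mulfV ?mul1r//.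
      by rewrite gt_eqF.
    by rewrite mulrDr mulr1 mulfV// expf_neq0// gt_eqF.
  rewrite -[X in _ --> X](_ : 1 ^+ n * n%:R^-1 = n%:R^-1); last by rewrite expr1n mul1r.
  apply: cvgM; last exact: cvg_cst.
  exact: (continuous_cvg _ (@exprn_continuous R n 1) c1).
Unshelve. all: by end_near.
Qed.

(** Total mass, up to the factor n, of the approximate identity that the Laplacian of a regularised
    kernel with p = n produces. *)
Lemma integral_poisson : (\int[leb n]_z (invN 1 z ^+ n.+2)%:E = (@area R n / n%:R)%:E)%E.
Proof.
have ms : measurable_fun [set: R] (fun r : R => s r ^+ n.+2).
  apply: continuous_measurable_fun; exact: cont_exp.
rewrite EFinM -integral_poisson_radial -(ge0_integral_radial n0 ms); last first.
  by move=> r; rewrite exprn_ge0// ltW.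
by apply: eq_integral => z _; rewrite /invN /s enorm2 expr1n.
Qed.

Lemma integrable_poisson : (leb n).-integrable setT (EFin \o (fun z : V => invN 1 z ^+ n.+2)).
Proof.
apply/integrableP; split.
  apply/measurable_EFinP; exact: smooth_measurable (smooth_invNX _ ltr01).
rewrite (_ : (\int[leb n]_z _)%E = (\int[leb n]_z (invN 1 z ^+ n.+2)%:E)%E).
  by rewrite integral_poisson ltry.
by apply: eq_integral => z _ /=; rewrite ger0_norm// exprn_ge0// ltW// invN_gt0.
Qed.

End poisson_mass.

Section chain_end.
Context {R : realType} {n : nat}.
Hypothesis n0 : (0 < n)%N.
Local Notation V := 'rV[R]_n.
Local Notation eps j := (harmonic j : R).
Variables (rho : R) (psi : V -> R).
Hypothesis psiC : Cc rho psi.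
Variables (K : nat -> V -> R) (K0 B : V -> R) (a : R).
Hypothesis sK : forall j, smooth (K j).
Hypothesis DK : forall j w z, 'D_w (K j) z = a * dotv z w * invN (eps j) z ^+ n.
Hypothesis mK0 : measurable_fun [set: V] K0.
Hypothesis KK0 : forall z, z != 0 -> K j z @[j --> \oo] --> K0 z.
Hypothesis KB : forall j z, z != 0 -> `|K j z| <= B z.
Hypothesis iB : locint B.

(** For p = n the first term of the Laplacian vanishes. In the second, z = e v cancels all powers of
    e and leaves n psi (e v) (|v|^2 + 1)^(-(n+2)/2), which converges to psi 0 times a function of
    mass [area]. This is the fundamental solution of the Laplacian. *)
Lemma chain_last : \int[leb n]_z (laplacian psi z * K0 z) = a * @area R n * psi 0.
Proof.
have [M HM] : exists M : R, forall y, `|psi y| <= M := Cc_bounded psiC.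
have mpsi : measurable_fun [set: V] psi by exact: continuous_measurable_rv (Cc_cont psiC).
have mP : measurable_fun [set: V] (fun z : V => invN 1 z ^+ n.+2).
  exact: smooth_measurable (smooth_invNX _ ltr01).
have nn : n%:R != 0 :> R by rewrite pnatr_eq0 -lt0n.
have iP : (leb n).-integrable setT (EFin \o (fun z : V => invN 1 z ^+ n.+2)) := integrable_poisson n0.
transitivity (\int[leb n]_v (a * n%:R * psi 0 * invN 1 v ^+ n.+2)); last first.
  rewrite RintegralZl// /Rintegral (integral_poisson n0) /=.
  by field.
apply: (cvg_unique (@Rhausdorff R) (cvg_laplacian_kernel n0 psiC sK mK0 KK0 KB iB)).
rewrite (_ : (fun j => _) = fun j => \int[leb n]_v (a * n%:R * psi (eps j *: v) * invN 1 v ^+ n.+2)); last first.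
  apply/funext => j; rewrite (laplacian_kernelE psiC sK DK).
  have e0 : 0 < eps j := eps_gt0 j.
  rewrite (Rintegral_scaling e0); last first.
    apply: integrable_Cc; apply: Cc_mul psiC _; rewrite subrr.
    apply: smoothM; first by move=> m; exact: Ck_cst.
    rewrite (_ : (fun z => _) = fun z => n%:R * eps j ^+ 2 * invN (eps j) z ^+ n.+2).
      by apply: smoothM; [move=> m; exact: Ck_cst|exact: smooth_invNX].
    by apply/funext => z; rewrite mul0r add0r.
  have bound (v : V) : `|a * n%:R * psi (eps j *: v) * invN 1 v ^+ n.+2| <=
      `|a * n%:R| * M * invN 1 v ^+ n.+2.
    rewrite normrM [X in _ * X]ger0_norm; last by rewrite exprn_ge0// ltW// invN_gt0.
    rewrite ler_wpM2r//; first by rewrite exprn_ge0// ltW// invN_gt0.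
    by rewrite normrM ler_wpM2l.
  have ih : (leb n).-integrable setT (EFin \o (fun v => a * n%:R * psi (eps j *: v) * invN 1 v ^+ n.+2)).
    apply: (le_integrable measurableT _ _ (integrableZl measurableT (`|a * n%:R| * M) iP)).
      apply/measurable_EFinP; apply: measurable_funM => //; apply: measurable_funM => //.
      by apply: (measurableT_comp mpsi); exact: measurable_rvZ.
    by move=> v _ /=; rewrite lee_fin; apply: le_trans (bound v) (ler_norm _).
  rewrite -[RHS](@mulVKf _ (eps j ^+ n)); last by rewrite expf_neq0// gt_eqF.
  congr (_ * _); rewrite -RintegralZl//.
  congr Rintegral; apply/funext => v; rewrite subrr mul0r add0r invN_scale// exprMn.
  have aux (e q P : R) : e != 0 ->
      q * (a * (n%:R * e ^+ 2 * (e^-1 ^+ n.+2 * P))) = e ^- n * (a * n%:R * q * P).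
    move=> ne; have ne' : e ^+ n != 0 by rewrite expf_neq0.
    rewrite -[n.+2]addn2 exprD !exprVn; move: (e ^+ n) (n%:R : R) ne' => X N ne'; field.
    by rewrite ne ne'.
  by apply: aux; rewrite gt_eqF.
apply: (@cvg_integral_dominated _ _ n0 _ _ (fun v => `|a * n%:R| * M * invN 1 v ^+ n.+2)).
- move=> j; apply: measurable_funM => //; apply: measurable_funM => //.
  by apply: (measurableT_comp mpsi); exact: measurable_rvZ.
- exact: measurable_funM.
- move=> v v0; apply: cvgM; last exact: cvg_cst.
  apply: cvgM; first exact: cvg_cst.
  have c : (eps j *: v) @[j --> \oo] --> (0 : V).
    have := cvgZr_tmp (a := v) (@cvg_harmonic R); rewrite scale0r; exact.
  exact: (continuous_cvg _ (@Cc_cont _ _ _ _ psiC 0) c).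
- have := integrableZl measurableT (`|a * n%:R| * M) iP.
  by apply: eq_integrable.
- move=> j v _; rewrite normrM [X in _ * X]ger0_norm; last by rewrite exprn_ge0// ltW// invN_gt0.
  rewrite ler_wpM2r//; first by rewrite exprn_ge0// ltW// invN_gt0.
  by rewrite normrM ler_wpM2l.
Qed.

End chain_end.

Section chain_instances.
Context {R : realType} {n : nat}.
Hypothesis n0 : (0 < n)%N.
Local Notation V := 'rV[R]_n.
Local Notation eps j := (harmonic j : R).

(** Bounds the logarithm, also after regularisation, by functions whose local integrability is
    known. *)
Lemma abs_ln_le (t : R) : 0 < t -> `|ln t| <= t + t^-1.
Proof.
move=> t0; have ti : 0 < t^-1 by rewrite invr_gt0.
have h1 := ln_sublinear t0; have h2 := ln_sublinear ti; rewrite lnV// in h2.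
by rewrite ler_norml; apply/andP; split; lra.
Qed.

Lemma measurable_enormT : measurable_fun [set: V] (@enorm R n).
Proof. exact: (@measurable_enorm R n _ _ _ (@measurable_id _ V setT)). Qed.

Lemma locint_enorm : @locint R n (@enorm R n).
Proof.
apply: locint_bounded; first exact: measurable_enormT.
by move=> r; exists r => v vr; rewrite ger0_norm ?enorm_ge0// ltW.
Qed.

Lemma locint_enormV : (1 < n)%N -> @locint R n (fun z => (enorm z)^-1).
Proof. by move=> n1; have := @locint_expV R n n0 1 n1; exact. Qed.

Lemma locint_ln : (1 < n)%N -> @locint R n (fun z => ln (enorm z)).
Proof.
move=> n1; apply: (le_locint (locintD locint_enorm (locint_enormV n1))).
  by apply: (measurableT_comp (@measurable_ln R)); exact: measurable_enormT.
move=> v; have [->|v0] := eqVneq v 0.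
  by rewrite enorm0 ln0// normr0 invr0 addr0.
by apply: abs_ln_le; rewrite enorm_gt0.
Qed.

Variables (rho : R) (psi : V -> R).
Hypothesis psiC : Cc rho psi.

Lemma laplacian_chain_pow q : (q.+2 < n)%N ->
  \int[leb n]_z (laplacian psi z * enorm z ^- q) =
  - q%:R * (n%:R - q.+2%:R) * \int[leb n]_z (psi z * enorm z ^- q.+2).
Proof.
move=> qn; have qn' : (q < n)%N by rewrite ltnW// ltnW.
have iq := @locint_expV R n n0 q qn'.
apply: (@chain_step R n n0 rho psi psiC (fun j z => invN (eps j) z ^+ q) _ (fun z => enorm z ^- q)) => //.
- by move=> j; exact: smooth_invNX (eps_gt0 j).
- by move=> j w z; exact: derive_invNX (eps_gt0 j).
- by case: iq.
- move=> z z0; rewrite -exprVn.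
  exact: (continuous_cvg _ (@exprn_continuous R q (enorm z)^-1) (cvg_invN z0)).
- move=> j z z0; rewrite ger0_norm; last by rewrite exprn_ge0// ltW// invN_gt0// eps_gt0.
  rewrite -exprVn; apply: lerXn2r; rewrite ?nnegrE ?invr_ge0 ?enorm_ge0 ?sqrtr_ge0//.
  exact: invN_le z0 (eps_gt0 j).
Qed.

Lemma laplacian_chain_end q : q.+2 = n ->
  \int[leb n]_z (laplacian psi z * enorm z ^- q) = - q%:R * @area R n * psi 0.
Proof.
move=> qn; have qn' : (q < n)%N by rewrite -qn ltnW.
have iq := @locint_expV R n n0 q qn'.
apply: (@chain_last R n n0 rho psi psiC (fun j z => invN (eps j) z ^+ q) (fun z => enorm z ^- q) (fun z => enorm z ^- q)) => //.
- by move=> j; exact: smooth_invNX (eps_gt0 j).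
- by move=> j w z; rewrite (derive_invNX q w z (eps_gt0 j)) qn.
- by case: iq.
- move=> z z0; rewrite -exprVn.
  exact: (continuous_cvg _ (@exprn_continuous R q (enorm z)^-1) (cvg_invN z0)).
- move=> j z z0; rewrite ger0_norm; last by rewrite exprn_ge0// ltW// invN_gt0// eps_gt0.
  rewrite -exprVn; apply: lerXn2r; rewrite ?nnegrE ?invr_ge0 ?enorm_ge0 ?sqrtr_ge0//.
  exact: invN_le z0 (eps_gt0 j).
Qed.

Lemma laplacian_chain_norm : (1 < n)%N ->
  \int[leb n]_z (laplacian psi z * enorm z) =
  (n%:R - 1) * \int[leb n]_z (psi z * enorm z ^- 1).
Proof.
move=> n1; rewrite -[(n%:R - 1)]mul1r.
apply: (@chain_step R n n0 rho psi psiC (fun j => regN (eps j)) (@enorm R n) (fun z => enorm z + 1) 1 1) => //.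
- by move=> j; exact: smooth_regN (eps_gt0 j).
- by move=> j w z; exact: derive_regN (eps_gt0 j).
- exact: measurable_enormT.
- move=> z z0; rewrite (_ : (fun j => _) = fun j => Num.sqrt (dotv z z + eps j ^+ 2)).
    exact: cvg_sqrt_regularized.
  by apply/funext => j; exact: regNE (eps_gt0 j).
- move=> j z z0; rewrite regNE ?eps_gt0// ger0_norm ?sqrtr_ge0//.
  exact: sqrt_regularized_le (eps_gt0 j) (eps_le1 j).
- exact: locintD locint_enorm (locint_cst 1).
Qed.

Lemma laplacian_chain_ln : (2 < n)%N ->
  \int[leb n]_z (laplacian psi z * ln (enorm z)) =
  (n%:R - 2) * \int[leb n]_z (psi z * enorm z ^- 2).
Proof.
move=> n2; rewrite -[(n%:R - 2)]mul1r; have n1 : (1 < n)%N by exact: ltnW.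
have lnE (j : nat) (z : V) : lnN (eps j) z = ln (Num.sqrt (dotv z z + eps j ^+ 2)).
  have N0 : 0 < dotv z z + eps j ^+ 2 by exact: N2_gt0 (eps_gt0 j).
  rewrite /lnN -{1}(sqr_sqrtr (ltW N0)) lnXn ?sqrtr_gt0// mulr2n; by field.
apply: (@chain_step R n n0 rho psi psiC (fun j => lnN (eps j)) (fun z => ln (enorm z))
   (fun z => (enorm z + 1) + (enorm z)^-1) 1 2) => //.
- by move=> j; exact: smooth_lnN (eps_gt0 j).
- by move=> j w z; have [_ ->] := lnN_derive w z (eps_gt0 j).
- by case: (locint_ln n1).
- move=> z z0; rewrite (_ : (fun j => _) = fun j => ln (Num.sqrt (dotv z z + eps j ^+ 2))).
    by apply: continuous_cvg; [apply: continuous_ln; rewrite enorm_gt0|exact: cvg_sqrt_regularized].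
  by apply/funext => j; exact: lnE.
- move=> j z z0; rewrite lnE.
  have N0 : 0 < dotv z z + eps j ^+ 2 by exact: N2_gt0 (eps_gt0 j).
  apply: le_trans (abs_ln_le _) _; first by rewrite sqrtr_gt0.
  apply: lerD; first exact: sqrt_regularized_le (eps_gt0 j) (eps_le1 j).
  exact: invN_le z0 (eps_gt0 j).
- exact: locintD (locintD locint_enorm (locint_cst 1)) (locint_enormV n1).
Qed.

Lemma derive_translate y w z : 'D_w (fun z => psi (y + z)) z = 'D_w psi (y + z).
Proof.
rewrite !derive_line; congr (derive1 _ 0); apply/funext => t; by rewrite addrA.
Qed.

End chain_instances.

Lemma laplacian_translate {R : realType} {n : nat} (psi : 'rV[R]_n -> R) y :
  laplacian (fun z => psi (y + z)) = fun z => laplacian psi (y + z).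
Proof.
apply/funext => z; apply: eq_bigr => i _.
rewrite (_ : 'D_(ebasis R i) (fun z => psi (y + z)) = fun z => 'D_(ebasis R i) psi (y + z)).
  exact: derive_translate.
by apply/funext => x; exact: derive_translate.
Qed.

(** * Logarithmic kernels *)

Section ln_line.
Context {R : realType}.
Local Notation L := (@lebesgue_measure R).

Lemma integral_invr_tail (s : R) : 0 < s -> s < 1 ->
  (\int[L]_t (t^-1 * posr (t - s) * posr (1 - t))%:E = (- ln s)%:E)%E.
Proof.
move=> s0 s1; have d x : s <= x <= 1 -> is_derive x 1 (@ln R) x^-1.
  by move=> /andP[sx _]; apply: is_derive1_ln; exact: lt_le_trans sx.
rewrite (integral_itv_FTC s1 _ d) ?ln1 ?sub0r//.
apply: continuous_in_subspaceT => t; rewrite inE /= in_itv /= => /andP[st _].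
by apply: cvgV; [rewrite gt_eqF// (lt_le_trans s0)|exact: cvg_id].
Qed.

(* - ln |s| is the integral of 1/t over |s| < t < 1; swap the two integrals. *)
Lemma integral_ln_unit :
  (\int[L]_s (- ln `|s| * posr `|s| * posr (1 - `|s|))%:E < +oo)%E.
Proof.
pose g (p : R * R) : R := posr `|p.1| * (p.2^-1 * posr (p.2 - `|p.1|) * posr (1 - p.2)).
have g0 p : 0 <= g p.
  rewrite /g !posrE; case: ltP => // h; last by rewrite mul0r.
  case: ltP => h2; last by rewrite mulr0 mul0r mulr0.
  by rewrite !mulr_ge0// invr_ge0 ltW// (lt_trans h)// -subr_gt0.
have m1 : measurable_fun [set: measurableTypeR R * measurableTypeR R] (fun p => `|p.1| : R).
  by apply: (measurableT_comp (@normr_measurable R setT)); exact: measurable_fst.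
have mg : measurable_fun [set: measurableTypeR R * measurableTypeR R] (EFin \o g).
  apply/measurable_EFinP; apply: measurable_funM; first exact: measurable_posr_comp.
  apply: measurable_funM; last by apply: measurable_posr_comp; apply: measurable_funB.
  apply: measurable_funM; last by apply: measurable_posr_comp; apply: measurable_funB.
  by apply: (measurableT_comp (@measurable_inv R)).
have -> : (\int[L]_s (- ln `|s| * posr `|s| * posr (1 - `|s|))%:E =
    \int[L]_s \int[L]_t (EFin \o g) (s, t))%E.
  apply: eq_integral => s _.
  rewrite /= /g /= !posrE; case: ltP => s0; last first.
    by rewrite mulr0 mul0r; under eq_integral => t _ do rewrite mul0r; rewrite integral0.
  under eq_integral => t _ do rewrite mul1r.
  rewrite subr_gt0; case: ltP => s1; last first.
    rewrite mulr0 integral0_eq// => t _; rewrite !posrE !subr_gt0.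
    case: ltP => h; last by rewrite mulr0 mul0r.
    by rewrite ltNge (le_trans s1 (ltW h)) mulr0.
  by rewrite integral_invr_tail// !mulr1.
rewrite (@fubini_tonelli _ _ _ _ R L L _ mg) //.
apply: (@le_lt_trans _ _ (\int[L]_t (2 * \1_(`[0%R, 1%R]%classic : set R) t)%:E)%E).
  apply: ge0_le_integral => //.
  - by move=> t _; apply: integral_ge0 => s _; rewrite lee_fin.
  - exact: (@measurable_fun_fubini_tonelli_G _ _ _ _ R L (EFin \o g) mg (fun p => g0 p)).
  - by apply/measurable_EFinP; apply: measurable_funM.
  move=> t _.
  have [t0|t0] := leP t 0.
    rewrite integral0_eq ?lee_fin ?mulr_ge0// => s _.
    rewrite /= /g /= (posrE (t - _)) subr_gt0 ltNge (le_trans t0 (normr_ge0 s)).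
    by rewrite mulr0 mul0r mulr0.
  have [t1|t1] := leP 1 t.
    rewrite integral0_eq ?lee_fin ?mulr_ge0// => s _.
    by rewrite /= /g /= (posrE (1 - _)) subr_gt0 ltNge t1 !mulr0.
  rewrite indicE mem_set /=; last by rewrite in_itv /= !ltW.
  apply: (@le_trans _ _ (\int[L]_s (t^-1 * \1_(`[(- t)%R, t]%classic : set R) s)%:E)%E).
    apply: ge0_le_integral => //.
    - by move=> s _; rewrite lee_fin.
    - exact: (measurableT_comp mg (measurable_fun_pair (@measurable_id _ (measurableTypeR R) setT) (measurable_cst _))).
    - by apply/measurable_EFinP; apply: measurable_funM.
    move=> s _; rewrite lee_fin /g /= !posrE !subr_gt0 t1 mulr1.
    case: (ltP `|s| t) => st; last by rewrite mulr0 mulr0 mulr_ge0// invr_ge0 ltW.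
    rewrite indicE mem_set /=; last by rewrite in_itv /= -ler_norml ltW.
    by rewrite !mulr1; case: (0 < _); rewrite ?mul1r// mul0r invr_ge0 ltW.
  rewrite (integral_indicM _ _ (fun=> _)) integral_cst//= lebesgue_measure_itv /=.
  rewrite lte_fin gtrN// -EFinB -EFinM lee_fin.
  have -> : t^-1 * (t - - t) = 2 by field; rewrite gt_eqF.
  by rewrite mulr1.
rewrite (integral_indicM _ _ (fun=> _)) integral_cst//= lebesgue_measure_itv /=.
by rewrite lte_fin ltr01 -EFinB -EFinM ltry.
Qed.

(** Where |s| < 1 the integrand is - ln |s|, integrable by [integral_ln_unit]; where 1 <= |s| < r it
    is at most |s|, hence at most r. *)
Lemma integral_ln_line (r : R) : 0 < r ->
  (\int[L]_s (`|ln `|s| | * posr (r - `|s|))%:E < +oo)%E.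
Proof.
move=> r0.
have mn : measurable_fun [set: R] (fun s : R => `|s|) := @normr_measurable R setT.
have mln : measurable_fun [set: R] (fun s : R => ln `|s|).
  exact: (measurableT_comp (@measurable_ln R)).
have m1 : measurable_fun [set: R] (fun s : R => - ln `|s| * posr `|s| * posr (1 - `|s|)).
  apply: measurable_funM; last by apply: measurable_posr_comp; exact: measurable_funB.
  by apply: measurable_funM; [exact: measurable_funN|exact: measurable_posr_comp].
have p1 (s : R) : 0 <= - ln `|s| * posr `|s| * posr (1 - `|s|).
  rewrite !posrE; case: ltP => s0; last by rewrite mulr0 mul0r.
  case: ltP => s1; last by rewrite mulr0.
  by rewrite !mulr1 oppr_ge0 ln_le0// ltW// -subr_gt0.
apply: (@le_lt_trans _ _ (\int[L]_s ((- ln `|s| * posr `|s| * posr (1 - `|s|))%:E +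
    (r * \1_(`[(- r)%R, r]%classic : set R) s)%:E))%E).
  apply: ge0_le_integral => //.
  - by move=> s _; rewrite lee_fin mulr_ge0// posr_ge0.
  - apply/measurable_EFinP; apply: measurable_funM; first exact: measurableT_comp.
    by apply: measurable_posr_comp; exact: measurable_funB.
  - by apply: emeasurable_funD; apply/measurable_EFinP => //; exact: measurable_funM.
  suff key (s : R) : `|ln `|s| | * posr (r - `|s|) <=
      - ln `|s| * posr `|s| * posr (1 - `|s|) + r * \1_(`[(- r)%R, r]%classic : set R) s.
    by move=> s _; rewrite -EFinD lee_fin.
  rewrite [X in _ * X <= _]posrE subr_gt0.
  have [sr|sr] := ltP `|s| r; last by rewrite mulr0 addr_ge0// mulr_ge0// ltW.
  rewrite indicE mem_set /=; last by rewrite in_itv /= -ler_norml ltW.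
  rewrite !mulr1 !posrE subr_gt0.
  have [s0|s0] := ltP 0 `|s|; last by rewrite mulr0 mul0r add0r ln0// normr0 ltW.
  have [s1|s1] := ltP `|s| 1.
    rewrite !mulr1 ler0_norm; first by rewrite lerDl ltW.
    by apply: ln_le0; exact: ltW.
  by rewrite mulr0 add0r ger0_norm ?ln_ge0// ltW// (lt_trans (ln_sublinear s0)).
rewrite ge0_integralD//; last 3 first.
- exact/measurable_EFinP.
- by move=> s _; rewrite lee_fin mulr_ge0// ltW.
- by apply/measurable_EFinP; exact: measurable_funM.
rewrite lte_add_pinfty ?integral_ln_unit//.
rewrite (integral_indicM _ _ (fun=> _)) integral_cst//= lebesgue_measure_itv /=.
by rewrite lte_fin gtrN// -EFinB -EFinM ltry.
by move=> s _; rewrite lee_fin.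
Qed.

(** The singular set is a hyperplane and not a point, so polar coordinates do not help; instead the
    ball is enclosed in an interval times a cube, over which the integral factorises. *)
Lemma locint_ln_head m : @locint R m.+1 (fun z => ln `|rhead z|).
Proof.
have mh := @measurable_rhead R m.
have mn : measurable_fun [set: R] (fun s : R => `|s|) := @normr_measurable R setT.
have mln : measurable_fun [set: R] (fun s : R => ln `|s|).
  exact: (measurableT_comp (@measurable_ln R)).
have mlnh : measurable_fun [set: 'rV[R]_m.+1] (fun z : 'rV[R]_m.+1 => ln `|rhead z|).
  exact: (measurableT_comp mln mh).
split => // r0; apply/integrableP; split; first by apply/measurable_EFinP; exact: measurable_funTS.
have [r rr r_gt0] : exists2 r : R, r0 <= r & 0 < r.
  by exists (Num.max r0 1); rewrite ?le_max ?lexx// lt_max ltr01 orbT.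
have mcube := @measurable_cube R m r.
pose f (z : 'rV[R]_m.+1) : R := `|ln `|rhead z| | * posr (r - `|rhead z|) * \1_(@cube R m r) (rtail z).
have mf : measurable_fun [set: 'rV[R]_m.+1] f.
  apply: measurable_funM.
    apply: measurable_funM; first exact: (measurableT_comp mn mlnh).
    by apply: measurable_posr_comp; apply: measurable_funB => //; exact: (measurableT_comp mn mh).
  apply: (measurableT_comp (measurable_indic mcube)); exact: measurable_rtail.
have f0 z : 0 <= f z by rewrite /f !mulr_ge0// posr_ge0.
apply: (@le_lt_trans _ _ (\int[leb m.+1]_z (f z)%:E)%E).
  rewrite integral_mkcond; apply: ge0_le_integral => //.
  - by move=> z _; rewrite patchE; case: ifPn.
  - apply/(measurable_restrictT _ (@measurable_eball R _ r0)).
    by apply: measurable_funTS; apply/measurable_EFinP; exact: (measurableT_comp mn mlnh).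
  - exact/measurable_EFinP.
  move=> z _; rewrite patchE; case: ifPn => [|_]; last by rewrite lee_fin.
  rewrite inE /eball /= => zr; rewrite lee_fin /f.
  have zr' : enorm z < r by exact: lt_le_trans rr.
  rewrite posrE subr_gt0 (le_lt_trans (coord_le_enorm z 0) zr') mulr1.
  rewrite indicE mem_set /=; first by rewrite mulr1.
  by move=> i; rewrite mxE; apply: le_trans (coord_le_enorm z _) (ltW zr').
rewrite ge0_integral_lebS//; last exact/measurable_EFinP.
rewrite (_ : (\int[L]_s _)%E = \int[L]_s ((`|ln `|s| | * posr (r - `|s|))%:E * ((2 * r) ^+ m)%:E))%E; last first.
  apply: eq_integral => s _.
  rewrite -(leb_cube m (ltW r_gt0)) -(setIT (@cube R m r)) -integral_indic//.
  rewrite -ge0_integralZlT//; last 2 first.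
  - exact/measurable_EFinP/measurable_indic.
  - by rewrite lee_fin mulr_ge0// posr_ge0.
  by apply: eq_integral => v _; rewrite /f rhead_rcons0 rtail_rcons0.
rewrite ge0_integralZrT//; last 2 first.
- by move=> s; rewrite lee_fin mulr_ge0// posr_ge0.
- by rewrite lee_fin exprn_ge0// mulr_ge0// ltW.
rewrite muleC; apply: lte_mul_pinfty => //; last exact: integral_ln_line.
  by rewrite lee_fin exprn_ge0// mulr_ge0// ltW.
apply/measurable_EFinP; apply: measurable_funM; first exact: (measurableT_comp mn mln).
by apply: measurable_posr_comp; exact: measurable_funB.
Qed.

End ln_line.

Section rotation_locint.
Context {R : realType} {k : nat}.
Local Notation V := 'rV[R]_k.

Lemma measurable_rotation (O : 'M[R]_k) : measurable_fun [set: V] (fun z : V => z *m O).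
Proof. exact: measurable_mulmx. Qed.

Lemma abs_integral_eball_rotation (K : V -> R) (O : 'M[R]_k) r : O *m O^T = 1%:M ->
  measurable_fun [set: V] K ->
  (\int[leb k]_(z in @eball R k r) `|K (z *m O)|%:E = \int[leb k]_(z in @eball R k r) `|K z|%:E)%E.
Proof.
move=> HO mK; rewrite integral_mkcond [RHS]integral_mkcond.
rewrite -(ge0_integral_rotation HO (f := ((fun z => `|K z|%:E) \_ (@eball R k r)))); last 2 first.
- apply/(measurable_restrictT _ (@measurable_eball R _ r)); apply: measurable_funTS.
  by apply/measurable_EFinP; exact: (measurableT_comp (@normr_measurable R setT)).
- by move=> z; rewrite patchE; case: ifPn => // _; rewrite lee_fin.
apply: eq_integral => z _; rewrite !patchE.
suff -> : (z *m O \in @eball R k r) = (z \in @eball R k r) by [].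
by apply/idP/idP; rewrite !inE /eball /= enorm_orth.
Qed.

Lemma locint_rotation (K : V -> R) (O : 'M[R]_k) : O *m O^T = 1%:M ->
  locint K -> locint (fun z => K (z *m O)).
Proof.
move=> HO [mK iK]; have mKO := measurableT_comp mK (measurable_rotation O).
split => // r; apply/integrableP; split; first by apply/measurable_EFinP; exact: measurable_funTS.
have := abs_integral_eball_rotation r HO mK => /= ->.
by have /integrableP[] := iK r.
Qed.

Lemma locint_abs (K : V -> R) : locint K -> locint (fun z => `|K z|).
Proof.
move=> [mK iK]; split; first exact: (measurableT_comp (@normr_measurable R setT)).
by move=> r; exact: (integrable_norm (iK r)).
Qed.

End rotation_locint.

(** * Pairing the Radon transform with a function of one variable *)

Section frames.
Context {R : realType} {m : nat}.
Local Notation V := 'rV[R]_m.+1.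

Lemma row0_orth (O : 'M[R]_m.+1) : O *m O^T = 1%:M -> enorm (row 0 O) = 1.
Proof.
by move=> HO; rewrite row_frame0 enorm_orth// enorm_rcons0 expr1n enorm0 expr0n addr0 sqrtr1.
Qed.

Lemma exists_frame (theta : V) : enorm theta = 1 ->
  exists O : 'M[R]_m.+1, O *m O^T = 1%:M /\ row 0 O = theta.
Proof.
move=> t1; have e1 : enorm (rcons0 (1, 0 : 'rV[R]_m)) = 1.
  by rewrite enorm_rcons0 expr1n enorm0 expr0n addr0 sqrtr1.
have [Q [HQ QE]] := exists_orthogonal e1 t1.
by exists Q; split => //; rewrite row_frame0.
Qed.

Lemma rhead_frame (O : 'M[R]_m.+1) z : rhead (z *m O^T) = dotv (row 0 O) z.
Proof.
by rewrite /rhead dotvC dotvE mxE; apply: eq_bigr => i _; rewrite !mxE.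
Qed.

Lemma trmx_orth (O : 'M[R]_m.+1) : O *m O^T = 1%:M -> O^T *m (O^T)^T = 1%:M.
Proof. by move=> HO; rewrite trmxK; exact: orthogonal_trmx. Qed.

Lemma locint_dotv (k : R -> R) theta : enorm theta = 1 ->
  locint (fun z : V => k (rhead z)) -> locint (fun z : V => k (dotv theta z)).
Proof.
move=> /exists_frame[Q [HQ QE]] ik.
have := locint_rotation (trmx_orth HQ) ik.
rewrite (_ : (fun z => _) = fun z => k (dotv theta z)) //.
by apply/funext => z; rewrite rhead_frame QE.
Qed.

(** Fubini in the coordinates (t, v) -> (t, v) O, in which theta.z is the first coordinate. Local
    integrability is asked of k in the first coordinate only; rotation invariance transports it to
    theta.z. *)
Lemma radon_pairing (O : 'M[R]_m.+1) (rho : R) (chi : V -> R) (k : R -> R) :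
  O *m O^T = 1%:M -> Cc rho chi -> locint (fun z : V => k (rhead z)) ->
  \int[@lebesgue_measure R]_t (radon O chi t * k t) =
  \int[leb m.+1]_z (chi z * k (dotv (row 0 O) z)).
Proof.
move=> HO H ik.
have ikd := locint_dotv (row0_orth HO) ik.
have iF := locint_Cc ikd H.
have mF : measurable_fun [set: V] (EFin \o (fun z => chi z * k (dotv (row 0 O) z))).
  by have /integrableP[] := iF.
have [M HM] : exists M : R, forall y, `|chi y| <= M := Cc_bounded H.
have mchi : measurable_fun [set: V] chi by exact: continuous_measurable_rv (Cc_cont H).
have hO (z : V) : dotv (row 0 O) (z *m O) = rhead z.
  by rewrite -rhead_frame -mulmxA HO mulmx1.
have iG : (leb m.+1).-integrable setT (EFin \o (fun z : V => chi (z *m O) * k (rhead z))).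
  apply: (@locint_mul _ _ _ _ M (rho + 1)) => //.
    exact: (measurableT_comp mchi (measurable_rotation O)).
  by move=> v hv; apply: (proj2 H); rewrite enorm_orth//; lra.
transitivity (\int[leb m.+1]_z (chi (z *m O) * k (rhead z))); last first.
  rewrite /Rintegral; congr fine; rewrite -(integral_rotation HO mF).
  by apply: eq_integral => z _ /=; rewrite hO.
have iS (s : R) : (leb m).-integrable setT (EFin \o (fun v : 'rV[R]_m => chi (rcons0 (s, v) *m O) * k s)).
  have := integrableZl measurableT (k s) (integrable_radon HO s H).
  by apply: eq_integrable => // v _ /=; rewrite mulrC EFinM.
rewrite Rintegral_lebS//; last first.
  move=> s; have := iS s; apply: eq_integrable => // v _ /=.
  by rewrite rhead_rcons0.
congr Rintegral; apply/funext => t.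
have iR := integrable_radon HO (t : R) H.
rewrite /radon mulrC -RintegralZl//.
by congr Rintegral; apply/funext => v; rewrite rhead_rcons0 mulrC.
Qed.

(** The component of y along theta shifts t, and its tangential part is absorbed by a translation of
    the hyperplane coordinates. *)
Lemma radon_translate (O : 'M[R]_m.+1) (rho : R) (chi : V -> R) y t :
  O *m O^T = 1%:M -> Cc rho chi ->
  radon O (fun z => chi (y + z)) t = radon O chi (dotv (row 0 O) y + t).
Proof.
move=> HO H; rewrite /radon /Rintegral; congr fine.
pose yO := y *m O^T.
have yE : y = rcons0 (dotv (row 0 O) y, rtail yO) *m O.
  rewrite -rhead_frame rcons0K /yO -mulmxA orthogonal_trmx ?mulmx1//.
pose g v := (chi (rcons0 (dotv (row 0 O) y + t, v) *m O))%:E.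
have mchi : measurable_fun [set: V] chi by exact: continuous_measurable_rv (Cc_cont H).
rewrite -(@integral_translation _ _ (rtail yO) g); last first.
  apply/measurable_EFinP; apply: (measurableT_comp mchi).
  apply: measurable_mulmx; apply: (measurableT_comp (@measurable_rcons0 R m)).
  exact: measurable_fun_pair.
apply: eq_integral => v _ /=; rewrite /g; congr (chi _)%:E.
by rewrite {1}yE -mulmxDl -rcons0D [rtail yO + v]addrC.
Qed.

End frames.

(** * Averaging over directions *)

Section spherical_fubini.
Context {R : realType} {m : nat}.
Hypothesis m0 : (0 < m)%N.
Local Notation V := 'rV[R]_m.+1.
Variables (rho : R) (chi : V -> R) (k : R -> R) (kbar : V -> R).
Hypothesis chiC : Cc rho chi.
Hypothesis mk : measurable_fun [set: R] k.
Hypothesis ik : locint (fun z : V => k (rhead z)).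
Hypothesis mkbar : measurable_fun [set: V] kbar.
Hypothesis iks : forall z : V, z != 0 ->
  (@sphm R m.+1).-integrable setT (fun theta => (k (dotv theta z))%:E).
Hypothesis kbarE : forall z : V, z != 0 ->
  (\int[@sphm R m.+1]_theta (k (dotv theta z))%:E = (kbar z)%:E)%E.

Let F (p : V * V) : \bar R := (chi p.2 * k (dotv p.1 p.2))%:E.

Let mchi : measurable_fun [set: V] chi.
Proof. exact: continuous_measurable_rv (Cc_cont chiC). Qed.

Let mF : measurable_fun [set: V * V] F.
Proof.
apply/measurable_EFinP; apply: measurable_funM.
  exact: (measurableT_comp mchi measurable_snd).
by apply: (measurableT_comp mk); apply: measurable_dotv.
Qed.

Let iFz theta : enorm theta = 1 ->
  (leb m.+1).-integrable setT (EFin \o (fun z => chi z * k (dotv theta z))).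
Proof. by move=> t1; exact: locint_Cc (locint_dotv t1 ik) chiC. Qed.

(** The ball is rotation invariant, so the integral of |k (theta.z)| over it is the same for every
    theta. This uniform bound gives integrability on the product with the finite measure [sphm], as
    well as the boundedness on the sphere that [sphIntE] asks for. *)
Let bound : exists2 C : R, 0 <= C & forall theta, enorm theta = 1 ->
  (\int[leb m.+1]_z `|F (theta, z)| <= C%:E)%E.
Proof.
have [M HM] : exists M : R, forall y, `|chi y| <= M := Cc_bounded chiC.
have M0 : 0 <= M by exact: le_trans (normr_ge0 _) (HM 0).
have mB := @measurable_eball R m.+1 (rho + 1).
pose I := (\int[leb m.+1]_(z in @eball R m.+1 (rho + 1)) `|k (rhead z)|%:E)%E.
have I0 : (0 <= I)%E by apply: integral_ge0 => z _; rewrite lee_fin.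
have Ify : (I < +oo)%E by have /integrableP[] := (proj2 ik) (rho + 1).
exists (M * fine I); first by rewrite mulr_ge0// fine_ge0.
move=> theta t1.
have mkt : measurable_fun [set: V] (fun z : V => k (dotv theta z)) := proj1 (locint_dotv t1 ik).
have IE : I = (\int[leb m.+1]_(z in @eball R m.+1 (rho + 1)) `|k (dotv theta z)|%:E)%E.
  have [Q [HQ QE]] := exists_frame t1.
  rewrite /I -(abs_integral_eball_rotation _ (trmx_orth HQ) (proj1 ik)).
  by apply: eq_integral => z _; rewrite rhead_frame QE.
rewrite EFinM fineK; last by rewrite ge0_fin_numE.
rewrite IE [in leRHS]integral_mkcond -ge0_integralZlT; last 3 first.
- apply/(measurable_restrictT _ mB); apply: measurable_funTS; apply/measurable_EFinP.
  exact: (measurableT_comp (@normr_measurable R setT)).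
- by move=> z; rewrite patchE; case: ifPn => // _; rewrite lee_fin.
- by rewrite lee_fin.
apply: ge0_le_integral => //.
- apply: (measurableT_comp (@abse_measurable R setT)).
  apply/measurable_EFinP; exact: measurable_funM.
- apply: emeasurable_funM => //.
  apply/(measurable_restrictT _ mB); apply: measurable_funTS; apply/measurable_EFinP.
  exact: (measurableT_comp (@normr_measurable R setT)).
move=> z _; rewrite patchE; case: ifPn => [_|/negP zr].
  by rewrite /F /= -EFinM lee_fin normrM ler_wpM2r.
rewrite mule0 /F /= (proj2 chiC) ?mul0r ?normr0//.
have : ~ (enorm z < rho + 1) by move=> h; apply: zr; rewrite inE.
by move/negP; rewrite -leNgt; lra.
Qed.

Let iF : ((@sphm R m.+1) \x (leb m.+1))%E.-integrable setT F.
Proof.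
apply/(integrable12ltyP _ _ mF).
have [C C0 HC] := bound.
have mFa : measurable_fun [set: V * V] (fun p => `|F p|%E).
  exact: (measurableT_comp (@abse_measurable R setT)).
have mI := @measurable_fun_fubini_tonelli_F _ _ _ _ R (leb m.+1) (fun p : V * V => `|F p|%E) mFa (fun p => abse_ge0 _).
rewrite sphm_integral_on//.
apply: (@le_lt_trans _ _ (\int[@sphm R m.+1]_(theta in @usphere R m.+1) C%:E)%E).
  apply: ge0_le_integral => //.
  - exact: measurable_usphere.
  - by move=> theta _; apply: integral_ge0 => z _; exact: abse_ge0.
  - exact: measurable_funTS.
rewrite integral_cst; last exact: measurable_usphere.
rewrite lte_mul_pinfty ?lee_fin//.
apply: (@le_lt_trans _ _ (@sphm R m.+1 setT)); last by rewrite -areaE ltry.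
by apply: le_measure; rewrite ?inE//; exact: measurable_usphere.
Qed.

Lemma sphInt_fubini :
  sphInt (fun theta => \int[leb m.+1]_z (chi z * k (dotv theta z))) =
  \int[leb m.+1]_z (chi z * kbar z).
Proof.
have [C C0 HC] := bound.
have mG : measurable_fun [set: V] (fun theta : V => \int[leb m.+1]_z F (theta, z))%E.
  exact: (measurable_fubini_F iF).
have finI theta : enorm theta = 1 -> ((\int[leb m.+1]_z F (theta, z)) \is a fin_num)%E.
  move=> t1; exact: (integrable_fin_num measurableT (iFz t1)).
rewrite (@sphIntE _ _ _ C) //; last 2 first.
- by apply: (measurableT_comp (@fine_measurable R setT measurableT)).
- move=> theta t1.
  have /integrableP[mFt _] := iFz t1.
  have := HC _ t1; have := le_abse_integral (leb m.+1) measurableT mFt.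
  move=> h1 h2; have := le_trans h1 h2.
  rewrite -[X in (`|X| <= _)%E](fineK (finI _ t1)) /= lee_fin; exact.
rewrite /Rintegral; congr fine.
transitivity (\int[@sphm R m.+1]_theta \int[leb m.+1]_z F (theta, z))%E.
  apply: integral_sphm_eq_on => //.
    apply/measurable_EFinP.
    by apply: (measurableT_comp (@fine_measurable R setT measurableT)).
  by move=> theta t1; rewrite fineK//; exact: finI.
rewrite (Fubini iF).
apply: integral_eq_off0 => //.
- exact: (measurable_fubini_G iF).
- by apply/measurable_EFinP; exact: measurable_funM.
move=> z z0; rewrite /F /= EFinM -kbarE// -integralZl//; last exact: iks.
Qed.

End spherical_fubini.

Section second_derivative_abs.
Context {R : realType}.
Local Notation L := (@lebesgue_measure R).

(** On t > 0 the function t g'' has the primitive t g' - g, on t < 0 the opposite holds; the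
    boundary terms at B and - B vanish, so each half contributes g 0. *)
Lemma integral_second_derivative_abs (g g1 g2 : R -> R) (B : R) : 0 < B ->
  (forall t : R, is_derive t 1 g (g1 t)) -> (forall t : R, is_derive t 1 g1 (g2 t)) ->
  continuous g2 -> (forall t, B <= `|t| -> g t = 0) -> (forall t, B <= `|t| -> g1 t = 0) ->
  (forall t, B <= `|t| -> g2 t = 0) ->
  \int[L]_t (g2 t * `|t|) = 2 * g 0.
Proof.
move=> B0 dg dg1 cg2 g0 g10 g20.
have cf : continuous (fun t : R => g2 t * `|t|).
  by apply: cont_mul => //; exact: norm_continuous.
have mf : measurable_fun [set: R] (fun t : R => g2 t * `|t|) by exact: continuous_measurable_fun.
have iF : L.-integrable `[- B, B]%classic (EFin \o (fun t : R => g2 t * `|t|)).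
  apply: continuous_compact_integrable; first exact: segment_compact.
  exact: continuous_subspaceT.
have dP (t : R) : is_derive t 1 (fun t : R => t * g1 t - g t) (t * g2 t).
  have h := is_deriveB (is_deriveM (is_derive_id t 1) (dg1 t)) (dg t).
  by apply: (is_derive_eq h); rewrite /GRing.scale /=; ring.
have dQ (t : R) : is_derive t 1 (fun t : R => g t - t * g1 t) (- t * g2 t).
  have h := is_deriveB (dg t) (is_deriveM (is_derive_id t 1) (dg1 t)).
  by apply: (is_derive_eq h); rewrite /GRing.scale /=; ring.
have LR (h h' : R -> R) (a b : R) : (forall t : R, is_derive t 1 h (h' t)) ->
    derivable_oo_LRcontinuous h a b.
  move=> dh; have ch : continuous h.
    move=> x; apply: (@differentiable_continuous _ _ _ x h).
    by apply/derivable1_diffP; have [] := dh x.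
  split; first by move=> x _; have [] := dh x.
    by apply: cvg_at_right_filter; exact: ch.
  by apply: cvg_at_left_filter; exact: ch.
have E1 : (\int[L]_(t in `[(- B)%R, 0%R]) (g2 t * `|t|)%:E = (g 0)%:E)%E.
  rewrite (@continuous_FTC2 _ _ (fun t : R => g t - t * g1 t)) ?oppr_lt0//.
  - have nB : B <= `|- B| by rewrite normrN ger0_norm// ltW.
    by rewrite mul0r subr0 (g0 _ nB) (g10 _ nB) mulr0 subr0 sube0.
  - exact: continuous_subspaceT.
  - exact: LR dQ.
  - move=> t; rewrite in_itv /= => /andP[_ t0]; rewrite derive1E.
    by have [_ ->] := dQ t; rewrite ltr0_norm// mulrC.
have E2 : (\int[L]_(t in `[0%R, B]) (g2 t * `|t|)%:E = (g 0)%:E)%E.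
  rewrite (@continuous_FTC2 _ _ (fun t : R => t * g1 t - g t))//.
  - have nB : B <= `|B| by rewrite ger0_norm// ltW.
    by rewrite mul0r sub0r (g0 _ nB) (g10 _ nB) mulr0 subr0 sub0e EFinN oppeK.
  - exact: continuous_subspaceT.
  - exact: LR dP.
  - move=> t; rewrite in_itv /= => /andP[t0 _]; rewrite derive1E.
    by have [_ ->] := dP t; rewrite gtr0_norm// mulrC.
have UE : `[- B, B]%classic = `[- B, 0]%classic `|` `]0, B]%classic :> set R.
  apply/seteqP; split => t /=; rewrite !in_itv /=.
    by move=> /andP[t1 t2]; have [h|h] := leP t 0; [left; rewrite t1|right].
  by move=> [|] /andP[t1 t2]; apply/andP; split => //; lra.
transitivity (\int[L]_(t in `[- B, B]) (g2 t * `|t|)).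
  rewrite [RHS]Rintegral_mkcond; congr Rintegral; apply/funext => t.
  rewrite patchE; case: ifPn => // /negP h; rewrite g20 ?mul0r//.
  rewrite leNgt; apply/negP => tB; apply: h; rewrite inE /= in_itv /= -ler_norml; exact: ltW.
rewrite UE Rintegral_setU//; last 2 first.
- by rewrite -UE.
- apply/disj_setPS => t [] /=; rewrite !in_itv /= => /andP[_ h1] /andP[h2 _].
  by have := lt_le_trans h2 h1; rewrite ltxx.
rewrite /Rintegral E1 integral_itv_obnd_cbnd; last by apply/measurable_EFinP; exact: measurable_funTS.
by rewrite E2 /=; ring.
Qed.

End second_derivative_abs.

Section radon_backprojection.
Context {R : realType} {m : nat}.
Local Notation V := 'rV[R]_m.+1.
Local Notation L := (@lebesgue_measure R).

Lemma radon_vanish (O : 'M[R]_m.+1) rho (chi : V -> R) t : O *m O^T = 1%:M -> Cc rho chi ->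
  rho < `|t| -> radon O chi t = 0.
Proof.
move=> HO H ht; rewrite /radon (_ : (fun v => _) = fun=> 0).
  by rewrite Rintegral_cst// mul0r.
apply/funext => v; apply: (proj2 H); rewrite enorm_orth//; apply: lt_le_trans ht _.
by have := coord_le_enorm (rcons0 (t, v)) 0; rewrite rcons0_0.
Qed.

Lemma locint_abs_head : @locint R m.+1 (fun z => `|rhead z|).
Proof.
apply: locint_bounded.
  exact: (measurableT_comp (@normr_measurable R setT) (@measurable_rhead R m)).
move=> r; exists r => v vr; rewrite normr_id ltW//; apply: le_lt_trans vr.
exact: coord_le_enorm.
Qed.

(** The factor 2 here is also the one by which [Vweight] exceeds the Radon transform, so in odd
    dimension no further constant arises at this point. *)
Lemma radon_abs_pairing (O : 'M[R]_m.+1) rho (chi : V -> R) (y : V) : O *m O^T = 1%:M ->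
  Cc rho chi ->
  2 * radon O chi (dotv (row 0 O) y) =
  \int[leb m.+1]_z (laplacian chi (y + z) * `|dotv (row 0 O) z|).
Proof.
move=> HO H; have Hy := Cc_translate y H.
set psi : V -> R := fun z => chi (y + z) in Hy; set r := rho + enorm y in Hy.
have -> : radon O chi (dotv (row 0 O) y) = radon O psi 0.
  by rewrite (radon_translate y 0 HO H) addr0.
have -> : (fun z => laplacian chi (y + z) * `|dotv (row 0 O) z|) =
   fun z => laplacian psi z * `|dotv (row 0 O) z|.
  by rewrite laplacian_translate.
rewrite -(radon_pairing HO (Cc_laplacian Hy) locint_abs_head).
have D1 := Cc_derive (row 0 O) Hy.
have c2 : continuous (radon O (laplacian psi)).
  move=> t; apply: (@differentiable_continuous _ _ _ t (radon O (laplacian psi))).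
  by apply/derivable1_diffP; have [] := is_derive_radon HO t (Cc_laplacian Hy).
have rB : r < `|r| + 1 by have := ler_norm r; lra.
apply/esym/(@integral_second_derivative_abs _ _ (radon O ('D_(row 0 O) psi)) _ (`|r| + 1)) => //.
- move=> t; have h := is_derive_radon HO t Hy.
  exact: h.
- move=> t; have h := radon_laplacian HO t Hy; exact: h.
- by move=> t ht; apply: (radon_vanish HO Hy); exact: lt_le_trans ht.
- by move=> t ht; apply: (radon_vanish HO D1); exact: lt_le_trans ht.
- by move=> t ht; apply: (radon_vanish HO (Cc_laplacian Hy)); exact: lt_le_trans ht.
Qed.

Lemma integral_translation1 (a : R) (f : R -> \bar R) : measurable_fun [set: R] f ->
  (\int[L]_t f (t + a)%R = \int[L]_t f t)%E.
Proof.
move=> mf; rewrite (@integral_change_var R _ _ _ _ L L (fun t : measurableTypeR R => t + a : measurableTypeR R) 1) ?mul1e//.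
move=> h mh h0; have := @ge0_integral_affine1 R 1 a h ltr01 mh h0.
by rewrite invr1 => <-; apply: eq_integral => t _; rewrite mul1r.
Qed.

Lemma radon_ln_pairing (O : 'M[R]_m.+1) rho (chi : V -> R) (y : V) : O *m O^T = 1%:M ->
  Cc rho chi ->
  \int[L]_t (radon O chi t * ln `|t - dotv (row 0 O) y|) =
  \int[leb m.+1]_z (chi (y + z) * ln `|dotv (row 0 O) z|).
Proof.
move=> HO H; have Hy := Cc_translate y H; set a := dotv (row 0 O) y.
have := radon_pairing (k := fun s => ln `|s|) HO Hy (@locint_ln_head R m) => /= <-.
have cr : continuous (radon O chi).
  move=> t; apply: (@differentiable_continuous _ _ _ t (radon O chi)).
  by apply/derivable1_diffP; have [] := is_derive_radon HO t H.
have mln : measurable_fun [set: R] (fun s : R => ln `|s|).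
  exact: (measurableT_comp (@measurable_ln R) (@normr_measurable R setT)).
rewrite /Rintegral; congr fine.
rewrite -(@integral_translation1 a (fun t => (radon O chi t * ln `|t - a|)%:E)); last first.
  apply/measurable_EFinP; apply: measurable_funM; first exact: continuous_measurable_fun.
  by apply: (measurableT_comp mln); exact: measurable_funB.
apply: eq_integral => t _; rewrite addrK (radon_translate y t HO H).
by rewrite addrC.
Qed.

End radon_backprojection.

(** * Spherical averages of |theta.z| and ln |theta.z| *)

Section sphere_kernels.
Context {R : realType} {m : nat}.
Hypothesis m0 : (0 < m)%N.
Local Notation V := 'rV[R]_m.+1.
Local Notation S := (@sphm R m.+1).

Lemma integral_sphm_rotation (Q : 'M[R]_m.+1) (f : V -> \bar R) : Q *m Q^T = 1%:M ->
  measurable_fun setT f -> (\int[S]_y f (y *m Q) = \int[S]_y f y)%E.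
Proof.
move=> HQ mf; rewrite (@integral_change_var R _ _ _ _ S S (fun y : V => y *m Q) 1) ?mul1e//.
move=> g mg g0; rewrite mul1e; exact: sphm_rotation.
Qed.

(** A rotation takes z / |z| to the first basis vector, so the average depends on z through |z|
    only. *)
Lemma sphm_dotv (z : V) (h : R -> R) : z != 0 -> measurable_fun [set: R] h ->
  (\int[S]_theta (h (dotv theta z))%:E = \int[S]_theta (h (enorm z * rhead theta))%:E)%E.
Proof.
move=> z0 mh; have [Q [HQ QE]] := exists_frame (enorm_normalize z0).
rewrite -(integral_sphm_rotation (trmx_orth HQ) (f := fun w => (h (enorm z * rhead w))%:E)); last first.
  apply/measurable_EFinP; apply: (measurableT_comp mh); apply: measurable_funM => //.
  exact: measurable_rhead.
apply: eq_integral => theta _; rewrite rhead_frame QE dotvZl mulrA mulfV ?mul1r; first by rewrite dotvC.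
by rewrite enorm_eq0.
Qed.

(** The constant c of the averages; it is known only through its product with a Gaussian moment,
    which suffices for comparing constants. *)
Definition sphere_abs : R := fine (\int[S]_theta (`|rhead theta|)%:E)%E.

Lemma integrable_sphm_abs (z : V) : S.-integrable setT (fun theta => (`|dotv theta z|)%:E).
Proof.
apply: (@integrable_sphm_bounded _ _ (fun theta => `|dotv theta z|) (enorm z)).
  by apply: (measurableT_comp (@normr_measurable R setT)); exact: measurable_dotv.
move=> y y1; rewrite normr_id; apply: le_trans (cauchy_schwarz y z) _.
by rewrite y1 mul1r.
Qed.

Lemma sphm_abs (z : V) : z != 0 ->
  (\int[S]_theta (`|dotv theta z|)%:E = (sphere_abs * enorm z)%:E)%E.
Proof.
move=> z0; have mn := @normr_measurable R setT.
have mh : measurable_fun [set: V] (fun theta : V => (`|rhead theta|)%:E).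
  by apply/measurable_EFinP; exact: (measurableT_comp mn (@measurable_rhead R m)).
have iz := integrable_fin_num measurableT (integrable_sphm_abs z).
have E : (\int[S]_theta (`|dotv theta z|)%:E = (enorm z)%:E * \int[S]_theta (`|rhead theta|)%:E)%E.
  rewrite (sphm_dotv z0 mn) -ge0_integralZlT//; last by rewrite lee_fin enorm_ge0.
  by apply: eq_integral => theta _; rewrite normrM ger0_norm ?enorm_ge0// EFinM.
have zgt : (0 < (enorm z)%:E)%E by rewrite lte_fin enorm_gt0.
have fi : (\int[S]_theta (`|rhead theta|)%:E \is a fin_num)%E.
  rewrite ge0_fin_numE; last by apply: integral_ge0.
  have : (\int[S]_theta (`|dotv theta z|)%:E < +oo)%E.
    by move: iz; rewrite ge0_fin_numE//; apply: integral_ge0.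
  rewrite E; case: (\int[S]_theta _)%E => [x _|+|//]; first by rewrite ltry.
  by rewrite gt0_muley.
by rewrite E -(fineK fi) -EFinM mulrC.
Qed.

(** The rule ln (a b) = ln a + ln b breaks down at b = 0, since ln 0 is 0 by convention, so these
    theta have to be discarded as a null set. Here the cone over them lies in a flat box of measure
    0. *)
Lemma sphm_hyperplane : S [set theta | rhead theta = 0] = 0%E.
Proof.
have m1 : measurable [set 0 : R] by [].
have mc := @measurable_cube R m 1.
pose A := [set z : V | rhead z = 0 /\ @cube R m 1 (rtail z)].
have AE : @rcons0 R m @^-1` A = [set 0] `*` @cube R m 1.
  apply/seteqP; split => -[s v] /=; rewrite /A /= rhead_rcons0 rtail_rcons0 //.
have mA : measurable A.
  rewrite (_ : A = (@rhead R m @^-1` [set 0]) `&` (@rtail R m @^-1` @cube R m 1))//.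
  apply: measurableI; rewrite -[X in measurable X]setTI.
    exact: (@measurable_rhead R m measurableT).
  exact: (@measurable_rtail R m measurableT).
have A0 : leb m.+1 A = 0%E.
  rewrite -[LHS]/(leb_step (leb m) A) /leb_step AE product_measure1E//.
  by apply/eqP; rewrite mule_eq0; apply/orP; left; apply/eqP; exact: lebesgue_measure_set1.
have mR : measurable [set theta : V | rhead theta = 0].
  rewrite -[X in measurable X]setTI; exact: (@measurable_rhead R m measurableT [set 0] m1).
rewrite /sphm (@subset_measure0 _ _ _ _ _ A) ?mule0//.
- apply: measurableI; last exact: measurable_pball.
  rewrite -[X in measurable X]setTI; apply: (@measurable_nrm R m.+1 measurableT).
  exact: mR.
- move=> y [/= h /andP[y0 y1]]; split.
    move: h; rewrite /rhead /nrm mxE => /eqP; rewrite mulf_eq0 invr_eq0 gt_eqF//= => /eqP.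
    by [].
  move=> i; rewrite mxE; apply: le_trans (coord_le_enorm y _) (ltW y1).
Qed.

Lemma measurable_lnabs : measurable_fun [set: R] (fun s : R => ln `|s|).
Proof. exact: (measurableT_comp (@measurable_ln R) (@normr_measurable R setT)). Qed.

(** As [sphm] is a cone measure, it suffices to integrate over the unit ball, where ln |(y/|y|).z|
    is ln |z| - ln |y| + ln |(z/|z|).y|, a sum of locally integrable functions of y. *)
Lemma integrable_sphm_ln (z : V) : z != 0 ->
  S.-integrable setT (fun theta => (ln `|dotv theta z|)%:E).
Proof.
move=> z0; have z1 := enorm_normalize z0.
have k1 : (1 < m.+1)%N by [].
have mf : measurable_fun [set: V] (fun theta => (ln `|dotv theta z|)%:E).
  by apply/measurable_EFinP; apply: (measurableT_comp measurable_lnabs); exact: measurable_dotv.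
apply: integrable_sphm => //.
have i1 := @locint_dotv R m (fun s => ln `|s|) _ z1 (@locint_ln_head R m).
have i2 := @locint_ln R m.+1 (ltn0Sn m) k1.
have iG := locintD (locint_abs i1) (locintD (locint_abs i2) (locint_cst `|ln (enorm z)|)).
have sub : @pball R m.+1 `<=` @eball R m.+1 1 by move=> y /andP[].
have iGp := integrableS (@measurable_eball R m.+1 1) (@measurable_pball R m.+1) sub (proj2 iG 1).
apply: (le_integrable (@measurable_pball R m.+1) _ _ iGp).
  apply: measurable_funTS; apply: (measurableT_comp mf); exact: measurable_nrm.
move=> y /andP[y0 y1] /=; rewrite lee_fin [leRHS]ger0_norm; last by rewrite !addr_ge0.
(* Here the logarithm takes its default value ln 0 = 0 and the bound is trivial. *)
have [d0|d0] := eqVneq (dotv y z) 0.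
  by rewrite dotvZl d0 mulr0 normr0 ln0// normr0 !addr_ge0.
have -> : dotv (nrm y) z = (enorm z / enorm y) * dotv ((enorm z)^-1 *: z) y.
  by rewrite /nrm !dotvZl dotvC; field; rewrite !enorm_eq0 z0 -enorm_eq0 gt_eqF.
have dz0 : 0 < `|dotv ((enorm z)^-1 *: z) y|.
  by rewrite normr_gt0 dotvZl mulf_neq0 ?invr_eq0 ?enorm_eq0// dotvC.
have ez0 : 0 < enorm z by rewrite enorm_gt0.
rewrite normrM (gtr0_norm (divr_gt0 ez0 y0)) lnM ?Num.Theory.posrE ?divr_gt0//.
rewrite lnM ?Num.Theory.posrE ?invr_gt0// lnV ?Num.Theory.posrE//.
have h1 := ler_normD (ln (enorm z) - ln (enorm y)) (ln `|dotv ((enorm z)^-1 *: z) y|).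
have h2 := ler_normB (ln (enorm z)) (ln (enorm y)).
lra.
Qed.

Definition sphere_ln : R := fine (\int[S]_theta (ln `|rhead theta|)%:E)%E.

Lemma sphm_ln (z : V) : z != 0 ->
  (\int[S]_theta (ln `|dotv theta z|)%:E = (sphere_ln + @area R m.+1 * ln (enorm z))%:E)%E.
Proof.
move=> z0; have ez0 : 0 < enorm z by rewrite enorm_gt0.
have mlnh : measurable_fun [set: V] (fun theta : V => ln `|rhead theta|).
  exact: (measurableT_comp measurable_lnabs (@measurable_rhead R m)).
pose e0 : V := rcons0 (1, 0).
have e01 : enorm e0 = 1 by rewrite enorm_rcons0 expr1n enorm0 expr0n addr0 sqrtr1.
have he (theta : V) : dotv theta e0 = rhead theta.
  by rewrite -{1}(rcons0K theta) dotv_rcons0 dotv0r addr0 mulr1.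
have i0 : S.-integrable setT (fun theta => (ln `|rhead theta|)%:E).
  have e00 : e0 != 0 by rewrite -enorm_gt0 e01.
  by have := integrable_sphm_ln e00; apply: eq_integrable => // theta _; rewrite he.
rewrite (sphm_dotv z0 measurable_lnabs).
transitivity (\int[S]_theta ((ln `|rhead theta|)%:E + (ln (enorm z))%:E))%E.
  apply: ae_eq_integral => //.
  - apply/measurable_EFinP; apply: (measurableT_comp measurable_lnabs).
    by apply: measurable_funM => //; exact: measurable_rhead.
  - by apply: emeasurable_funD => //; apply/measurable_EFinP.
  exists [set theta | rhead theta = 0]; split; last 2 first.
  - exact: sphm_hyperplane.
  - move=> theta /= h; apply: contrapT => h0; apply: h => _.
    rewrite normrM (gtr0_norm ez0) lnM ?Num.Theory.posrE ?normr_gt0//; last exact/eqP.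
    by rewrite addrC.
  rewrite -[X in measurable X]setTI.
  exact: (@measurable_rhead R m measurableT [set 0]).
have ic : S.-integrable setT (fun _ : V => (ln (enorm z))%:E).
  apply: (@integrable_sphm_bounded _ _ (fun _ : V => ln (enorm z)) `|ln (enorm z)|) => //.
rewrite integralD//.
have -> : (\int[S]__ (ln (enorm z))%:E = (ln (enorm z))%:E * (@area R m.+1)%:E)%E.
  by rewrite areaE; exact: integral_cst.
have fi := integrable_fin_num measurableT i0.
rewrite EFinD /sphere_ln (fineK fi).
by rewrite mulrC EFinM.
Qed.

End sphere_kernels.

(** * Gaussian moments *)

Section gauss_moments.
Context {R : realType}.
Local Notation L := (@lebesgue_measure R).

Definition egauss (m : nat) : \bar R := (\int[L]_r (r ^+ m * posr r * expR (- r ^+ 2))%:E)%E.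
Definition gauss (m : nat) : R := fine (egauss m).

Let mexp d (T : measurableType d) (f : T -> R) : measurable_fun setT f ->
  measurable_fun setT (fun x => expR (f x)).
Proof. by move=> mf; exact: (measurableT_comp (@measurable_expR R)). Qed.

Lemma integral_power_below (m : nat) (b : R) : 0 < b ->
  (\int[L]_u (m.+1%:R * u ^+ m * posr u * posr (b - u))%:E = (b ^+ m.+1)%:E)%E.
Proof.
move=> b0; under eq_integral => u _ do rewrite -[X in _ * posr X * _]subr0.
rewrite (integral_itv_FTC b0 _ (fun x _ => is_derive1_exp m.+1 x)) ?expr0n ?subr0//.
apply: continuous_subspaceT.
by apply: cont_mul; [exact: cont_cst|exact: exprn_continuous].
Qed.

Lemma cvg_expNsqr : expR (- x ^+ 2) @[x --> +oo] --> (0 : R).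
Proof.
have h := @cvgr_expR R.
have sq : (x ^+ 2) @[x --> +oo%R] --> (+oo%R : set_system R).
  apply/cvgryPge => A; near=> x.
  have x1 : 1 <= x by near: x; exact: nbhs_pinfty_ge.
  have xA : A <= x by near: x; apply: nbhs_pinfty_ge; exact: num_real.
  by rewrite expr2; apply: le_trans xA _; rewrite ler_peMl// (le_trans ler01).
exact: (cvg_comp _ _ sq h).
Unshelve. all: by end_near.
Qed.

Lemma is_derive_gauss (x : R) : is_derive x 1 (fun x => expR (- x ^+ 2)) (- (2 * x) * expR (- x ^+ 2)).
Proof.
have h0 := is_deriveN (is_derive1_exp 2 x).
have h := @is_derive1_comp R _ _ x _ _ (is_derive_expR (- x ^+ 2)) h0.
by apply: (is_derive_eq h); rewrite mulrC /= expr1.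
Qed.

Lemma continuous_gauss : continuous (fun x : R => expR (- x ^+ 2)).
Proof.
move=> x; apply: (@differentiable_continuous _ _ _ x (fun x : R => expR (- x ^+ 2))).
by apply/derivable1_diffP; have [] := is_derive_gauss x.
Qed.

Lemma integral_gauss_tail (u : R) : 0 <= u ->
  (\int[L]_r (r * expR (- r ^+ 2) * posr (r - u))%:E = (2^-1 * expR (- u ^+ 2))%:E)%E.
Proof.
move=> u0.
have d (x : R) : is_derive x 1 (fun r => - 2^-1 * expR (- r ^+ 2)) (x * expR (- x ^+ 2)).
  have h := is_deriveM (is_derive_cst (- 2^-1 : R) x 1) (is_derive_gauss x).
  by apply: (is_derive_eq h); rewrite scaler0 addr0 /GRing.scale /=; field.
rewrite (integral_ray_FTC (l := 0) _ _ (fun x _ => d x)) //.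
- by rewrite sub0r mulNr opprK.
- apply: continuous_subspaceT.
  by apply: cont_mul; [exact: cont_id|exact: continuous_gauss].
- by move=> x ux; rewrite mulr_ge0 ?expR_ge0// (le_trans u0).
- rewrite -[X in _ --> X](mulr0 (- 2^-1 : R)); apply: cvgM; first exact: cvg_cst.
  exact: cvg_expNsqr.
Qed.

Lemma integral_exp_tail (a : R) :
  (\int[L]_t (expR (- t) * posr (t - a))%:E = (expR (- a))%:E)%E.
Proof.
have d (x : R) : is_derive x 1 (fun x : R => - expR (- x)) (expR (- x)).
  have h0 := is_deriveN (is_derive_id x 1).
  have h := is_deriveN (@is_derive1_comp R _ _ x _ _ (is_derive_expR (- x)) h0).
  by apply: (is_derive_eq h); rewrite mulrN1 opprK.
rewrite (integral_ray_FTC (l := 0) _ _ (fun x _ => d x)) ?sub0r ?opprK//.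
- apply: continuous_subspaceT => x; apply: (@continuous_comp _ _ _ (@GRing.opp R) (@expR R)).
    exact: opp_continuous.
  exact: continuous_expR.
- rewrite -oppr0; apply: cvgN; exact: cvgr_expR.
Qed.

(* r^(m+1) = (m+1) (integral of u^m over 0 < u < r); swap the two integrals. *)
Lemma egaussS2 m : egauss m.+2 = ((m.+1%:R / 2)%:E * egauss m)%E.
Proof.
pose f (p : R * R) : R := m.+1%:R * p.2 ^+ m * posr p.2 * posr (p.1 - p.2) *
  (p.1 * posr p.1 * expR (- p.1 ^+ 2)).
have f0 p : 0 <= f p.
  rewrite /f !posrE; case: (ltP 0 p.2) => h2; last by rewrite mulr0 !mul0r.
  case: (ltP 0 p.1) => h1; last by rewrite mulr0 !mul0r mulr0.
  by rewrite !mulr1 !mulr_ge0// ?exprn_ge0 ?ler0n ?expR_ge0// ltW.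
have mf : measurable_fun [set: measurableTypeR R * measurableTypeR R] (EFin \o f).
  apply/measurable_EFinP; apply: measurable_funM; last first.
    apply: measurable_funM; last by apply: mexp; apply: measurable_funN; apply: measurable_funX.
    by apply: measurable_funM => //; exact: measurable_posr_comp.
  apply: measurable_funM; last by apply: measurable_posr_comp; exact: measurable_funB.
  apply: measurable_funM; last exact: measurable_posr_comp.
  by apply: measurable_funM => //; apply: measurable_funX.
transitivity (\int[L]_r \int[L]_u (EFin \o f) (r, u))%E.
  apply: eq_integral => r _.
  have [r0|r0] := leP r 0.
    rewrite (posrE r) ltNge r0 mulr0 mul0r integral0_eq// => u _.
    by rewrite /= /f /= (posrE r) ltNge r0 mulr0 mul0r mulr0.
  under eq_integral => u _ do rewrite /= /f /= EFinM.
  rewrite ge0_integralZrT; last 3 first.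
  - apply/measurable_EFinP; apply: measurable_funM; last by apply: measurable_posr_comp; exact: measurable_funB.
    apply: measurable_funM; last exact: measurable_posr_comp.
    by apply: measurable_funM => //; apply: measurable_funX.
  - move=> u; rewrite lee_fin !posrE; case: (ltP 0 u) => h2; last by rewrite mulr0 !mul0r.
    by rewrite !mulr_ge0// exprn_ge0// ltW.
  - by rewrite lee_fin (posrE r) r0 mulr1 mulr_ge0 ?expR_ge0// ltW.
  by rewrite integral_power_below// -EFinM; congr EFin; rewrite [r ^+ m.+2]exprSr; ring.
rewrite (@fubini_tonelli _ _ _ _ R L L _ mf) //.
rewrite /egauss -ge0_integralZlT; last 3 first.
- apply/measurable_EFinP; apply: measurable_funM.
    by apply: measurable_funM; [exact: measurable_funX|exact: measurable_posr_comp].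
  by apply: mexp; apply: measurable_funN; apply: measurable_funX.
- move=> r; rewrite lee_fin posrE; case: (ltP 0 r) => h; last by rewrite mulr0 mul0r.
  by rewrite mulr1 mulr_ge0 ?expR_ge0// exprn_ge0// ltW.
- by rewrite lee_fin divr_ge0.
apply: eq_integral => u _.
have [u0|u0] := leP u 0.
  rewrite (posrE u) ltNge u0 mulr0 mul0r mule0 integral0_eq// => r _.
  by rewrite /= /f /= (posrE u) ltNge u0 mulr0 !mul0r.
transitivity (\int[L]_r ((m.+1%:R * u ^+ m)%:E * (r * expR (- r ^+ 2) * posr (r - u))%:E))%E.
  apply: eq_integral => r _; rewrite -EFinM /= /f /= !posrE u0 subr_gt0; congr EFin.
  by case: (ltP u r) => ur; [rewrite (lt_trans u0 ur) /=; ring|rewrite !mulr0 mul0r].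
rewrite ge0_integralZlT; last 3 first.
- apply/measurable_EFinP; apply: measurable_funM; last by apply: measurable_posr_comp; exact: measurable_funB.
  by apply: measurable_funM => //; apply: mexp; apply: measurable_funN; apply: measurable_funX.
- move=> r; rewrite lee_fin posrE subr_gt0; case: ltP => ur; last by rewrite mulr0.
  by rewrite mulr1 mulr_ge0 ?expR_ge0// ltW// (lt_trans u0).
- by rewrite lee_fin mulr_ge0// exprn_ge0// ltW.
rewrite integral_gauss_tail ?ltW// -!EFinM; congr EFin.
by rewrite posrE u0 /=; field.
Qed.

Lemma egauss0 : egauss 0 = (Num.sqrt pi / 2)%:E.
Proof.
rewrite -integral0y_gauss -integral_itv_obnd_cbnd; last first.
  by apply/measurable_EFinP; apply: measurable_funTS; exact: continuous_measurable_fun continuous_gauss.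
rewrite -integral_posr_ray; apply: eq_integral => t _.
by rewrite subr0 expr0 mul1r mulrC.
Qed.

Lemma egauss1 : egauss 1 = (2^-1)%:E.
Proof.
have := integral_gauss_tail (lexx 0); rewrite expr0n oppr0 expR0 mulr1 => <-.
by apply: eq_integral => r _; rewrite addr0 expr1; congr EFin; ring.
Qed.

Lemma egaussE m : egauss m = (gauss m)%:E.
Proof.
suff [+ _] : (egauss m \is a fin_num) /\ (egauss m.+1 \is a fin_num).
  by move=> h; rewrite /gauss fineK.
elim: m => [|m [IH1 IH2]]; first by rewrite egauss0 egauss1.
by split => //; rewrite egaussS2 fin_numM.
Qed.

Lemma gauss0 : gauss 0 = Num.sqrt pi / 2. Proof. by rewrite /gauss egauss0. Qed.
Lemma gauss1 : gauss 1 = 2^-1. Proof. by rewrite /gauss egauss1. Qed.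

Lemma gaussS2 m : gauss m.+2 = m.+1%:R / 2 * gauss m.
Proof. by rewrite /gauss egaussS2 egaussE. Qed.

Lemma gauss_gt0 m : 0 < gauss m.
Proof.
suff [] : 0 < gauss m /\ 0 < gauss m.+1 by [].
elim: m => [|m [IH1 IH2]].
  by rewrite gauss0 gauss1 divr_gt0 ?invr_gt0 ?sqrtr_gt0 ?pi_gt0.
by split => //; rewrite gaussS2 mulr_gt0// divr_gt0.
Qed.

(** The value Gamma(j + 1/2) = (2j)! sqrt pi / (4^j j!), stated as a ratio of consecutive moments
    because that ratio is what remains of the constants in even dimension. *)
Lemma gauss_even_odd j : gauss (2 * j) * (2 ^+ j * j`!%:R) ^+ 2 =
  Num.sqrt pi * (2 * j)`!%:R * gauss (2 * j).+1.
Proof.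
elim: j => [|j IH]; first by rewrite muln0 gauss0 gauss1 fact0 expr0 !mulr1 expr1n mulr1.
have -> : (2 * j.+1 = (2 * j).+2)%N by rewrite mulnS.
rewrite !gaussS2 !factS !natrM [2 ^+ j.+1]exprS.
set k := (2 * j)%N in IH *.
have -> : (k.+1.+1%:R : R) = 2 * j.+1%:R by rewrite /k -natrM; congr (_%:R); lia.
transitivity ((gauss k * (2 ^+ j * j`!%:R) ^+ 2) * (k.+1%:R / 2 * (2 * j.+1%:R) ^+ 2)); first by ring.
by rewrite IH; field.
Qed.

Lemma Gamma1 : Gamma (1 : R) = 1.
Proof.
rewrite /Gamma /Rintegral; under eq_integral => t _ do rewrite subrr powRr0 mul1r.
rewrite -(integral_posr_ray (fun t => expR (- t))).
by rewrite integral_exp_tail oppr0 expR0.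
Qed.

Lemma sqrt_powR (t : R) m : 0 < t -> t `^ (m%:R / 2) = Num.sqrt t ^+ m.
Proof.
by move=> t0; rewrite mulrC powRrM powR12_sqrt ?ltW// powR_mulrn// sqrtr_ge0.
Qed.

(* t^((m+1)/2) = (m+1) (integral of u^m over 0 < u < sqrt t); swap the two integrals. *)
Lemma Gamma_gauss m : Gamma (m.+3%:R / 2 : R) = m.+1%:R * gauss m.
Proof.
pose f (p : R * R) : R := m.+1%:R * p.1 ^+ m * posr p.1 * (expR (- p.2) * posr (p.2 - p.1 ^+ 2)).
have f0 p : 0 <= f p.
  rewrite /f !posrE; case: (ltP 0 p.1) => h2; last by rewrite mulr0 !mul0r.
  by rewrite !mulr1 !mulr_ge0// ?exprn_ge0 ?ler0n ?expR_ge0// ltW.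
have mf : measurable_fun [set: measurableTypeR R * measurableTypeR R] (EFin \o f).
  apply/measurable_EFinP; apply: measurable_funM; last first.
    apply: measurable_funM; first by apply: mexp; exact: measurable_funN.
    by apply: measurable_posr_comp; apply: measurable_funB => //; exact: measurable_funX.
  apply: measurable_funM; last exact: measurable_posr_comp.
  by apply: measurable_funM => //; apply: measurable_funX.
have E1 : (\int[L]_r \int[L]_t (EFin \o f) (r, t) = (m.+1%:R * gauss m)%:E)%E.
  rewrite EFinM -egaussE /egauss -ge0_integralZlT; last 3 first.
  - apply/measurable_EFinP; apply: measurable_funM.
      by apply: measurable_funM; [exact: measurable_funX|exact: measurable_posr_comp].
    by apply: mexp; apply: measurable_funN; apply: measurable_funX.
  - move=> r; rewrite lee_fin posrE; case: (ltP 0 r) => h; last by rewrite mulr0 mul0r.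
    by rewrite mulr1 mulr_ge0 ?expR_ge0// exprn_ge0// ltW.
  - by rewrite lee_fin.
  apply: eq_integral => r _.
  under eq_integral => u _ do rewrite /= /f /= EFinM.
  rewrite ge0_integralZlT; last 3 first.
  - apply/measurable_EFinP; apply: measurable_funM; first by apply: mexp; exact: measurable_funN.
    by apply: measurable_posr_comp; exact: measurable_funB.
  - by move=> t; rewrite lee_fin mulr_ge0 ?expR_ge0 ?posr_ge0.
  - rewrite lee_fin posrE; case: (ltP 0 r) => h; last by rewrite mulr0.
    by rewrite mulr1 mulr_ge0// exprn_ge0// ltW.
  by rewrite integral_exp_tail -!EFinM; congr EFin; ring.
rewrite (@fubini_tonelli _ _ _ _ R L L _ mf) // in E1.
rewrite /Gamma /Rintegral -[RHS]/(fine (m.+1%:R * gauss m)%:E) -E1; congr fine.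
rewrite integral_mkcond; apply: eq_integral => t _.
rewrite patchE.
have -> : (t \in `]0, +oo[%classic) = (0 < t) by apply/idP/idP; rewrite inE /= in_itv /= andbT.
have [t0|t0] := ltP 0 t; last first.
  rewrite integral0_eq// => r _; rewrite /= /f /= (posrE (t - _)) subr_gt0.
  by rewrite ltNge (le_trans t0 (sqr_ge0 r)) !mulr0.
have st0 : 0 < Num.sqrt t by rewrite sqrtr_gt0.
have -> : m.+3%:R / 2 - 1 = m.+1%:R / 2 :> R.
  {  have -> : m.+3%:R = m.+1%:R + 2 :> R by rewrite -natrD addn2.
    by field. }
rewrite sqrt_powR// EFinM -integral_power_below// -ge0_integralZrT; last 3 first.
- apply/measurable_EFinP; apply: measurable_funM; last by apply: measurable_posr_comp; exact: measurable_funB.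
  apply: measurable_funM; last exact: measurable_posr_comp.
  by apply: measurable_funM => //; apply: measurable_funX.
- move=> u; rewrite lee_fin !posrE; case: (ltP 0 u) => h2; last by rewrite mulr0 !mul0r.
  by rewrite !mulr_ge0// exprn_ge0// ltW.
- by rewrite lee_fin expR_ge0.
apply: eq_integral => r _; rewrite -EFinM /= /f /= !posrE; congr EFin.
have [r0|r0] := ltP 0 r; last by rewrite !mulr0 !mul0r.
have -> : (0 < t - r ^+ 2) = (0 < Num.sqrt t - r).
  rewrite !subr_gt0 -{1}(sqr_sqrtr (ltW t0)) ltr_pXn2r// nnegrE ltW//.
ring.
Qed.

Lemma Gamma_half m : (0 < m)%N -> Gamma (m.+1%:R / 2 : R) = 2 * gauss m.
Proof.
(* [Gamma_gauss] starts at Gamma(3/2), so the value Gamma(1) is treated apart. *)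
case: m => [//|[_|m _]]; first by rewrite gauss1 !mulfV// Gamma1.
by rewrite Gamma_gauss gaussS2; field.
Qed.

Lemma integral_leb_gauss k : (\int[leb k]_z (expR (- enorm z ^+ 2))%:E = (Num.sqrt (pi : R) ^+ k)%:E)%E.
Proof.
have mg q : measurable_fun [set: 'rV[R]_q] (fun z : 'rV[R]_q => (expR (- enorm z ^+ 2))%:E).
  apply/measurable_EFinP; apply: mexp; apply: measurable_funN; apply: measurable_funX.
  exact: measurable_enormT.
elim: k => [|k IH].
  by rewrite integral_leb0// enorm0 expr0n oppr0 expR0.
rewrite ge0_integral_lebS//.
transitivity (\int[L]_s ((expR (- s ^+ 2))%:E * (Num.sqrt (pi : R) ^+ k)%:E))%E.
  apply: eq_integral => s _; rewrite -IH -ge0_integralZlT//.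
    apply: eq_integral => v _; rewrite -EFinM -expRD; congr (expR _)%:E.
    by rewrite enorm_rcons0 sqr_sqrtr ?opprD// addr_ge0// sqr_ge0.
  exact: mg.
rewrite ge0_integralZrT; last 3 first.
- by apply/measurable_EFinP; exact: continuous_measurable_fun continuous_gauss.
- by move=> s; rewrite lee_fin expR_ge0.
- by rewrite lee_fin exprn_ge0// sqrtr_ge0.
by have -> := @integralT_gauss R; rewrite -EFinM -exprS.
Qed.

(* The integral of exp (- |z|^2) in Cartesian and in polar coordinates; likewise with |z_1| exp (- |z|^2) for
   [sphere_abs]. *)
Lemma area_gauss m : @area R m.+1 * gauss m = Num.sqrt pi ^+ m.+1.
Proof.
apply: EFin_inj; rewrite -integral_leb_gauss EFinM -egaussE.
rewrite (@ge0_integral_radial R m.+1 isT (fun r => expR (- r ^+ 2)))//.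
exact: continuous_measurable_fun continuous_gauss.
Qed.

Lemma sphere_abs_gauss m : @sphere_abs R m * gauss m.+1 = Num.sqrt pi ^+ m.
Proof.
pose F (z : 'rV[R]_m.+1) := (`|rhead z| * expR (- enorm z ^+ 2))%:E.
have mn := @normr_measurable R setT.
have mF : measurable_fun [set: 'rV[R]_m.+1] F.
  apply/measurable_EFinP; apply: measurable_funM.
    exact: (measurableT_comp mn (@measurable_rhead R m)).
  apply: mexp; apply: measurable_funN; apply: measurable_funX.
  exact: measurable_enormT.
have F0 z : (0 <= F z)%E by rewrite lee_fin mulr_ge0 ?expR_ge0.
have mh : measurable_fun [set: 'rV[R]_m.+1] (fun z : 'rV[R]_m.+1 => (`|rhead z|)%:E).
  by apply/measurable_EFinP; exact: (measurableT_comp mn (@measurable_rhead R m)).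
have fi : (\int[@sphm R m.+1]_w (`|rhead w|)%:E)%E = (@sphere_abs R m)%:E.
  have e00 : (rcons0 (1 : R, 0 : 'rV[R]_m)) != 0.
    by rewrite -enorm_gt0 enorm_rcons0 expr1n enorm0 expr0n addr0 sqrtr1.
  have := integrable_fin_num measurableT (integrable_sphm_abs (rcons0 (1 : R, 0 : 'rV[R]_m))).
  rewrite (_ : (fun theta => _) = (fun theta => (`|rhead theta|)%:E)).
    by move=> h; rewrite /sphere_abs fineK.
  apply/funext => theta; congr (`|_|)%:E.
  by rewrite -{1}(rcons0K theta) dotv_rcons0 dotv0r addr0 mulr1.
have c0 : 0 <= @sphere_abs R m.
  by rewrite -lee_fin -fi; apply: integral_ge0 => w _; rewrite lee_fin.
have E1 : (\int[leb m.+1]_z F z = (@sphere_abs R m * gauss m.+1)%:E)%E.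
  rewrite (ge0_polar (ltn0Sn m) mF F0) EFinM -egaussE /egauss -ge0_integralZlT; last 3 first.
  - apply/measurable_EFinP; apply: measurable_funM.
      by apply: measurable_funM; [exact: measurable_funX|exact: measurable_posr_comp].
    by apply: mexp; apply: measurable_funN; apply: measurable_funX.
  - move=> r; rewrite lee_fin posrE; case: (ltP 0 r) => h; last by rewrite mulr0 mul0r.
    by rewrite mulr1 mulr_ge0 ?expR_ge0// exprn_ge0// ltW.
  - by rewrite lee_fin.
  apply: eq_integral => r _ /=; rewrite posrE; case: (ltP 0 r) => r0; last by rewrite !mulr0 mul0r mul0e mule0.
  rewrite (@integral_sphm_eq_on _ _ _ (fun w => (r * expR (- r ^+ 2))%:E * (`|rhead w|)%:E)%E); last 3 first.
  - by apply: (measurableT_comp mF); exact: measurable_rvZ.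
  - by apply: emeasurable_funM.
  - move=> w w1; rewrite /F -EFinM; congr EFin.
    rewrite enormZ w1 mulr1 (gtr0_norm r0) /rhead mxE normrM (gtr0_norm r0); ring.
  rewrite ge0_integralZlT//; last by rewrite lee_fin mulr_ge0 ?expR_ge0// ltW.
  by rewrite fi -!EFinM; congr EFin; rewrite !mulr1 [r ^+ m.+1]exprS; ring.
apply: EFin_inj; rewrite -E1 ge0_integral_lebS//.
transitivity (\int[L]_s ((`|s| * expR (- s ^+ 2))%:E * (Num.sqrt (pi : R) ^+ m)%:E))%E.
  apply: eq_integral => s _.
  transitivity (\int[leb m]_v ((`|s| * expR (- s ^+ 2))%:E * (expR (- enorm v ^+ 2))%:E))%E.
    apply: eq_integral => v _; rewrite /F rhead_rcons0 -EFinM -mulrA -expRD; congr (_ * expR _)%:E.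
    by rewrite enorm_rcons0 sqr_sqrtr ?opprD// addr_ge0// sqr_ge0.
  rewrite ge0_integralZlT; first by rewrite integral_leb_gauss.
  - apply/measurable_EFinP; apply: mexp; apply: measurable_funN; apply: measurable_funX.
    exact: measurable_enormT.
  - by move=> v; rewrite lee_fin expR_ge0.
  - by rewrite lee_fin mulr_ge0 ?expR_ge0.
have mg : measurable_fun [set: R] (fun s : R => `|s| * expR (- s ^+ 2)).
  by apply: measurable_funM => //; exact: continuous_measurable_fun continuous_gauss.
rewrite ge0_integralZrT; last 3 first.
- exact/measurable_EFinP.
- by move=> s; rewrite lee_fin mulr_ge0 ?expR_ge0.
- by rewrite lee_fin exprn_ge0// sqrtr_ge0.
rewrite (@ge0_integral_even R (fun s => `|s| * expR (- s ^+ 2)))//; last by move=> s; rewrite normrN sqrrN.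
rewrite (_ : (\int[L]_x _)%E = egauss 1).
  by rewrite egauss1 -!EFinM mulfV// mul1r.
apply: eq_integral => s _; rewrite posrE; congr EFin.
by case: (ltP 0 s) => s0; [rewrite (gtr0_norm s0); ring|rewrite !mulr0 mul0r].
Qed.

End gauss_moments.

(** * The whole chain of Laplacians *)

Section iterated_chain.
Context {R : realType} {n : nat}.
Hypothesis n0 : (0 < n)%N.
Local Notation V := 'rV[R]_n.
Local Notation lap j psi := (iter j (@laplacian R n) psi).

Lemma iter_laplacian_translate (psi : V -> R) y j :
  lap j (fun z => psi (y + z)) = fun z => lap j psi (y + z).
Proof.
have key (q : nat) := laplacian_translate (lap q psi) y.
elim: j => [|j IH]; first by [].
rewrite [LHS]iterS.
rewrite IH.
exact: key.
Qed.

(** The exponent climbs from q to n - 2 in steps of 2, and the last Laplacian gives the delta. The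
    step at exponent q + 2l contributes - (q + 2l) (n - q - 2l - 2); the second factors are 2i, ...,
    4, 2, with product 2^i i!. *)
Lemma integral_iter_laplacian_pow i q rho (psi : V -> R) : Cc rho psi ->
  (q + 2 * i.+1 = n)%N ->
  \int[leb n]_z (lap i.+1 psi z * enorm z ^- q) =
  (-1) ^+ i.+1 * 2 ^+ i * i`!%:R * (\prod_(l < i.+1) (q + 2 * l)%:R) * @area R n * psi 0.
Proof.
move=> H; elim: i q => [|i IH] q qn.
  rewrite /= (laplacian_chain_end n0 H); last by rewrite -qn addn2.
  by rewrite big_ord1 muln0 addn0 fact0; ring.
have HC := Cc_iter_laplacian i.+1 H.
rewrite iterS (laplacian_chain_pow n0 HC); last by lia.
rewrite (IH q.+2); last by lia.
rewrite [in RHS]big_ord_recl /= muln0 addn0.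
have -> : \prod_(i0 < i.+1) (q.+2 + 2 * i0)%:R = \prod_(i0 < i.+1) (q + 2 * bump 0 i0)%:R :> R.
  by apply: eq_bigr => l _; congr (_%:R); rewrite /bump; lia.
have -> : n%:R - q.+2%:R = 2 * i.+1%:R :> R.
  rewrite -natrM -natrB; last by lia.
  by congr (_%:R); lia.
rewrite [i.+1`!]factS natrM [(-1) ^+ i.+2]exprS [2 ^+ i.+1]exprS; ring.
Qed.

(** The first step turns |z| into (n - 1) / |z|, after which the exponents are odd. The even factors
    n - 1 = 2j + 2 and 2j, ..., 2 interleave with the odd factors 1, 3, ..., 2j + 1 to form (n -
    1)!. *)
Lemma integral_iter_laplacian_abs j rho (psi : V -> R) : Cc rho psi -> (n = 2 * j + 3)%N ->
  \int[leb n]_z (lap j.+2 psi z * enorm z) = (-1) ^+ j.+1 * (n.-1)`!%:R * @area R n * psi 0.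
Proof.
move=> H nE; have HC := Cc_iter_laplacian j.+1 H.
rewrite iterS (laplacian_chain_norm n0 HC); last by lia.
rewrite (integral_iter_laplacian_pow H); last by lia.
have -> : (n.-1)`!%:R = (n%:R - 1) * (2 ^+ j * j`!%:R * \prod_(l < j.+1) (1 + 2 * l)%:R) :> R; last by ring.
have -> : n%:R - 1 = (2 * j.+1)%:R :> R by rewrite -[X in _ - X]/(1%:R) -natrB; [congr (_%:R); lia|lia].
have -> : n.-1 = (2 * j.+1)%N by lia.
elim: j {H nE HC} => [|j IH]; first by rewrite big_ord1 muln0 muln1 fact0 /= !mulr1.
have -> : (2 * j.+2 = (2 * j.+1).+2)%N by lia.
rewrite [(2 * j.+1).+2`!]factS [(2 * j.+1).+1`!]factS [j.+1`!]factS.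
rewrite [in LHS]natrM [X in _ * X = _]natrM IH [in RHS]big_ord_recr /= [2 ^+ j.+1]exprS natrM.
have -> : (1 + 2 * j.+1)%:R = (2 * j.+1).+1%:R :> R by rewrite add1n.
rewrite (natrM _ j.+1 j`!).
ring.
Qed.

(** The first step turns ln |z| into (n - 2) / |z|^2 with n - 2 = 2j. Now both sequences of factors
    are even and each multiplies to 2^j j!, whence the square. *)
Lemma integral_iter_laplacian_ln j rho (psi : V -> R) : Cc rho psi -> (0 < j)%N ->
  (n = 2 * j + 2)%N ->
  \int[leb n]_z (lap j.+1 psi z * ln (enorm z)) =
  (-1) ^+ j * (2 ^+ j * j`!%:R) ^+ 2 * @area R n * psi 0.
Proof.
case: j => // j H _ nE; have HC := Cc_iter_laplacian j.+1 H.
rewrite iterS (laplacian_chain_ln n0 HC); last by lia.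
rewrite (integral_iter_laplacian_pow H); last by lia.
have -> : \prod_(l < j.+1) (2 + 2 * l)%:R = 2 ^+ j.+1 * j.+1`!%:R :> R.
  elim: j {H nE HC} => [|j IH]; first by rewrite big_ord1 muln0 addn0 mulr1.
  rewrite big_ord_recr /= IH [j.+2`!]factS natrM [2 ^+ j.+2]exprS.
  have -> : (2 + 2 * j.+1)%:R = 2 * j.+2%:R :> R by rewrite -natrM; congr (_%:R); lia.
  ring.
have -> : n%:R - 2 = 2 * j.+1%:R :> R.
  by rewrite -natrM -natrB; [congr (_%:R); lia|lia].
rewrite [j.+1`!]factS natrM [2 ^+ j.+1]exprS; ring.
Qed.

(** The case q = 0 of the power chain, whose right-hand side has the factor q. It eliminates the
    additive constant of the logarithmic average. *)
Lemma integral_iter_laplacian_cst j rho (psi : V -> R) : (2 < n)%N -> Cc rho psi ->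
  \int[leb n]_z lap j.+1 psi z = 0.
Proof.
move=> n2 H; have HC := Cc_iter_laplacian j H.
have := laplacian_chain_pow n0 HC (q := 0) n2; rewrite oppr0 !mul0r => h; rewrite -[RHS]h.
by congr Rintegral; apply/funext => z; rewrite /= expr0 invr1 mulr1.
Qed.

End iterated_chain.

(** * Inversion *)

Section inversion.
Context {R : realType} {m : nat}.
Hypothesis m1 : (1 < m)%N.
Local Notation n := m.+1.
Local Notation V := 'rV[R]_n.
Local Notation lap j psi := (iter j (@laplacian R n) psi).
Variables (f : 'rV[R]_(n + 1) -> R) (rho : R) (phi : V -> R).
Hypothesis rho1 : rho < 1.
Hypothesis phiC : Cc rho phi.
Hypothesis f_phi : forall x, on_sphere x -> f x = `|xlast x| * phi (xprime x).

Let m0 : (0 < m)%N. Proof. exact: ltnW. Qed.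

Lemma Vweight_radonE (O : 'M[R]_n) theta : O *m O^T = 1%:M -> row 0 O = theta ->
  Vweight f theta = fun t => 2 * radon O phi t.
Proof.
move=> HO OE; have [M HM] : exists M : R, forall y, `|phi y| <= M := Cc_bounded phiC.
apply/funext => t; apply: (@Vweight_radon R m f phi M m0 (Cc_cont phiC) HM) => //.
- by move=> y y1; apply: (proj2 phiC); exact: lt_le_trans y1.
- by rewrite -OE row0_orth.
- by rewrite -row_frame0.
Qed.

Lemma derive1nZ (c : R) (h : R -> R) k : (forall i, (i < k)%N -> forall t, derivable (derive1n i h) t 1) ->
  derive1n k (fun t => c * h t) = fun t => c * derive1n k h t.
Proof.
elim: k => // k IH dh; rewrite derive1nS IH; last by move=> i ik; apply: dh; exact: ltnW.
apply/funext => t; rewrite derive1nS !derive1E.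
exact: (@deriveZ R R R (derive1n k h) c t 1 (dh k (ltnSn k) t)).
Qed.

Lemma derivable_radon (O : 'M[R]_n) rho' (psi : V -> R) k t : O *m O^T = 1%:M -> Cc rho' psi ->
  derivable (derive1n k (radon O psi)) t 1.
Proof.
move=> HO; elim: k psi t => [|k IH] psi t H.
  by have [] := is_derive_radon HO t H.
rewrite derive1Sn.
have -> : ((radon O psi)^`())%classic = radon O ('D_(row 0 O) psi).
  apply/funext => s; rewrite derive1E.
  exact: (@derive_val _ _ _ _ _ _ _ (is_derive_radon HO s H)).
by apply: IH; exact: Cc_derive.
Qed.

Lemma derive1n_Vweight (O : 'M[R]_n) theta j : O *m O^T = 1%:M -> row 0 O = theta ->
  derive1n (2 * j) (Vweight f theta) = fun t => 2 * radon O (lap j phi) t.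
Proof.
move=> HO OE; rewrite (Vweight_radonE HO OE) derive1nZ; last first.
  by move=> i _ t; exact: derivable_radon HO phiC.
by rewrite (derive1n_radon HO _ phiC).
Qed.

Lemma odd_backprojection j y :
  sphInt (fun theta : V => derive1n (2 * j) (Vweight f theta) (dotv theta y)) =
  corr (fun z => @sphere_abs R m * enorm z) (lap j.+1 phi) y.
Proof.
have HC := Cc_iter_laplacian j phiC; have HC' := Cc_translate y (Cc_laplacian HC).
rewrite (@sphInt_eq_on _ _ _ (fun theta => \int[leb n]_z (lap j.+1 phi (y + z) * `|dotv theta z|))).
  apply: (sphInt_fubini (k := fun t => `|t|) HC') => //.
  - exact: locint_abs_head.
  - by apply: measurable_funM => //; exact: measurable_enormT.
  - by move=> z _; exact: integrable_sphm_abs.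
  - by move=> z z0; exact: sphm_abs.
move=> theta t1; have [Q [HQ QE]] := exists_frame t1.
rewrite (derive1n_Vweight j HQ QE) -QE.
exact: (radon_abs_pairing y HQ HC).
Qed.

Lemma even_backprojection j y :
  sphInt (fun theta : V => \int[@lebesgue_measure R]_(t in `[-1, 1]%classic)
     (derive1n (2 * j) (Vweight f theta) t * ln `|t - dotv theta y|)) =
  2 * corr (fun z => @sphere_ln R m + @area R n * ln (enorm z)) (lap j phi) y.
Proof.
have HC := Cc_iter_laplacian j phiC.
(* The 2 of [Vweight] is absorbed into chi, so that the Radon transform of chi is the derivative in
   the statement. *)
pose chi z := 2 * lap j phi z.
have chiC : Cc rho chi.
  split; last by move=> z hz; rewrite /chi (proj2 HC) ?mulr0.
  apply: (smooth_onP _ _).2 => q; apply: Ck_mul; [exact: openT|exact: Ck_cst|].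
  exact: ((smooth_onP _ _).1 (proj1 HC)).
have HC' := Cc_translate y chiC.
have iK : locint (fun z : V => @sphere_ln R m + @area R n * ln (enorm z)).
  apply: locintD; first exact: locint_cst.
  by apply: locintZ; apply: locint_ln.
rewrite (@sphInt_eq_on _ _ _ (fun theta => \int[leb n]_z (chi (y + z) * ln `|dotv theta z|))).
  rewrite (sphInt_fubini (k := fun t => ln `|t|) (kbar := fun z => @sphere_ln R m + @area R n * ln (enorm z)) HC') //.
  - rewrite /corr -RintegralZl//; last exact: (integrable_corr y iK HC).
    by congr Rintegral; apply/funext => z; rewrite mulrA.
  - exact: measurable_lnabs.
  - exact: locint_ln_head.
  - by case: iK.
  - by move=> z; exact: integrable_sphm_ln.
  - by move=> z; exact: sphm_ln.
move=> theta t1; have [Q [HQ QE]] := exists_frame t1.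
rewrite (derive1n_Vweight j HQ QE) -QE -(radon_ln_pairing y HQ chiC).
(* The Radon transform vanishes for |t| > rho and rho < 1, so the integral over [-1, 1] is the one
   over the whole line. *)
rewrite Rintegral_mkcond; congr Rintegral; apply/funext => t.
have rE : radon Q chi t = 2 * radon Q (lap j phi) t.
  by have iR := integrable_radon HQ (t : R) HC; rewrite /radon -RintegralZl.
rewrite patchE rE; case: ifPn => // /negP h.
rewrite (radon_vanish HQ HC) ?mulr0 ?mul0r//.
apply: lt_le_trans rho1 _; rewrite leNgt; apply/negP => tB; apply: h.
by rewrite inE /= in_itv /= -ler_norml ltW.
Qed.

Lemma laplacian_odd_backprojection j y : (n = 2 * j + 3)%N ->
  laplacian (fun y : V => sphInt (fun theta : V => derive1n (2 * j) (Vweight f theta) (dotv theta y))) y =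
  (-1) ^+ j.+1 * (n.-1)`!%:R * @sphere_abs R m * @area R n * phi y.
Proof.
move=> nE; have HC := Cc_iter_laplacian j.+1 phiC.
have iK : locint (fun z : V => @sphere_abs R m * enorm z) by apply: locintZ; exact: locint_enorm.
have -> : (fun y : V => sphInt (fun theta : V => derive1n (2 * j) (Vweight f theta) (dotv theta y))) =
    corr (fun z => @sphere_abs R m * enorm z) (lap j.+1 phi).
  by apply/funext => z; exact: odd_backprojection.
rewrite (laplacian_corr iK HC) /corr.
have Hy := Cc_translate y phiC.
transitivity (@sphere_abs R m * \int[leb n]_z (lap j.+2 (fun z => phi (y + z)) z * enorm z)).
  rewrite -RintegralZl//; last exact: locint_Cc locint_enorm (Cc_iter_laplacian j.+2 Hy).
  congr Rintegral; apply/funext => z; rewrite (iter_laplacian_translate phi y j.+2).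
  by rewrite -[lap j.+2 phi (y + z)]/(laplacian (lap j.+1 phi) (y + z)); ring.
rewrite (integral_iter_laplacian_abs _ Hy nE)// addr0; ring.
Qed.

Lemma laplacian_even_backprojection j y : (0 < j)%N -> (n = 2 * j + 2)%N ->
  laplacian (fun y : V => sphInt (fun theta : V => \int[@lebesgue_measure R]_(t in `[-1, 1]%classic)
     (derive1n (2 * j) (Vweight f theta) t * ln `|t - dotv theta y|))) y =
  2 * (-1) ^+ j * (2 ^+ j * j`!%:R) ^+ 2 * @area R n ^+ 2 * phi y.
Proof.
move=> j0 nE; have HC := Cc_iter_laplacian j phiC.
have iL : locint (fun z : V => ln (enorm z)) by apply: locint_ln.
have iK : locint (fun z : V => 2 * (@sphere_ln R m + @area R n * ln (enorm z))).
  by apply: locintZ; apply: locintD; [exact: locint_cst|exact: locintZ].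
have iK1 : locint (fun z : V => @sphere_ln R m + @area R n * ln (enorm z)).
  by apply: locintD; [exact: locint_cst|exact: locintZ].
have -> : (fun y : V => sphInt (fun theta : V => \int[@lebesgue_measure R]_(t in `[-1, 1]%classic)
     (derive1n (2 * j) (Vweight f theta) t * ln `|t - dotv theta y|))) =
    corr (fun z => 2 * (@sphere_ln R m + @area R n * ln (enorm z))) (lap j phi).
  apply/funext => z; rewrite even_backprojection /corr -RintegralZl//; last exact: (integrable_corr z iK1 HC).
  by congr Rintegral; apply/funext => w; ring.
rewrite (laplacian_corr iK HC) /corr.
have Hy := Cc_translate y phiC; have HyC := Cc_iter_laplacian j.+1 Hy.
have i1 := integrable_Cc HyC.
have i2 := locint_Cc iL HyC.
transitivity (2 * @sphere_ln R m * (\int[leb n]_z lap j.+1 (fun z => phi (y + z)) z) +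
    2 * @area R n * \int[leb n]_z (lap j.+1 (fun z => phi (y + z)) z * ln (enorm z))).
  rewrite -RintegralZl// -[X in _ = _ + X]RintegralZl// -RintegralD//; last 2 first.
  - exact: (integrableZl measurableT (2 * @sphere_ln R m) i1).
  - exact: (integrableZl measurableT (2 * @area R n) i2).
  congr Rintegral; apply/funext => z; rewrite (iter_laplacian_translate phi y j.+1) iterS; ring.
(* Here [sphere_ln] disappears without having been evaluated. *)
rewrite (integral_iter_laplacian_cst (ltn0Sn m) j m1 Hy)// (integral_iter_laplacian_ln _ Hy j0 nE)//.
rewrite addr0; ring.
Qed.

End inversion.

(** * Comparison of constants *)

Section constants.
Context {R : realType}.

Lemma sqrtpi_gt0 : 0 < Num.sqrt (pi : R).
Proof. by rewrite sqrtr_gt0 pi_gt0. Qed.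

Lemma pi_powR_half n : (pi : R) `^ (n.+1%:R - 2^-1) = Num.sqrt pi ^+ (2 * n).+1.
Proof.
rewrite -sqrt_powR ?pi_gt0//; congr (_ `^ _).
have -> : (2 * n).+1%:R = 2 * n%:R + 1 :> R by rewrite -natr1 natrM.
by rewrite -natr1; field.
Qed.

(** Each of the two Gamma values is twice a Gaussian moment, which reduces the 8 in the denominator
    to 2. *)
Lemma lambda_gauss m : (1 < m)%N -> lambda_n R m.+1 =
  (-1) ^+ ((m.+1)./2 - 1) * gauss m.-1 * gauss m / (2 * Num.sqrt pi ^+ (2 * m).+1 * (m.-1)`!%:R).
Proof.
move=> m1; have m0 : (0 < m)%N by exact: ltnW.
rewrite /lambda_n pi_powR_half.
have -> : (m.+1%:R - 1) / 2 = (m.-1).+1%:R / 2 :> R by rewrite -natr1 addrK prednK.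
rewrite !Gamma_half//; last by rewrite -ltnS prednK.
have -> : (m.+1 - 2 = m.-1)%N by lia.
have p0 := sqrtpi_gt0.
by field; rewrite pnatr_eq0 -lt0n fact_gt0 expf_neq0// gt_eqF.
Qed.

(** The moment of order m cancels against [area]; the one of order m - 1 meets the moment of order m
    + 1 from [sphere_abs], and the recursion between them supplies the m / 2 that balances m! / (2
    (m - 1)!). The powers of sqrt pi match exactly and the sign is squared. *)
Lemma lambda_odd m j : (m.+1 = 2 * j + 3)%N ->
  lambda_n R m.+1 * (-1) ^+ j * m`!%:R * @sphere_abs R m * @area R m.+1 = 1.
Proof.
move=> mE; have m1 : (1 < m)%N by lia.
have -> : m = (2 * j).+2 by lia.
set k := (2 * j)%N.
rewrite lambda_gauss//.
have -> : ((k.+3)./2 - 1 = j)%N by rewrite /k; lia.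
have ha := @area_gauss R k.+2; have hc := @sphere_abs_gauss R k.+2.
have g1 := @gauss_gt0 R k.+2; have g2 := @gauss_gt0 R k.+3; have g0 := @gauss_gt0 R k.+1.
have p0 := sqrtpi_gt0.
have -> : @area R k.+3 = Num.sqrt pi ^+ k.+3 / gauss k.+2 by rewrite -ha mulfK// gt_eqF.
have -> : @sphere_abs R k.+2 = Num.sqrt pi ^+ k.+2 / gauss k.+3 by rewrite -hc mulfK// gt_eqF.
rewrite (gaussS2 k.+1) /=.
have -> : (2 * k.+2).+1 = (k.+3 + k.+2)%N by lia.
rewrite [k.+2`!]factS natrM exprD.
have s1 : (-1) ^+ j * (-1) ^+ j = 1 :> R by rewrite -exprMn mulrNN mulr1 expr1n.
have f0 : (k.+1)`!%:R != 0 :> R by rewrite pnatr_eq0 -lt0n fact_gt0.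
have q1 : Num.sqrt pi ^+ k.+3 != 0 :> R by rewrite expf_neq0// gt_eqF.
have q2 : Num.sqrt pi ^+ k.+2 != 0 :> R by rewrite expf_neq0// gt_eqF.
have k2 : k.+2%:R != 0 :> R by rewrite pnatr_eq0.
rewrite -[RHS]s1.
move: (Num.sqrt pi ^+ k.+3) (Num.sqrt pi ^+ k.+2) ((k.+1)`!%:R) (k.+2%:R : R) (gauss k.+1) (gauss k.+2) ((-1) ^+ j) g0 g1 q1 q2 f0 k2.
move=> A B C D G G' E G0 G0' A0 B0 C0 D0; field.
by rewrite A0 B0 C0 D0 !gt_eqF.
Qed.

(** The square of [area] brings in the moment of order m twice, so a ratio of moments of consecutive
    orders 2j and 2j + 1 survives; [gauss_even_odd] evaluates it. Its sqrt pi is the power left over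
    after the division by pi. *)
Lemma lambda_even m j : (0 < j)%N -> (m.+1 = 2 * j + 2)%N ->
  lambda_n R m.+1 / pi * (2 * (-1) ^+ j * (2 ^+ j * j`!%:R) ^+ 2 * @area R m.+1 ^+ 2) = 1.
Proof.
move=> j0 mE; have m1 : (1 < m)%N by lia.
have -> : m = (2 * j).+1 by lia.
set k := (2 * j)%N.
rewrite lambda_gauss//; last by rewrite /k; lia.
have -> : ((k.+2)./2 - 1 = j)%N by rewrite /k; lia.
have ha := @area_gauss R k.+1.
have g1 := @gauss_gt0 R k.+1; have g0 := @gauss_gt0 R k.
have p0 := sqrtpi_gt0.
have -> : @area R k.+2 = Num.sqrt pi ^+ k.+2 / gauss k.+1 by rewrite -ha mulfK// gt_eqF.
have h := @gauss_even_odd R j; rewrite -/k in h.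
rewrite /= -{2}(sqr_sqrtr (pi_ge0 R)).
have -> : (2 * k.+1).+1 = (k + k).+3%N by lia.
have s1 : (-1) ^+ j * (-1) ^+ j = 1 :> R by rewrite -exprMn mulrNN mulr1 expr1n.
have f0 : k`!%:R != 0 :> R by rewrite pnatr_eq0 -lt0n fact_gt0.
transitivity (((-1) ^+ j * (-1) ^+ j) * ((@gauss R k * (2 ^+ j * j`!%:R) ^+ 2) / (Num.sqrt pi * k`!%:R * @gauss R k.+1))); last first.
  rewrite h s1 mul1r mulfV// !mulf_neq0// gt_eqF//.
have -> : Num.sqrt (pi : R) ^+ (k + k).+3 = Num.sqrt pi ^+ 3 * (Num.sqrt pi ^+ k * Num.sqrt pi ^+ k).
  by rewrite -!exprD; congr (_ ^+ _); lia.
have -> : Num.sqrt (pi : R) ^+ k.+2 = Num.sqrt pi ^+ 2 * Num.sqrt pi ^+ k by rewrite -exprD.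
have q0 : Num.sqrt (pi : R) ^+ k != 0 by rewrite expf_neq0// gt_eqF.
move: (Num.sqrt (pi : R) ^+ k) (k`!%:R : R) (@gauss R k) (@gauss R k.+1) ((-1) ^+ j : R) (Num.sqrt (pi : R)) (2 ^+ j * j`!%:R : R) p0 g0 g1 q0 f0.
move=> A B C D E F G F0 C0 D0 A0 B0; field.
by rewrite A0 B0 !gt_eqF.
Qed.

End constants.

Theorem theorem3p1 (R : realType) (n : nat) (f : 'rV[R]_(n + 1) -> R) :
  (2 < n)%N -> Ctilde_e f ->
  forall x : 'rV[R]_(n + 1), on_sphere x -> enorm (xprime x) < 1 ->
  (odd n ->
     f x = lambda_n R n * `|xlast x| *
       - laplacian (fun y : 'rV[R]_n =>
           sphInt (fun theta : 'rV[R]_n =>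
             derive1n (n - 3) (Vweight f theta) (dotv theta y))) (xprime x)) /\
  (~~ odd n ->
     f x = lambda_n R n / pi * `|xlast x| *
       laplacian (fun y : 'rV[R]_n =>
           sphInt (fun theta : 'rV[R]_n =>
             \int[@lebesgue_measure R]_(t in `[-1, 1]%classic)
               (derive1n (n - 2) (Vweight f theta) t * ln `|t - dotv theta y|)))
         (xprime x)).
Proof.
case: n f => // m f m1 /sphere_density[rho [phi [rho0 rho1 phiC fphi]]] x Sx _.
have m1' : (1 < m)%N by [].
split => [on|en].
  have [j nE] : exists j, (m.+1 = 2 * j + 3)%N.
    (* This j is also the exponent [n/2 - 1] of the sign in [lambda_n]. *)
    by exists ((m.+1)./2 - 1)%N; lia.
  have -> : (m.+1 - 3 = 2 * j)%N by lia.
  rewrite (laplacian_odd_backprojection m1' rho1 phiC fphi _ nE) fphi//.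
  have -> : (-1) ^+ j.+1 = - (-1) ^+ j :> R by rewrite exprS mulN1r.
  rewrite -[LHS]mulr1 -[X in _ * X = _](lambda_odd nE) -[m.+1.-1]/m; ring.
have [j nE] : exists j, (m.+1 = 2 * j + 2)%N.
  by exists ((m.+1)./2 - 1)%N; lia.
have j0 : (0 < j)%N by lia.
have -> : (m.+1 - 2 = 2 * j)%N by lia.
rewrite (laplacian_even_backprojection m1' rho1 phiC fphi _ j0 nE) fphi//.
rewrite -[LHS]mulr1 -[X in _ * X = _](lambda_even j0 nE); ring.
Qed.
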